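(* Let $k$ be a perfect field of characteristic $p>0$ and let $X$ be a smooth, geometrically irreducible scheme over $k$. For integers $t\ge 0$ let $\mathsf{Strat}(X,t)$ be the category of $t$-stratified bundles on $X$. Then: 1) For every integer $t\ge 0$, $\mathsf{Strat}(X,t)$ is a $k$-linear, abelian, rigid, tensor category. 2) For every integer $t\ge 0$, the functor $$(+):\mathsf{Strat}(X,t)\to \mathsf{Strat}(X,t+1),\qquad (E^{(i)},\sigma^{(0)},\sigma^{(i)}, i\ge 1)\mapsto (E^{(i)}, F^{(-t-1)*}\sigma^{(0)},\sigma^{(i)}, i\ge 1)$$ is a fully faithful embedding of $k$-linear, abelian, rigid, tensor categories. 3) If $x\in X(k)$ is a rational point, then for every integer $t\ge 0$ the functor $$\omega_x:\mathsf{Strat}(X,t)\to \mathsf{Vec}_k,\qquad (E^{(i)},\sigma^{(i)})\mapsto E^{(0)}|_x$$ is a fiber functor, which makes $(\mathsf{Strat}(X,t),\omega_x)$ a (neutral) Tannaka category.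
   Context: Frobenius twists. Let $F_k:\operatorname{Spec} k\to\operatorname{Spec} k$ be the absolute Frobenius. Set $X^{(0)}=X$, and for $i\in\mathbb{Z}$ let $X^{(i+1)}=X^{(i)}\otimes_{k,F_k}k$ and $X^{(i-1)}=X^{(i)}\otimes_{k,F_k^{-1}}k$ (possible since $k$ is perfect). Let $F^{(i)}:X^{(i)}\to X^{(i+1)}$ be the relative Frobenius over $k$. For integers $a<b$, $F^{(a,b)}:X^{(a)}\to X^{(b)}$ is the composite of the relative Frobenii $F^{(a)},\dots,F^{(b-1)}$, and $F^{(a,a)}=\mathrm{id}$. $t$-stratified bundles. Let $t\ge 0$. A $t$-stratified bundle on $X$ is a sequence $(E^{(i)},\sigma^{(i)}, i\in\mathbb{N})$ (with $0\in\mathbb N$), where $E^{(i)}$ is a coherent sheaf on $X^{(i)}$, $\sigma^{(i)}:E^{(i)}\xrightarrow{\cong}F^{(i)*}E^{(i+1)}$ is an $\mathcal{O}_{X^{(i)}}$-isomorphism for each $i\ge 1$, and $\sigma^{(0)}:F^{(-t,0)*}E^{(0)}\xrightarrow{\cong}F^{(-t,1)*}E^{(1)}$ is an $\mathcal{O}_{X^{(-t)}}$-isomorphism. A morphism $(D^{(i)},\tau^{(i)})\to(E^{(i)},\sigma^{(i)})$ is a sequence of $\mathcal{O}_{X^{(i)}}$-linear maps $f_i:D^{(i)}\to E^{(i)}$ commuting with all the $\tau^{(i)}$ and $\sigma^{(i)}$ (after the relevant Frobenius pullbacks). These form the category $\mathsf{Strat}(X,t)$; tensor products are taken termwise. $\mathsf{Vec}_k$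 is the category of finite dimensional $k$-vector spaces. A fiber functor is an exact, $k$-linear functor compatible with the tensor structure. *)

(* Defs.v *)
From HB Require Import structures.
From mathcomp Require Import all_boot all_order all_algebra generic_quotient.
From mathcomp Require Import boolp.

Set Implicit Arguments.
Unset Strict Implicit.
Unset Printing Implicit Defensive.

(* Schemes over k are treated through their functors of points on commutative
   k-algebras (Demazure-Gabriel, Groupes algebriques, I.1): a k-scheme is a
   Zariski sheaf covered by open affine subfunctors. Rings are [comPzRingType]s
   because the zero ring is needed as a test algebra. *)

Import GRing.Theory.
Local Open Scope ring_scope.
Local Open Scope quotient_scope.

Definition semilinear (A B : comPzRingType) (f : A -> B)
    (M : lmodType A) (N : lmodType B) (g : M -> N) : Prop :=
  (forall u v, g (u + v) = g u + g v) /\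
  (forall a u, g (a *: u) = f a *: g u).

(* g exhibits N as the base change of M along f, i.e. the B-linear map
   B (x)_A M -> N induced by g is an isomorphism. *)
Definition is_base_change (A B : comPzRingType) (f : A -> B)
    (M : lmodType A) (N : lmodType B) (g : M -> N) : Prop :=
  semilinear f g /\
  forall (P : lmodType B) (h : M -> P), semilinear f h ->
    exists! h' : N -> P, linear h' /\ forall u, h' (g u) = h u.

Definition finitely_generated (A : comPzRingType) (M : lmodType A) : Prop :=
  exists (n : nat) (e : 'I_n -> M),
    forall u, exists c : 'I_n -> A, u = \sum_i c i *: e i.

Section TensorProduct.
Variables (A : comPzRingType) (M N : lmodType A).

Definition balanced (T : zmodType) (h : M -> N -> T) : Prop :=
  [/\ forall u u' v, h (u + u') v = h u v + h u' v,
      forall u v v', h u (v + v') = h u v + h u v' &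
      forall a u v, h (a *: u) v = h u (a *: v)].

Definition fsum (T : zmodType) (h : M -> N -> T) (s : seq (M * N)) : T :=
  \sum_(q <- s) h q.1 q.2.

(* M (x)_A N: formal sums of pairs, identified when no balanced map to an
   abelian group separates them. *)
Definition tens_rel (s s' : seq (M * N)) : bool :=
  `[< forall (T : zmodType) (h : M -> N -> T), balanced h ->
        fsum h s = fsum h s' >].

Lemma tens_rel_refl : reflexive tens_rel.
Proof. by move=> s; apply/asboolP. Qed.

Lemma tens_rel_sym : symmetric tens_rel.
Proof. by move=> s s'; apply/asboolP/asboolP => H T h bh; rewrite (H T h). Qed.

Lemma tens_rel_trans : transitive tens_rel.
Proof.
move=> s s' s'' /asboolP H1 /asboolP H2; apply/asboolP => T h bh.
by rewrite (H1 T h) // (H2 T h).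
Qed.

Canonical tens_equiv := EquivRel tens_rel tens_rel_refl tens_rel_sym tens_rel_trans.

Definition tens : Type := {eq_quot tens_equiv}.
HB.instance Definition _ := Choice.on tens.
HB.instance Definition _ := EqQuotient.on tens.

Definition teval (T : zmodType) (h : M -> N -> T) (x : tens) : T :=
  fsum h (repr x).

Definition pure (u : M) (v : N) : tens := \pi_tens [:: (u, v)].

Lemma teval_pi (T : zmodType) (h : M -> N -> T) s :
  balanced h -> teval h (\pi_tens s) = fsum h s.
Proof.
move=> bh; rewrite /teval.
have /asboolP H : tens_rel (repr (\pi_tens s)) s.
  by apply/(eqmodP tens_equiv (repr (\pi_tens s)) s); rewrite reprK.
exact: H.
Qed.

Lemma tens_ext (x y : tens) :
  (forall (T : zmodType) (h : M -> N -> T), balanced h ->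
     teval h x = teval h y) -> x = y.
Proof.
move=> H; rewrite -[x]reprK -[y]reprK; apply/(eqmodP tens_equiv).
by apply/asboolP => T h bh; exact: (H T h bh).
Qed.

Lemma fsum_cat (T : zmodType) (h : M -> N -> T) s s' :
  fsum h (s ++ s') = fsum h s + fsum h s'.
Proof. by rewrite /fsum big_cat. Qed.

Lemma fsum_map (T : zmodType) (h : M -> N -> T) (f : M -> M) s :
  fsum h [seq (f q.1, q.2) | q <- s] = fsum (fun u => h (f u)) s.
Proof. by rewrite /fsum big_map. Qed.

Definition tens0 : tens := \pi_tens [::].
Definition tens_add (x y : tens) : tens := \pi_tens (repr x ++ repr y).
Definition tens_opp (x : tens) : tens :=
  \pi_tens [seq (- q.1, q.2) | q <- repr x].
Definition tens_scale (a : A) (x : tens) : tens :=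
  \pi_tens [seq (a *: q.1, q.2) | q <- repr x].

Lemma balanced_opp (T : zmodType) (h : M -> N -> T) u v :
  balanced h -> h (- u) v = - h u v.
Proof.
case=> hl _ _; apply/eqP; rewrite -addr_eq0 -hl addNr.
by have := hl 0 0 v; rewrite addr0 => /eqP; rewrite -subr_eq0 opprD addrA subrr add0r oppr_eq0.
Qed.

Lemma balanced_scale (T : zmodType) (h : M -> N -> T) a :
  balanced h -> balanced (fun u => h (a *: u)).
Proof.
case=> hl hr hb; split=> *; rewrite ?scalerDr ?hl ?hr //.
by rewrite scalerA mulrC -scalerA hb.
Qed.

Lemma teval0 (T : zmodType) (h : M -> N -> T) : balanced h -> teval h tens0 = 0.
Proof. by move=> bh; rewrite teval_pi // /fsum big_nil. Qed.

Lemma tevalD (T : zmodType) (h : M -> N -> T) x y :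
  balanced h -> teval h (tens_add x y) = teval h x + teval h y.
Proof. by move=> bh; rewrite teval_pi // fsum_cat. Qed.

Lemma tevalN (T : zmodType) (h : M -> N -> T) x :
  balanced h -> teval h (tens_opp x) = - teval h x.
Proof.
move=> bh; rewrite teval_pi // fsum_map /teval /fsum -sumrN.
by apply: eq_bigr => q _; rewrite balanced_opp.
Qed.

Lemma tevalZ (T : zmodType) (h : M -> N -> T) a x :
  balanced h -> teval h (tens_scale a x) = teval (fun u => h (a *: u)) x.
Proof. by move=> bh; rewrite teval_pi // fsum_map. Qed.

Lemma tens_addA : associative tens_add.
Proof. by move=> x y z; apply: tens_ext => T h bh; rewrite !tevalD // addrA. Qed.
Lemma tens_addC : commutative tens_add.
Proof. by move=> x y; apply: tens_ext => T h bh; rewrite !tevalD // addrC. Qed.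
Lemma tens_add0 : left_id tens0 tens_add.
Proof. by move=> x; apply: tens_ext => T h bh; rewrite tevalD // teval0 // add0r. Qed.
Lemma tens_addN : left_inverse tens0 tens_opp tens_add.
Proof.
by move=> x; apply: tens_ext => T h bh; rewrite tevalD // tevalN // teval0 // addNr.
Qed.

HB.instance Definition _ :=
  GRing.isZmodule.Build tens tens_addA tens_addC tens_add0 tens_addN.

Lemma tens_scaleA a b x : tens_scale a (tens_scale b x) = tens_scale (a * b) x.
Proof.
apply: tens_ext => T h bh; rewrite !tevalZ //; last exact: balanced_scale.
by rewrite /teval /fsum; apply: eq_bigr => q _; rewrite scalerA mulrC.
Qed.
Lemma tens_scale1 : left_id 1 tens_scale.
Proof.
move=> x; apply: tens_ext => T h bh; rewrite tevalZ //.
by rewrite /teval /fsum; apply: eq_bigr => q _; rewrite scale1r.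
Qed.
Lemma tens_scaleDr : right_distributive tens_scale +%R.
Proof.
move=> a x y; apply: tens_ext => T h bh; rewrite tevalZ // !tevalD //.
  by rewrite !tevalZ.
exact: balanced_scale.
Qed.
Lemma tens_scaleDl x : {morph tens_scale^~ x : a b / a + b}.
Proof.
move=> a b; apply: tens_ext => T h bh; rewrite tevalD // !tevalZ //.
rewrite /teval /fsum -big_split; apply: eq_bigr => q _ /=.
by rewrite scalerDl; case: bh => ->.
Qed.

HB.instance Definition _ :=
  GRing.Zmodule_isLmodule.Build A tens tens_scaleA tens_scale1 tens_scaleDr tens_scaleDl.

Lemma teval_pure (T : zmodType) (h : M -> N -> T) u v :
  balanced h -> teval h (pure u v) = h u v.
Proof. by move=> bh; rewrite teval_pi // /fsum big_seq1. Qed.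

Lemma teval_add (T : zmodType) (h : M -> N -> T) (x y : tens) :
  balanced h -> teval h (x + y) = teval h x + teval h y.
Proof. exact: tevalD. Qed.

Lemma balanced_pure : balanced pure.
Proof.
split=> *; apply: tens_ext => T h bh; rewrite ?tevalD // !teval_pure //;
  by case: bh.
Qed.

Lemma scale_pure a u v : a *: pure u v = pure (a *: u) v.
Proof.
apply: tens_ext => T h bh; rewrite tevalZ // !teval_pure //.
exact: balanced_scale.
Qed.

Lemma tens_sum (x : tens) : x = \sum_(q <- repr x) pure q.1 q.2.
Proof.
apply: tens_ext => T h bh; rewrite {1}/teval /fsum.
elim: (repr x) => [|q s IH]; first by rewrite !big_nil teval0.
by rewrite !big_cons tevalD // IH teval_pure.
Qed.

Lemma tens_ind (P : tens -> Prop) :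
  P 0 -> (forall x y, P x -> P y -> P (x + y)) -> (forall u v, P (pure u v)) ->
  forall x, P x.
Proof.
move=> P0 PD Pp x; rewrite (tens_sum x).
by elim: (repr x) => [|q s IH]; rewrite ?big_nil ?big_cons //; apply: PD.
Qed.

Lemma tens_eq_fun (T : zmodType) (g g' : tens -> T) :
  (forall x y, g (x + y) = g x + g y) -> (forall x y, g' (x + y) = g' x + g' y) ->
  (forall u v, g (pure u v) = g' (pure u v)) -> forall x, g x = g' x.
Proof.
move=> gD gD' gp; elim/tens_ind => [|x y IHx IHy|] //; last by rewrite gD gD' IHx IHy.
have z (f : tens -> T) : (forall x y, f (x + y) = f x + f y) -> f 0 = 0.
  by move=> fD; have := fD 0 0; rewrite addr0 => /eqP; rewrite -subr_eq0 opprD addrA subrr add0r oppr_eq0 => /eqP.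
by rewrite !z.
Qed.

End TensorProduct.

Section TensorMaps.

Lemma linear_semilinear (A : comPzRingType) (M N : lmodType A) (g : M -> N) :
  linear g <-> semilinear id g.
Proof.
split=> [gl|[gD gZ] a u v]; last by rewrite gD gZ.
have gD u v : g (u + v) = g u + g v by have := gl 1 u v; rewrite !scale1r.
split=> // a u.
have g0 : g 0 = 0.
  by have := gD 0 0; rewrite addr0 => /eqP; rewrite -subr_eq0 opprD addrA subrr add0r oppr_eq0 => /eqP.
by have := gl a u 0; rewrite g0 !addr0.
Qed.

Definition tens_map (A B : comPzRingType) (M N : lmodType A) (M' N' : lmodType B)
    (f : M -> M') (g : N -> N') : tens M N -> tens M' N' :=
  teval (fun u v => pure (f u) (g v)).

Definition tens_assoc (A : comPzRingType) (M N P : lmodType A) :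
    tens (tens M N) P -> tens M (tens N P) :=
  teval (fun x w => teval (fun u v => pure u (pure v w)) x).

Definition tens_lunit (A : comPzRingType) (M : lmodType A) : tens A^o M -> M :=
  teval (fun (a : A^o) u => (a : A) *: u).

Definition tens_runit (A : comPzRingType) (M : lmodType A) : tens M A^o -> M :=
  teval (fun u (a : A^o) => (a : A) *: u).

Definition tens_braid (A : comPzRingType) (M N : lmodType A) :
    tens M N -> tens N M :=
  teval (fun u v => pure v u).

Lemma teval_semilinear (A B : comPzRingType) (f : A -> B) (M N : lmodType A)
    (P : lmodType B) (h : M -> N -> P) :
  balanced h -> (forall a u v, h (a *: u) v = f a *: h u v) ->
  semilinear f (teval h).
Proof.
move=> bh hZ; split=> [x y|a x]; first exact: teval_add.
rewrite [LHS]tevalZ // /teval /fsum scaler_sumr.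
by apply: eq_bigr => q _; rewrite hZ.
Qed.

Lemma tens_map_balanced (A B : comPzRingType) (f : A -> B) (M N : lmodType A)
    (M' N' : lmodType B) (g : M -> M') (g' : N -> N') :
  semilinear f g -> semilinear f g' ->
  balanced (fun u v => pure (g u) (g' v)).
Proof.
have [bl br bb] := balanced_pure M' N'.
by move=> [gD gZ] [gD' gZ']; split=> *; rewrite ?gD ?gD' ?gZ ?gZ' ?bl ?br ?bb.
Qed.

Lemma tens_map_pure (A B : comPzRingType) (f : A -> B) (M N : lmodType A)
    (M' N' : lmodType B) (g : M -> M') (g' : N -> N') u v :
  semilinear f g -> semilinear f g' ->
  tens_map g g' (pure u v) = pure (g u) (g' v).
Proof. by move=> sg sg'; rewrite /tens_map teval_pure //; apply: tens_map_balanced sg'. Qed.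

Lemma tens_map_semilinear (A B : comPzRingType) (f : A -> B) (M N : lmodType A)
    (M' N' : lmodType B) (g : M -> M') (g' : N -> N') :
  semilinear f g -> semilinear f g' -> semilinear f (tens_map g g').
Proof.
move=> sg sg'; apply: teval_semilinear; first exact: tens_map_balanced sg'.
by move=> a u v; rewrite sg.2 scale_pure.
Qed.

Lemma tens_map_linear (A : comPzRingType) (M N M' N' : lmodType A)
    (g : M -> M') (g' : N -> N') :
  linear g -> linear g' -> linear (tens_map g g').
Proof.
move=> /linear_semilinear sg /linear_semilinear sg'.
exact/linear_semilinear/(tens_map_semilinear sg sg').
Qed.

Lemma semilinear_comp (A B C : comPzRingType) (f : A -> B) (f' : B -> C)
    (M : lmodType A) (N : lmodType B) (P : lmodType C) (g : M -> N) (g' : N -> P) :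
  semilinear f g -> semilinear f' g' ->
  semilinear (fun a => f' (f a)) (fun u => g' (g u)).
Proof.
by move=> [gD gZ] [gD' gZ']; split=> *; rewrite ?gD ?gD' ?gZ ?gZ'.
Qed.

Lemma tens_map_comp (A B C : comPzRingType) (f : A -> B) (f' : B -> C)
    (M N : lmodType A) (M' N' : lmodType B) (M'' N'' : lmodType C)
    (g : M -> M') (h : N -> N') (g' : M' -> M'') (h' : N' -> N'') x :
  semilinear f g -> semilinear f h -> semilinear f' g' -> semilinear f' h' ->
  tens_map g' h' (tens_map g h x) =
  tens_map (fun u => g' (g u)) (fun v => h' (h v)) x.
Proof.
move=> sg sh sg' sh'.
have sG := semilinear_comp sg sg'; have sH := semilinear_comp sh sh'.
have [D _] := tens_map_semilinear sg sh; have [D' _] := tens_map_semilinear sg' sh'.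
have [D'' _] := tens_map_semilinear sG sH.
move: x; apply: tens_eq_fun => [x y|x y|u v]; rewrite ?D ?D' ?D'' //.
by rewrite (tens_map_pure _ _ sg sh) (tens_map_pure _ _ sg' sh') (tens_map_pure _ _ sG sH).
Qed.

Lemma tens_map_id (A : comPzRingType) (M N : lmodType A) (g : M -> M) (h : N -> N) x :
  (forall u, g u = u) -> (forall v, h v = v) -> tens_map g h x = x.
Proof.
move=> /funext-> /funext->.
have sM : semilinear id (id : M -> M) by [].
have sN : semilinear id (id : N -> N) by [].
move: x; apply: tens_eq_fun => // [x y|u v]; last exact: tens_map_pure sM sN.
by have [-> _] := tens_map_semilinear sM sN.
Qed.

Lemma tens_map_base_change (A B : comPzRingType) (f : A -> B) (M N : lmodType A)
    (M' N' : lmodType B) (g : M -> M') (g' : N -> N') :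
  is_base_change f g -> is_base_change f g' -> is_base_change f (tens_map g g').
Proof.
move=> [sg ug] [sg' ug']; split; first exact: tens_map_semilinear.
move=> P h [hD hZ].
have [bl br bb] := balanced_pure M N.
have [bl' br' bb'] := balanced_pure M' N'.
have scl (u : M) (v : N) (a : A) : pure u (a *: v) = a *: pure u v.
  by rewrite scale_pure; case: (balanced_pure M N).
have scl' (u : M') (v : N') (a : B) : pure u (a *: v) = a *: pure u v.
  by rewrite scale_pure; case: (balanced_pure M' N').
have shu u : semilinear f (fun v => h (pure u v)).
  by split=> *; rewrite ?br ?scl ?hD ?hZ.
have [K HK] := choice (fun u => ug' P _ (shu u)).
have Kl u : linear (K u) by case: (HK u) => -[].
have KE u v : K u (g' v) = h (pure u v) by case: (HK u) => -[].
have KU u k : linear k -> (forall v, k (g' v) = h (pure u v)) -> K u = k.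
  by move=> kl kE; case: (HK u) => _; apply.
have Ks u := (linear_semilinear (K u)).1 (Kl u).
have sK n : semilinear f (fun u => K u n).
  split=> [u u'|a u].
    rewrite (KU (u + u') (fun n => K u n + K u' n)) //.
      by move=> a x y; rewrite !(Kl _) scalerDr addrACA.
    by move=> v; rewrite !KE bl hD.
  rewrite (KU (a *: u) (fun n => f a *: K u n)) //.
    by move=> b x y; rewrite !(Kl _) scalerDr !scalerA mulrC.
  by move=> v; rewrite !KE -scale_pure hZ.
have [L HL] := choice (fun n => ug P _ (sK n)).
have Ll n : linear (L n) by case: (HL n) => -[].
have LE n u : L n (g u) = K u n by case: (HL n) => -[].
have LU n k : linear k -> (forall u, k (g u) = K u n) -> L n = k.
  by move=> kl kE; case: (HL n) => _; apply.
have Ls n := (linear_semilinear (L n)).1 (Ll n).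
have LD n n' m : L (n + n') m = L n m + L n' m.
  rewrite (LU (n + n') (fun m => L n m + L n' m)) //.
    by move=> a x y; rewrite !(Ll _) scalerDr addrACA.
  by move=> u; rewrite !LE (Ks u).1.
have LZ a n m : L (a *: n) m = a *: L n m.
  rewrite (LU (a *: n) (fun m => a *: L n m)) //.
    by move=> b x y; rewrite !(Ll _) scalerDr !scalerA mulrC.
  by move=> u; rewrite !LE (Ks u).2.
have bL : balanced (fun m n => L n m).
  by split=> *; rewrite ?LD ?LZ ?(Ls _).1 ?(Ls _).2.
have sL : semilinear id (teval (fun m n => L n m)).
  by apply: teval_semilinear => // a u v; rewrite (Ls v).2.
have sT := tens_map_semilinear sg sg'.
exists (teval (fun m n => L n m)); split; first split.
- exact/linear_semilinear.
- apply: tens_eq_fun => // [x y|u v]; first by rewrite sT.1 sL.1.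
  by rewrite (tens_map_pure _ _ sg sg') teval_pure // LE KE.
move=> k [/linear_semilinear[kD kZ] kE]; apply/funext; apply: tens_eq_fun => //.
  by move=> x y; rewrite sL.1.
move=> m n; rewrite teval_pure //.
rewrite (LU n (fun m => k (pure m n))) //.
  by apply/linear_semilinear; split=> *; rewrite ?bl' ?kD // -scale_pure kZ.
move=> u; rewrite (KU u (fun n => k (pure (g u) n))) //.
  by apply/linear_semilinear; split=> *; rewrite ?br' ?kD // scl' kZ.
by move=> v; rewrite -kE (tens_map_pure _ _ sg sg').
Qed.

Lemma tens_fg (A : comPzRingType) (M N : lmodType A) :
  finitely_generated M -> finitely_generated N -> finitely_generated (tens M N).
Proof.
move=> [m [e He]] [n [e' He']].
have [bl br bb] := balanced_pure M N.
have p0l (v : N) : pure (0 : M) v = 0 by have := scale_pure 0 (0 : M) v; rewrite scaler0 scale0r => <-.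
have p0r (u : M) : pure u (0 : N) = 0.
  by have := bb 0 u 0; rewrite scaler0 -scale_pure scale0r => <-.
have suml I r (F : I -> M) (v : N) :
    pure (\sum_(i <- r) F i) v = \sum_(i <- r) pure (F i) v.
  by elim: r => [|i r IH]; rewrite ?big_nil ?big_cons // bl IH.
have sumr I r (F : I -> N) (u : M) :
    pure u (\sum_(i <- r) F i) = \sum_(i <- r) pure u (F i).
  by elim: r => [|i r IH]; rewrite ?big_nil ?big_cons // br IH.
pose E (i : 'I_#|{: 'I_m * 'I_n}|) := pure (e (enum_val i).1) (e' (enum_val i).2).
exists #|{: 'I_m * 'I_n}|, E; elim/tens_ind => [|x y [c ->] [d ->]|u v].
- by exists (fun=> 0); rewrite big1 // => i _; rewrite scale0r.
- exists (fun i => c i + d i); rewrite -big_split /=.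
  by apply: eq_bigr => i _; rewrite scalerDl.
have [c ->] := He u; have [d ->] := He' v.
exists (fun i => c (enum_val i).1 * d (enum_val i).2).
rewrite suml (eq_bigr (fun i => \sum_j (c i * d j) *: pure (e i) (e' j))); last first.
  move=> i _; rewrite sumr; apply: eq_bigr => j _.
  by rewrite -bb scale_pure scalerA mulrC.
rewrite pair_big /= (reindex (@enum_val _ {: 'I_m * 'I_n})) //=.
by exists enum_rank => x _; rewrite ?enum_rankK ?enum_valK.
Qed.

Section Assoc.
Variables (A : comPzRingType) (M N P : lmodType A).

Let bal_in (w : P) : balanced (fun (u : M) (v : N) => pure u (pure v w)).
Proof.
have [l r b] := balanced_pure M (tens N P).
have [l' r' b'] := balanced_pure N P.
by split=> *; [rewrite l|rewrite l' r|rewrite b scale_pure].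
Qed.

Let bal_out : balanced
  (fun (x : tens M N) (w : P) => teval (fun u v => pure u (pure v w)) x).
Proof.
have [l r b] := balanced_pure M (tens N P).
have [l' r' b'] := balanced_pure N P.
split=> [x y w|x w w'|a x w].
- exact: teval_add.
- move: x; apply: tens_eq_fun => [x y|x y|u v].
  + by rewrite teval_add.
  + by rewrite !teval_add // addrACA.
  + by rewrite !teval_pure // r' r.
- move: x; apply: tens_eq_fun => [x y|x y|u v].
  + by rewrite scalerDr teval_add.
  + by rewrite teval_add.
  + by rewrite scale_pure !teval_pure // b scale_pure b'.
Qed.

Lemma tens_assoc_pure u v w :
  tens_assoc (pure (pure u v) w) = pure (u : M) (pure (v : N) (w : P)).
Proof. by rewrite /tens_assoc teval_pure // teval_pure. Qed.

Lemma tens_assoc_linear : linear (@tens_assoc A M N P).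
Proof.
apply/linear_semilinear/teval_semilinear => // a x w; move: x.
apply: tens_eq_fun => [x y|x y|u v].
- by rewrite scalerDr teval_add.
- by rewrite teval_add // scalerDr.
- by rewrite scale_pure !teval_pure // scale_pure.
Qed.

Lemma tens3_eq_fun (T : zmodType) (g g' : tens (tens M N) P -> T) :
  (forall x y, g (x + y) = g x + g y) -> (forall x y, g' (x + y) = g' x + g' y) ->
  (forall u v w, g (pure (pure u v) w) = g' (pure (pure u v) w)) ->
  forall x, g x = g' x.
Proof.
move=> gD gD' H; apply: tens_eq_fun => // x w; move: x.
have [l _ _] := balanced_pure (tens M N) P.
by apply: tens_eq_fun => [x y|x y|u v]; rewrite ?l.
Qed.

End Assoc.

Lemma linearDE (A : comPzRingType) (M N : lmodType A) (g : M -> N) :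
  linear g -> forall u v, g (u + v) = g u + g v.
Proof. by move=> /linear_semilinear[]. Qed.

Lemma tens_assoc_nat (A B : comPzRingType) (f : A -> B) (M N P : lmodType A)
    (M' N' P' : lmodType B) (g : M -> M') (h : N -> N') (k : P -> P') x :
  semilinear f g -> semilinear f h -> semilinear f k ->
  tens_assoc (tens_map (tens_map g h) k x) = tens_map g (tens_map h k) (tens_assoc x).
Proof.
move=> sg sh sk.
have sgh := tens_map_semilinear sg sh; have shk := tens_map_semilinear sh sk.
have s1 := tens_map_semilinear sgh sk; have s2 := tens_map_semilinear sg shk.
move: x; apply: tens3_eq_fun => [x y|x y|u v w].
- by rewrite s1.1 linearDE //; exact: tens_assoc_linear.
- by rewrite linearDE ?s2.1 //; exact: tens_assoc_linear.
- rewrite tens_assoc_pure (tens_map_pure _ _ sgh sk) (tens_map_pure _ _ sg sh).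
  by rewrite tens_assoc_pure (tens_map_pure _ _ sg shk) (tens_map_pure _ _ sh sk).
Qed.

Section Units.
Variables (A : comPzRingType) (M : lmodType A).

Lemma lunit_balanced : balanced (fun (a : A^o) (u : M) => (a : A) *: u).
Proof.
split=> *; rewrite ?scalerDl ?scalerDr //.
by rewrite scalerA mulrC.
Qed.

Lemma runit_balanced : balanced (fun (u : M) (a : A^o) => (a : A) *: u).
Proof.
split=> *; rewrite ?scalerDl ?scalerDr //.
by rewrite scalerA mulrC.
Qed.

Lemma tens_lunit_linear : linear (@tens_lunit A M).
Proof.
apply/linear_semilinear/teval_semilinear; first exact: lunit_balanced.
by move=> a u v; rewrite scalerA.
Qed.

Lemma tens_runit_linear : linear (@tens_runit A M).
Proof.
apply/linear_semilinear/teval_semilinear; first exact: runit_balanced.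
by move=> a u v; rewrite !scalerA mulrC.
Qed.

Lemma tens_braid_linear (N : lmodType A) : linear (@tens_braid A M N).
Proof.
have [l r b] := balanced_pure N M.
apply/linear_semilinear/teval_semilinear; first by split=> *; rewrite ?l ?r ?b.
by move=> a u v; rewrite -b scale_pure.
Qed.

Lemma tens_braid_pure (N : lmodType A) u v :
  tens_braid (pure (u : M) (v : N)) = pure v u.
Proof.
have [l r b] := balanced_pure N M.
by rewrite /tens_braid teval_pure //; split=> *; rewrite ?l ?r ?b.
Qed.

End Units.

Lemma tens_lunit_nat (A B : comPzRingType) (f : {rmorphism A -> B})
    (M : lmodType A) (M' : lmodType B) (g : M -> M') x :
  semilinear f g ->
  tens_lunit (@tens_map A B A^o M B^o M' f g x) = g (tens_lunit x).
Proof.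
move=> sg.
have sf : @semilinear A B f A^o B^o f by split=> *; rewrite ?rmorphD ?rmorphM.
have s1 := tens_map_semilinear sf sg.
move: x; apply: tens_eq_fun => [x y|x y|u v].
- by rewrite s1.1 linearDE //; exact: tens_lunit_linear.
- by rewrite linearDE ?sg.1 //; exact: tens_lunit_linear.
- rewrite (tens_map_pure _ _ sf sg) /tens_lunit !teval_pure ?sg.2 //;
    exact: lunit_balanced.
Qed.

Lemma tens_runit_nat (A B : comPzRingType) (f : {rmorphism A -> B})
    (M : lmodType A) (M' : lmodType B) (g : M -> M') x :
  semilinear f g ->
  tens_runit (@tens_map A B M A^o M' B^o g f x) = g (tens_runit x).
Proof.
move=> sg.
have sf : @semilinear A B f A^o B^o f by split=> *; rewrite ?rmorphD ?rmorphM.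
have s1 := tens_map_semilinear sg sf.
move: x; apply: tens_eq_fun => [x y|x y|u v].
- by rewrite s1.1 linearDE //; exact: tens_runit_linear.
- by rewrite linearDE ?sg.1 //; exact: tens_runit_linear.
- rewrite (tens_map_pure _ _ sg sf) /tens_runit !teval_pure ?sg.2 //;
    exact: runit_balanced.
Qed.

Lemma tens_braid_nat (A B : comPzRingType) (f : A -> B) (M N : lmodType A)
    (M' N' : lmodType B) (g : M -> M') (h : N -> N') x :
  semilinear f g -> semilinear f h ->
  tens_braid (tens_map g h x) = tens_map h g (tens_braid x).
Proof.
move=> sg sh.
have s1 := tens_map_semilinear sg sh; have s2 := tens_map_semilinear sh sg.
move: x; apply: tens_eq_fun => [x y|x y|u v].
- by rewrite s1.1 linearDE //; exact: tens_braid_linear.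
- by rewrite linearDE ?s2.1 //; exact: tens_braid_linear.
- by rewrite (tens_map_pure _ _ sg sh) !tens_braid_pure (tens_map_pure _ _ sh sg).
Qed.

End TensorMaps.

Lemma rmorphism_ext (A B : pzSemiRingType) (f g : {rmorphism A -> B}) :
  f =1 g -> f = g.
Proof.
case: f g => [f [[a] [b]]] [g [[a'] [b']]] /= /funext fg.
move: fg a b a' b' => /= -> *.
by do ![f_equal; try exact: Prop_irrelevance].
Qed.

Section KFunctors.
Variable k : fieldType.

Record kAlg := KAlg {
  kcar :> comPzRingType;
  kstr : {rmorphism k -> kcar}
}.

Record kHom (A B : kAlg) := KHom {
  khom :> {rmorphism A -> B};
  khomP : forall c : k, khom (kstr A c) = kstr B c
}.

Lemma kHom_ext (A B : kAlg) (f g : kHom A B) : f =1 g -> f = g.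
Proof.
case: f g => [f fP] [g gP] /= /rmorphism_ext fg.
by move: fP gP; rewrite fg => *; f_equal; apply: Prop_irrelevance.
Qed.

Definition kbase : kAlg := KAlg (idfun : {rmorphism k -> k}).

Definition kid (A : kAlg) : kHom A A :=
  @KHom A A (idfun : {rmorphism A -> A}) (fun _ => erefl).

Lemma kcomp_subproof (A B C : kAlg) (g : kHom B C) (f : kHom A B) (c : k) :
  (g \o f : {rmorphism A -> C}) (kstr A c) = kstr C c.
Proof. by rewrite /= !khomP. Qed.

Definition kcomp (A B C : kAlg) (g : kHom B C) (f : kHom A B) : kHom A C :=
  KHom (kcomp_subproof g f).

Record kfunctor := KFunctor {
  pts :> kAlg -> Type;
  pmap : forall A B : kAlg, kHom A B -> pts A -> pts B;
  pmap_id : forall A (x : pts A), pmap (kid A) x = x;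
  pmap_comp : forall A B C (g : kHom B C) (f : kHom A B) (x : pts A),
    pmap (kcomp g f) x = pmap g (pmap f x)
}.

Record ktrans (X Y : kfunctor) := KTrans {
  kt :> forall A : kAlg, X A -> Y A;
  kt_nat : forall (A B : kAlg) (f : kHom A B) (x : X A),
    pmap f (kt x) = kt (pmap f x)
}.

Definition ktid (X : kfunctor) : ktrans X X :=
  @KTrans X X (fun _ x => x) (fun _ _ _ _ => erefl).

Lemma ktcomp_subproof (X Y Z : kfunctor) (g : ktrans Y Z) (f : ktrans X Y)
    (A B : kAlg) (u : kHom A B) (x : X A) :
  pmap u (g A (f A x)) = g B (f B (pmap u x)).
Proof. by rewrite !kt_nat. Qed.

Definition ktcomp (X Y Z : kfunctor) (g : ktrans Y Z) (f : ktrans X Y) :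
    ktrans X Z :=
  @KTrans X Z (fun A x => g A (f A x)) (ktcomp_subproof g f).

Lemma kspec_id (R A : kAlg) (u : kHom R A) : kcomp (kid A) u = u.
Proof. exact: kHom_ext. Qed.

Lemma kspec_comp (R A B C : kAlg) (g : kHom B C) (f : kHom A B) (u : kHom R A) :
  kcomp (kcomp g f) u = kcomp g (kcomp f u).
Proof. exact: kHom_ext. Qed.

Definition kspec (R : kAlg) : kfunctor :=
  @KFunctor (kHom R) (fun A B f u => kcomp f u) (@kspec_id R) (@kspec_comp R).

Section Product.
Variables X Y : kfunctor.
Let pr (A : kAlg) : Type := (X A * Y A)%type.
Let prmap (A B : kAlg) (f : kHom A B) (z : pr A) : pr B :=
  (pmap f z.1, pmap f z.2).
Lemma kprod_id A (z : pr A) : prmap (kid A) z = z.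
Proof. by case: z => x y; rewrite /prmap !pmap_id. Qed.
Lemma kprod_comp A B C (g : kHom B C) (f : kHom A B) (z : pr A) :
  prmap (kcomp g f) z = prmap g (prmap f z).
Proof. by rewrite /prmap !pmap_comp. Qed.
Definition kprod : kfunctor := KFunctor kprod_id kprod_comp.
End Product.

Definition is_field (A : kAlg) : Prop :=
  (1 : A) <> 0 /\ forall a : A, a <> 0 -> exists b : A, a * b = 1.

Definition generates_unit (A B : kAlg) (f : A -> B) (I : A -> Prop) : Prop :=
  exists (n : nat) (a : 'I_n -> A) (c : 'I_n -> B),
    (forall i, I (a i)) /\ \sum_i c i * f (a i) = 1.

Definition is_localization (A B : kAlg) (a : A) (f : A -> B) : Prop :=
  [/\ exists b, f a * b = 1,
      forall b : B, exists (c : A) (n : nat), b * f a ^+ n = f c &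
      forall c : A, f c = 0 -> exists n : nat, a ^+ n * c = 0].

Definition zariski_sheaf (X : kfunctor) : Prop :=
  forall (A : kAlg) (n : nat) (a : 'I_n -> A) (B : 'I_n -> kAlg)
         (l : forall i, kHom A (B i)),
    (exists c : 'I_n -> A, \sum_i c i * a i = 1) ->
    (forall i, is_localization (a i) (l i)) ->
    forall x : (forall i, X (B i)),
      (forall i j (C : kAlg) (u : kHom (B i) C) (v : kHom (B j) C),
         kcomp u (l i) = kcomp v (l j) -> pmap u (x i) = pmap v (x j)) ->
      exists! x0 : X A, forall i, pmap (l i) x0 = x i.

Definition subfun (X : kfunctor) : Type := forall A : kAlg, X A -> Prop.

(* The locus in Spec A where x lies in U is the complement of V(I). *)
Definition open_subfun (X : kfunctor) (U : subfun X) : Prop :=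
  forall (A : kAlg) (x : X A), exists I : A -> Prop,
    forall (B : kAlg) (f : kHom A B), U B (pmap f x) <-> generates_unit f I.

Definition represents (X : kfunctor) (U : subfun X) (R : kAlg) : Prop :=
  exists u : X R, forall (A : kAlg) (x : X A),
    (U A x -> exists! f : kHom R A, pmap f u = x) /\
    (forall f : kHom R A, pmap f u = x -> U A x).

(* Coverings are tested on field-valued points. *)
Definition covered_by_affines (P : kAlg -> Prop) (X : kfunctor) : Prop :=
  forall (K : kAlg), is_field K -> forall x : X K,
    exists (U : subfun X) (R : kAlg),
      [/\ open_subfun U, represents U R, P R & U K x].

Definition is_scheme (X : kfunctor) : Prop :=
  zariski_sheaf X /\ covered_by_affines (fun _ => True) X.

Definition fin_gen_alg (R : kAlg) : Prop :=
  exists s : seq R, forall P : R -> Prop,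
    (forall c : k, P (kstr R c)) -> {in s, forall r, P r} ->
    (forall a b, P a -> P b -> P (a + b)) ->
    (forall a b, P a -> P b -> P (a * b)) ->
    forall r, P r.

Definition formally_smooth (X : kfunctor) : Prop :=
  forall (A B : kAlg) (q : kHom A B),
    (forall b : B, exists a, q a = b) ->
    (forall a a' : A, q a = 0 -> q a' = 0 -> a * a' = 0) ->
    forall y : X B, exists x : X A, pmap q x = y.

(* EGA IV 17.3.1; finite type and finite presentation agree over a field. *)
Definition smooth (X : kfunctor) : Prop :=
  covered_by_affines fin_gen_alg X /\ formally_smooth X.

Definition nonempty_subfun (X : kfunctor) (U : subfun X) : Prop :=
  exists (K : kAlg) (x : X K), is_field K /\ U K x.

Definition irreducible (X : kfunctor) : Prop :=
  nonempty_subfun (fun A (_ : X A) => True) /\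
  forall U V : subfun X, open_subfun U -> open_subfun V ->
    nonempty_subfun U -> nonempty_subfun V ->
    nonempty_subfun (fun A x => U A x /\ V A x).

(* X_K = X x_k Spec K, for every field extension K of k. *)
Definition geometrically_irreducible (X : kfunctor) : Prop :=
  forall K : kAlg, is_field K -> irreducible (kprod X (kspec K)).

(* A quasi-coherent sheaf on X is given by its pullbacks E A x along all points
   x : Spec A -> X, together with the base change isomorphisms. The equation
   pmap f x = y is an argument of [tr] so that pulling back along a morphism
   needs no transport. *)
Record qcoh (X : kfunctor) := QCoh {
  fib :> forall A : kAlg, X A -> lmodType A;
  tr : forall (A B : kAlg) (f : kHom A B) (x : X A) (y : X B),
    pmap f x = y -> fib x -> fib y;
  tr_bc : forall (A B : kAlg) (f : kHom A B) (x : X A) (y : X B)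
    (e : pmap f x = y), is_base_change f (tr e);
  tr_id : forall (A : kAlg) (x : X A) (e : pmap (kid A) x = x) (u : fib x),
    tr e u = u;
  tr_comp : forall (A B C : kAlg) (f : kHom A B) (g : kHom B C)
    (x : X A) (y : X B) (z : X C) (e : pmap f x = y) (e' : pmap g y = z)
    (e'' : pmap (kcomp g f) x = z) (u : fib x),
    tr e'' u = tr e' (tr e u)
}.

(* On a locally noetherian scheme, coherent means quasi-coherent of finite type. *)
Definition coherent (X : kfunctor) (E : qcoh X) : Prop :=
  forall (A : kAlg) (x : X A), finitely_generated (E A x).

Record shom (X : kfunctor) (E E' : qcoh X) := SHom {
  sh :> forall (A : kAlg) (x : X A), E A x -> E' A x;
  sh_linear : forall (A : kAlg) (x : X A), linear (sh (x := x));
  sh_nat : forall (A B : kAlg) (f : kHom A B) (x : X A) (y : X B)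
    (e : pmap f x = y) (u : E A x), sh (tr e u) = tr e (sh u)
}.

Lemma shom_ext (X : kfunctor) (E E' : qcoh X) (f g : shom E E') :
  (forall A (x : X A) (u : E A x), f A x u = g A x u) -> f = g.
Proof.
case: f g => [f fl fn] [g gl gn] /= fg.
have {}fg : f = g by do 3!(apply/functional_extensionality_dep=> ?); exact: fg.
by move: fl fn gl gn; rewrite fg => *; f_equal; apply: Prop_irrelevance.
Qed.

Section SheafOps.
Variable X : kfunctor.
Implicit Types E : qcoh X.

Lemma trD E A B (f : kHom A B) (x : X A) (y : X B) (e : pmap f x = y) u v :
  tr (q := E) e (u + v) = tr e u + tr e v.
Proof. by case: (tr_bc E e) => -[]. Qed.

Lemma trZ E A B (f : kHom A B) (x : X A) (y : X B) (e : pmap f x = y) a u :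
  tr (q := E) e (a *: u) = f a *: tr e u.
Proof. by case: (tr_bc E e) => -[]. Qed.

Lemma tr0 E A B (f : kHom A B) (x : X A) (y : X B) (e : pmap f x = y) :
  tr (q := E) e 0 = 0.
Proof. by have := trZ (E := E) e 0 0; rewrite scaler0 rmorph0 scale0r. Qed.

Lemma trN E A B (f : kHom A B) (x : X A) (y : X B) (e : pmap f x = y) u :
  tr (q := E) e (- u) = - tr e u.
Proof. by have := trZ (E := E) e (-1) u; rewrite rmorphN rmorph1 !scaleN1r. Qed.

Lemma tr_semilinear E A B (f : kHom A B) (x : X A) (y : X B) (e : pmap f x = y) :
  semilinear f (tr (q := E) e).
Proof. by case: (tr_bc E e). Qed.

Lemma sh_semilinear E E' (f : shom E E') A (x : X A) : semilinear id (f A x).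
Proof. exact/linear_semilinear/sh_linear. Qed.

Lemma shD E E' (f : shom E E') A (x : X A) u v : f A x (u + v) = f A x u + f A x v.
Proof. by case: (sh_semilinear f x). Qed.

Lemma shZ E E' (f : shom E E') A (x : X A) a u : f A x (a *: u) = a *: f A x u.
Proof. by case: (sh_semilinear f x). Qed.

Definition sid E : shom E E.
Proof. by refine (@SHom X E E (fun _ _ u => u) _ _) => //. Defined.

Definition scomp E E' E'' (g : shom E' E'') (f : shom E E') : shom E E''.
Proof.
refine (@SHom X E E'' (fun A x u => g A x (f A x u)) _ _).
- abstract (by move=> A x a u v; rewrite shD shZ shD shZ).
- abstract (by move=> *; rewrite !sh_nat).
Defined.

Definition szero E E' : shom E E'.
Proof.
refine (@SHom X E E' (fun A x u => 0) _ _).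
- abstract (by move=> A x a u v; rewrite scaler0 addr0).
- abstract (by move=> *; rewrite tr0).
Defined.

Definition sadd E E' (f g : shom E E') : shom E E'.
Proof.
refine (@SHom X E E' (fun A x u => f A x u + g A x u) _ _).
- abstract (by move=> A x a u v; rewrite !shD !shZ scalerDr addrACA).
- abstract (by move=> *; rewrite trD !sh_nat).
Defined.

Definition sopp E E' (f : shom E E') : shom E E'.
Proof.
refine (@SHom X E E' (fun A x u => - f A x u) _ _).
- abstract (by move=> A x a u v; rewrite shD shZ opprD scalerN).
- abstract (by move=> *; rewrite trN !sh_nat).
Defined.

Definition sscale (c : k) E E' (f : shom E E') : shom E E'.
Proof.
refine (@SHom X E E' (fun A x u => kstr A c *: f A x u) _ _).
- abstract (by move=> A x a u v; rewrite shD shZ scalerDr !scalerA mulrC).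
- abstract (by move=> A B h x y e u; rewrite sh_nat trZ khomP).
Defined.

Definition s_iso E E' (f : shom E E') : Prop :=
  exists g : shom E' E, scomp g f = sid E /\ scomp f g = sid E'.

Lemma regular_base_change (A B : comPzRingType) (f : {rmorphism A -> B}) :
  @is_base_change A B f A^o B^o f.
Proof.
split=> [|P h [_ hZ]]; first by split=> *; rewrite ?rmorphD ?rmorphM.
exists (fun b : B^o => (b : B) *: h 1); split=> [|h' [/linear_semilinear[_ h'Z] h'E]].
  split=> [a u v|u]; first by rewrite scalerDl scalerA.
  by rewrite -hZ [_ *: _]mulr1.
apply/funext => b; rewrite -h'E rmorph1 -h'Z.
by rewrite [_ *: _]mulr1.
Qed.

Definition sunit : qcoh X.
Proof.
refine (@QCoh X (fun A _ => A^o) (fun A B f x y e a => f a) _ _ _).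
- abstract (by move=> *; exact: regular_base_change).
- by [].
- by [].
Defined.

Definition stens E E' : qcoh X.
Proof.
refine (@QCoh X (fun A x => tens (E A x) (E' A x))
          (fun A B f x y e => tens_map (tr (q := E) e) (tr (q := E') e)) _ _ _).
- abstract (move=> A B f x y e; apply: tens_map_base_change; exact: tr_bc).
- abstract (move=> A x e u; apply: tens_map_id; exact: tr_id).
- abstract (move=> A B C f g x y z e e' e'' u;
    rewrite (tens_map_comp u (tr_semilinear E e) (tr_semilinear E' e)
               (tr_semilinear E e') (tr_semilinear E' e'));
    congr (tens_map _ _ u); apply/funext => v; exact: tr_comp).
Defined.

Definition stens_map E1 E2 E1' E2' (f : shom E1 E1') (g : shom E2 E2') :
  shom (stens E1 E2) (stens E1' E2').
Proof.
refine (@SHom X (stens E1 E2) (stens E1' E2')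
          (fun A x => tens_map (f A x) (g A x)) _ _).
- abstract (move=> A x; apply: tens_map_linear; exact: sh_linear).
- abstract (move=> A B h x y e u; rewrite /=
    (tens_map_comp u (tr_semilinear E1 e) (tr_semilinear E2 e)
       (sh_semilinear f y) (sh_semilinear g y))
    (tens_map_comp u (sh_semilinear f x) (sh_semilinear g x)
       (tr_semilinear E1' e) (tr_semilinear E2' e));
    congr (tens_map _ _ u); apply/funext => v; exact: sh_nat).
Defined.

Definition sassoc E1 E2 E3 :
  shom (stens (stens E1 E2) E3) (stens E1 (stens E2 E3)).
Proof.
refine (@SHom X (stens (stens E1 E2) E3) (stens E1 (stens E2 E3))
          (fun A x => @tens_assoc A (E1 A x) (E2 A x) (E3 A x)) _ _).
- abstract (move=> A x; exact: tens_assoc_linear).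
- abstract (move=> A B h x y e u; apply: tens_assoc_nat; exact: tr_semilinear).
Defined.

Definition slunit E : shom (stens sunit E) E.
Proof.
refine (@SHom X (stens sunit E) E (fun A x => @tens_lunit A (E A x)) _ _).
- abstract (move=> A x; exact: tens_lunit_linear).
- abstract (move=> A B h x y e u; apply: tens_lunit_nat; exact: tr_semilinear).
Defined.

Definition srunit E : shom (stens E sunit) E.
Proof.
refine (@SHom X (stens E sunit) E (fun A x => @tens_runit A (E A x)) _ _).
- abstract (move=> A x; exact: tens_runit_linear).
- abstract (move=> A B h x y e u; apply: tens_runit_nat; exact: tr_semilinear).
Defined.

Definition sbraid E E' : shom (stens E E') (stens E' E).
Proof.
refine (@SHom X (stens E E') (stens E' E)
          (fun A x => @tens_braid A (E A x) (E' A x)) _ _).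
- abstract (move=> A x; exact: tens_braid_linear).
- abstract (move=> A B h x y e u; apply: tens_braid_nat; exact: tr_semilinear).
Defined.

Lemma sunit_coherent : coherent sunit.
Proof.
move=> A x; exists 1%N, (fun=> 1) => a; exists (fun=> a).
by rewrite big_ord1 [_ *: _]mulr1.
Qed.

Lemma stens_coherent E E' : coherent E -> coherent E' -> coherent (stens E E').
Proof. by move=> c c' A x; apply: tens_fg; [apply: c | apply: c']. Qed.

End SheafOps.

Section Pullback.
Variables (Y X : kfunctor) (f : ktrans Y X).

Lemma pull_eq A B (h : kHom A B) (y : Y A) (z : Y B) :
  pmap h y = z -> pmap h (f A y) = f B z.
Proof. by move=> <-; rewrite kt_nat. Qed.

Definition pull (E : qcoh X) : qcoh Y.
Proof.
refine (@QCoh Y (fun A y => E A (f A y))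
          (fun A B h y z e => tr (q := E) (pull_eq e)) _ _ _).
- abstract (move=> *; exact: tr_bc).
- abstract (move=> *; exact: tr_id).
- abstract (move=> *; exact: tr_comp).
Defined.

Definition pull_map (E E' : qcoh X) (u : shom E E') : shom (pull E) (pull E').
Proof.
refine (@SHom Y (pull E) (pull E') (fun A y => u A (f A y)) _ _).
- abstract (move=> A y; exact: (@sh_linear _ _ _ u A (f A y))).
- abstract (move=> A B h y z e v; exact: (sh_nat u (pull_eq e) v)).
Defined.

Definition pull_unit : shom (sunit Y) (pull (sunit X)).
Proof. by refine (@SHom Y (sunit Y) (pull (sunit X)) (fun _ _ u => u) _ _). Defined.

Definition pull_unit_inv : shom (pull (sunit X)) (sunit Y).
Proof. by refine (@SHom Y (pull (sunit X)) (sunit Y) (fun _ _ u => u) _ _). Defined.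

Definition pull_tens (E E' : qcoh X) :
  shom (stens (pull E) (pull E')) (pull (stens E E')).
Proof.
by refine (@SHom Y (stens (pull E) (pull E')) (pull (stens E E'))
             (fun _ _ u => u) _ _).
Defined.

Definition pull_tens_inv (E E' : qcoh X) :
  shom (pull (stens E E')) (stens (pull E) (pull E')).
Proof.
by refine (@SHom Y (pull (stens E E')) (stens (pull E) (pull E'))
             (fun _ _ u => u) _ _).
Defined.

Lemma pull_map_iso (E E' : qcoh X) (u : shom E E') : s_iso u -> s_iso (pull_map u).
Proof.
case=> v [vu uv]; exists (pull_map v).
split; apply: shom_ext => A y w.
  exact: (congr1 (fun g : shom E E => g A (f A y) w) vu).
exact: (congr1 (fun g : shom E' E' => g A (f A y) w) uv).
Qed.

End Pullback.

Section Isomorphisms.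
Variables (Z Y X : kfunctor) (g : ktrans Y X) (f : ktrans Z Y).

Lemma tr_irr (E : qcoh X) A B (h : kHom A B) (x : X A) (y : X B)
    (e e' : pmap h x = y) (u : E A x) : tr e u = tr e' u.
Proof. by rewrite (Prop_irrelevance e e'). Qed.

Definition pull_comp (E : qcoh X) : shom (pull f (pull g E)) (pull (ktcomp g f) E).
Proof.
refine (@SHom Z (pull f (pull g E)) (pull (ktcomp g f) E) (fun _ _ u => u) _ _).
- by [].
- abstract (by move=> *; exact: tr_irr).
Defined.

Definition pull_comp_inv (E : qcoh X) :
  shom (pull (ktcomp g f) E) (pull f (pull g E)).
Proof.
refine (@SHom Z (pull (ktcomp g f) E) (pull f (pull g E)) (fun _ _ u => u) _ _).
- by [].
- abstract (by move=> *; exact: tr_irr).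
Defined.

Lemma s_iso_comp (E E' E'' : qcoh X) (u : shom E E') (v : shom E' E'') :
  s_iso u -> s_iso v -> s_iso (scomp v u).
Proof.
move=> [u' [u'u uu']] [v' [v'v vv']]; exists (scomp u' v').
split; apply: shom_ext => A x w /=.
  have /= -> := congr1 (fun g : shom E' E' => g A x (u A x w)) v'v.
  exact: (congr1 (fun g : shom E E => g A x w) u'u).
have /= -> := congr1 (fun g : shom E' E' => g A x (v' A x w)) uu'.
exact: (congr1 (fun g : shom E'' E'' => g A x w) vv').
Qed.

Lemma s_iso_tens (E1 E2 E1' E2' : qcoh X) (u : shom E1 E1') (v : shom E2 E2') :
  s_iso u -> s_iso v -> s_iso (stens_map u v).
Proof.
move=> [u' [u'u uu']] [v' [v'v vv']]; exists (stens_map u' v').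
split; apply: shom_ext => A x w /=;
  rewrite (tens_map_comp w (sh_semilinear _ x) (sh_semilinear _ x)
             (sh_semilinear _ x) (sh_semilinear _ x)) tens_map_id // => z.
- exact: (congr1 (fun g : shom E1 E1 => g A x z) u'u).
- exact: (congr1 (fun g : shom E2 E2 => g A x z) v'v).
- exact: (congr1 (fun g : shom E1' E1' => g A x z) uu').
- exact: (congr1 (fun g : shom E2' E2' => g A x z) vv').
Qed.

End Isomorphisms.

Lemma pull_unit_iso (Y X : kfunctor) (f : ktrans Y X) : s_iso (pull_unit f).
Proof. by exists (pull_unit_inv f); split; apply: shom_ext. Qed.

Lemma pull_unit_inv_iso (Y X : kfunctor) (f : ktrans Y X) : s_iso (pull_unit_inv f).
Proof. by exists (pull_unit f); split; apply: shom_ext. Qed.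

Lemma pull_tens_iso (Y X : kfunctor) (f : ktrans Y X) (E E' : qcoh X) :
  s_iso (pull_tens f E E').
Proof. by exists (pull_tens_inv f E E'); split; apply: shom_ext. Qed.

Lemma pull_tens_inv_iso (Y X : kfunctor) (f : ktrans Y X) (E E' : qcoh X) :
  s_iso (pull_tens_inv f E E').
Proof. by exists (pull_tens f E E'); split; apply: shom_ext. Qed.

Lemma pull_comp_iso (Z Y X : kfunctor) (g : ktrans Y X) (f : ktrans Z Y) (E : qcoh X) :
  s_iso (pull_comp g f E).
Proof. by exists (pull_comp_inv g f E); split; apply: shom_ext. Qed.

Lemma pull_comp_inv_iso (Z Y X : kfunctor) (g : ktrans Y X) (f : ktrans Z Y)
    (E : qcoh X) : s_iso (pull_comp_inv g f E).
Proof. by exists (pull_comp g f E); split; apply: shom_ext. Qed.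

End KFunctors.

Section Categories.
Variable k : fieldType.

(* The data of a k-linear tensor category; their laws are stated separately.
   Hom sets carry explicit operations, since an [lmodType] cannot accommodate
   families indexed by all k-algebras. *)
Record ktcat := KTCat {
  ob :> Type;
  hom : ob -> ob -> Type;
  idm : forall a, hom a a;
  cmp : forall a b c, hom b c -> hom a b -> hom a c;
  h0 : forall a b, hom a b;
  hadd : forall a b, hom a b -> hom a b -> hom a b;
  hopp : forall a b, hom a b -> hom a b;
  hscale : forall a b, k -> hom a b -> hom a b;
  tone : ob;
  ten : ob -> ob -> ob;
  tenm : forall a b a' b', hom a a' -> hom b b' -> hom (ten a b) (ten a' b');
  assoc : forall a b c, hom (ten (ten a b) c) (ten a (ten b c));
  lunit : forall a, hom (ten tone a) a;
  runit : forall a, hom (ten a tone) a;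
  braid : forall a b, hom (ten a b) (ten b a)
}.

Local Notation "g \* f" := (cmp g f) (at level 40, left associativity).
Local Notation "f \(x) g" := (tenm f g) (at level 35, no associativity).

Section TensorCategories.
Variable C : ktcat.
Implicit Types a b c d : C.

Definition is_category : Prop :=
  [/\ forall a b (f : hom a b), idm b \* f = f,
      forall a b (f : hom a b), f \* idm a = f &
      forall a b c d (f : hom a b) (g : hom b c) (h : hom c d),
        h \* (g \* f) = (h \* g) \* f].

Definition homs_are_modules : Prop :=
  forall a b : C,
  [/\ associative (@hadd C a b), commutative (@hadd C a b),
      left_id (h0 a b) (@hadd C a b) &
      left_inverse (h0 a b) (@hopp C a b) (@hadd C a b)] /\
  [/\ forall x y (f : hom a b), hscale x (hscale y f) = hscale (x * y) f,
      forall f : hom a b, hscale 1 f = f,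
      forall x (f g : hom a b),
        hscale x (hadd f g) = hadd (hscale x f) (hscale x g) &
      forall x y (f : hom a b),
        hscale (x + y) f = hadd (hscale x f) (hscale y f)].

Definition cmp_bilinear : Prop :=
  forall a b c,
  [/\ forall (g : hom b c) (f f' : hom a b),
        g \* hadd f f' = hadd (g \* f) (g \* f'),
      forall (g g' : hom b c) (f : hom a b),
        hadd g g' \* f = hadd (g \* f) (g' \* f),
      forall x (g : hom b c) (f : hom a b), g \* hscale x f = hscale x (g \* f) &
      forall x (g : hom b c) (f : hom a b), hscale x g \* f = hscale x (g \* f)].

Definition is_klinear_category : Prop :=
  [/\ is_category, homs_are_modules & cmp_bilinear].

Definition inverse_of a b (f : hom a b) (g : hom b a) : Prop :=
  g \* f = idm a /\ f \* g = idm b.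

Definition is_iso a b (f : hom a b) : Prop := exists g, inverse_of f g.

Definition is_mono a b (f : hom a b) : Prop :=
  forall c (g g' : hom c a), f \* g = f \* g' -> g = g'.

Definition is_epi a b (f : hom a b) : Prop :=
  forall c (g g' : hom b c), g \* f = g' \* f -> g = g'.

Definition is_zero a : Prop :=
  (forall b, exists! f : hom a b, True) /\ (forall b, exists! f : hom b a, True).

Definition is_biproduct a b s (i : hom a s) (j : hom b s) (p : hom s a) (q : hom s b) :
    Prop :=
  [/\ p \* i = idm a, q \* j = idm b, p \* j = h0 b a, q \* i = h0 a b &
      hadd (i \* p) (j \* q) = idm s].

Definition is_kernel a b c (f : hom a b) (i : hom c a) : Prop :=
  f \* i = h0 c b /\
  forall d (g : hom d a), f \* g = h0 d b -> exists! h : hom d c, i \* h = g.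

Definition is_cokernel a b c (f : hom a b) (q : hom b c) : Prop :=
  q \* f = h0 a c /\
  forall d (g : hom b d), g \* f = h0 a d -> exists! h : hom c d, h \* q = g.

Definition is_abelian : Prop :=
  (exists z : C, is_zero z) /\
  (forall a b, exists s (i : hom a s) (j : hom b s) (p : hom s a) (q : hom s b),
     is_biproduct i j p q) /\
  (forall a b (f : hom a b), exists c (i : hom c a), is_kernel f i) /\
  (forall a b (f : hom a b), exists c (q : hom b c), is_cokernel f q) /\
  (forall a b (f : hom a b), is_mono f -> exists c (g : hom b c), is_kernel g f) /\
  (forall a b (f : hom a b), is_epi f -> exists c (g : hom c a), is_cokernel g f).

Definition ten_functorial : Prop :=
  (forall a b, idm a \(x) idm b = idm (ten a b)) /\
  (forall a b c a' b' c' (f : hom a b) (g : hom b c) (f' : hom a' b') (g' : hom b' c'),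
     (g \* f) \(x) (g' \* f') = (g \(x) g') \* (f \(x) f')).

Definition ten_bilinear : Prop :=
  forall a b a' b',
  [/\ forall (f f' : hom a a') (g : hom b b'),
        hadd f f' \(x) g = hadd (f \(x) g) (f' \(x) g),
      forall (f : hom a a') (g g' : hom b b'),
        f \(x) hadd g g' = hadd (f \(x) g) (f \(x) g'),
      forall x (f : hom a a') (g : hom b b'),
        hscale x f \(x) g = hscale x (f \(x) g) &
      forall x (f : hom a a') (g : hom b b'),
        f \(x) hscale x g = hscale x (f \(x) g)].

Definition constraints_natural : Prop :=
  [/\ forall a b c a' b' c' (f : hom a a') (g : hom b b') (h : hom c c'),
        assoc a' b' c' \* ((f \(x) g) \(x) h) = (f \(x) (g \(x) h)) \* assoc a b c,
      forall a a' (f : hom a a'), lunit a' \* (idm (tone C) \(x) f) = f \* lunit a,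
      forall a a' (f : hom a a'), runit a' \* (f \(x) idm (tone C)) = f \* runit a &
      forall a b a' b' (f : hom a a') (g : hom b b'),
        braid a' b' \* (f \(x) g) = (g \(x) f) \* braid a b].

Definition constraints_iso : Prop :=
  [/\ forall a b c, is_iso (assoc a b c), forall a, is_iso (lunit a) &
      forall a, is_iso (runit a)].

Definition pentagon : Prop := forall a b c d,
  assoc a b (ten c d) \* assoc (ten a b) c d =
  (idm a \(x) assoc b c d) \* (assoc a (ten b c) d \* (assoc a b c \(x) idm d)).

Definition triangle : Prop := forall a b,
  (idm a \(x) lunit b) \* assoc a (tone C) b = runit a \(x) idm b.

Definition hexagon : Prop := forall a b c,
  assoc b c a \* (braid a (ten b c) \* assoc a b c) =
  (idm b \(x) braid a c) \* (assoc b a c \* (braid a b \(x) idm c)).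

Definition braid_symmetric : Prop := forall a b,
  braid b a \* braid a b = idm (ten a b).

Definition is_tensor_category : Prop :=
  [/\ ten_functorial, ten_bilinear, constraints_natural & constraints_iso] /\
  [/\ pentagon, triangle, hexagon & braid_symmetric].

(* Rigidity is the existence of duals, as in Deligne, Categories
   tannakiennes, 2.1.2. *)
Definition is_dual a a' (ev : hom (ten a' a) (tone C)) (coev : hom (tone C) (ten a a')) :
    Prop :=
  runit a \* ((idm a \(x) ev) \* (assoc a a' a \* (coev \(x) idm a))) = lunit a /\
  forall assoc_inv, inverse_of (assoc a' a a') assoc_inv ->
    lunit a' \* ((ev \(x) idm a') \* (assoc_inv \* (idm a' \(x) coev))) = runit a'.

Definition is_rigid : Prop := forall a, exists a' ev coev, @is_dual a a' ev coev.

Definition rigid_abelian_tensor_category : Prop :=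
  [/\ is_klinear_category, is_abelian, is_tensor_category & is_rigid].

Definition short_exact a b c (f : hom a b) (g : hom b c) : Prop :=
  is_kernel g f /\ is_cokernel f g.

End TensorCategories.

Record tfunctor (C D : ktcat) := TFunctor {
  fob :> C -> D;
  fmap : forall a b : C, hom a b -> hom (fob a) (fob b);
  mu : forall a b : C, hom (ten (fob a) (fob b)) (fob (ten a b));
  eps : hom (tone D) (fob (tone C))
}.

Section TensorFunctors.
Variables (C D : ktcat) (F : tfunctor C D).
Implicit Types a b c : C.

Definition is_functor : Prop :=
  (forall a, fmap F (idm a) = idm (F a)) /\
  (forall a b c (g : hom b c) (f : hom a b), fmap F (g \* f) = fmap F g \* fmap F f).

Definition is_klinear_functor : Prop :=
  (forall a b (f g : hom a b), fmap F (hadd f g) = hadd (fmap F f) (fmap F g)) /\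
  (forall a b x (f : hom a b), fmap F (hscale x f) = hscale x (fmap F f)).

Definition is_exact_functor : Prop :=
  forall a b c (f : hom a b) (g : hom b c),
    short_exact f g -> short_exact (fmap F f) (fmap F g).

Definition is_tensor_functor : Prop :=
  [/\ forall a b, is_iso (mu F a b),
      is_iso (eps F) &
      forall a b a' b' (f : hom a a') (g : hom b b'),
        mu F a' b' \* (fmap F f \(x) fmap F g) = fmap F (f \(x) g) \* mu F a b] /\
  [/\ forall a b c,
        fmap F (assoc a b c) \* (mu F (ten a b) c \* (mu F a b \(x) idm (F c))) =
        mu F a (ten b c) \* ((idm (F a) \(x) mu F b c) \* assoc (F a) (F b) (F c)),
      forall a, fmap F (lunit a) \* (mu F (tone C) a \* (eps F \(x) idm (F a))) =
        lunit (F a),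
      forall a, fmap F (runit a) \* (mu F a (tone C) \* (idm (F a) \(x) eps F)) =
        runit (F a) &
      forall a b, fmap F (braid a b) \* mu F a b = mu F b a \* braid (F a) (F b)].

Definition is_faithful : Prop :=
  forall a b (f g : hom a b), fmap F f = fmap F g -> f = g.

Definition is_full : Prop :=
  forall a b (h : hom (F a) (F b)), exists f : hom a b, fmap F f = h.

Definition exact_linear_tensor_functor : Prop :=
  [/\ is_functor, is_klinear_functor, is_exact_functor & is_tensor_functor].

Definition fully_faithful_embedding : Prop :=
  [/\ exact_linear_tensor_functor, is_faithful & is_full].

End TensorFunctors.

Record fdvect := FdVect {
  fdv :> lmodType k;
  fdvP : finitely_generated fdv
}.

Record vhom (V W : fdvect) := VHom {
  vh :> V -> W;
  vh_linear : linear vh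
}.

Lemma vhom_ext (V W : fdvect) (f g : vhom V W) : f =1 g -> f = g.
Proof.
case: f g => [f fl] [g gl] /= /funext fg.
by move: fl gl; rewrite fg => *; f_equal; apply: Prop_irrelevance.
Qed.

Definition vtens (V W : fdvect) : fdvect := FdVect (tens_fg (fdvP V) (fdvP W)).

Lemma regular_fg : finitely_generated (k^o : lmodType k).
Proof. by exists 1%N, (fun=> 1) => a; exists (fun=> a); rewrite big_ord1 [_ *: _]mulr1. Qed.

Definition vunit : fdvect := FdVect regular_fg.

Section VectOps.
Variables V W : fdvect.

Lemma vh_semilinear (f : vhom V W) : semilinear id f.
Proof. exact/linear_semilinear/vh_linear. Qed.

Definition vid : vhom V V.
Proof. by refine (@VHom V V id _). Defined.

Definition vcomp (U : fdvect) (g : vhom V W) (f : vhom U V) : vhom U W.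
Proof.
refine (@VHom U W (fun u => g (f u)) _).
by abstract (by move=> a u v; rewrite vh_linear vh_linear).
Defined.

Definition vzero : vhom V W.
Proof.
refine (@VHom V W (fun _ => 0) _).
by abstract (by move=> a u v; rewrite scaler0 addr0).
Defined.

Definition vadd (f g : vhom V W) : vhom V W.
Proof.
refine (@VHom V W (fun u => f u + g u) _).
by abstract (by move=> a u v; rewrite !vh_linear scalerDr addrACA).
Defined.

Definition vopp (f : vhom V W) : vhom V W.
Proof.
refine (@VHom V W (fun u => - f u) _).
by abstract (by move=> a u v; rewrite vh_linear opprD scalerN).
Defined.

Definition vscale (c : k) (f : vhom V W) : vhom V W.
Proof.
refine (@VHom V W (fun u => c *: f u) _).
by abstract (by move=> a u v; rewrite vh_linear scalerDr !scalerA mulrC).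
Defined.

End VectOps.

Definition Vec : ktcat :=
  @KTCat fdvect vhom vid (fun U V W g f => vcomp g f) vzero vadd vopp
    (fun V W c f => vscale c f) vunit vtens
    (fun V W V' W' f g =>
       @VHom (vtens V W) (vtens V' W') (tens_map f g)
         (tens_map_linear (@vh_linear _ _ f) (@vh_linear _ _ g)))
    (fun U V W => @VHom (vtens (vtens U V) W) (vtens U (vtens V W)) _
                    (@tens_assoc_linear k U V W))
    (fun V => @VHom (vtens vunit V) V _ (@tens_lunit_linear k V))
    (fun V => @VHom (vtens V vunit) V _ (@tens_runit_linear k V))
    (fun V W => @VHom (vtens V W) (vtens W V) _ (@tens_braid_linear k V W)).

Definition is_fiber_functor (C : ktcat) (w : tfunctor C Vec) : Prop :=
  exact_linear_tensor_functor w.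

(* Deligne-Milne, Tannakian Categories, Definition 2.19. *)
Definition neutral_Tannaka_category (C : ktcat) (w : tfunctor C Vec) : Prop :=
  [/\ rigid_abelian_tensor_category C,
      bijective (fun x : k => hscale x (idm (tone C))),
      is_fiber_functor w & is_faithful w].

End Categories.

Lemma frobenius_add (A : comPzRingType) (p : nat) :
  prime p -> p%:R = 0 :> A -> forall x y : A, (x + y) ^+ p = x ^+ p + y ^+ p.
Proof.
move=> pp p0 x y; rewrite exprDn; case: p pp p0 => // n pp p0.
rewrite big_ord_recl big_ord_recr /= subn0 subnn bin0 binn !mulr1 mul1r !mulr1n.
rewrite big1 ?add0r // => i _; rewrite /bump add1n.
have /dvdnP[m ->] : (n.+1 %| 'C(n.+1, i.+1))%N.
  by apply: prime_dvd_bin pp _; exact: (ltn_ord i).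
by rewrite mulnC mulrnA -[X in X *+ m]mulr_natr p0 mulr0 mul0rn.
Qed.

Section Frobenius.
Variables (k : fieldType) (p : nat) (chark : p \in [pchar k]).

Lemma kalg_char (A : kAlg k) : p%:R = 0 :> A.
Proof. by rewrite -(rmorph_nat (kstr A)) (pcharf0 chark) rmorph0. Qed.

Lemma frobenius_zmod (A : kAlg k) : zmod_morphism (fun x : A => x ^+ p).
Proof.
move=> x y; apply/eqP; rewrite eq_sym subr_eq.
by rewrite -frobenius_add ?subrK //; [exact: pcharf_prime chark | exact: kalg_char].
Qed.

Lemma frobenius_monoid (A : kAlg k) : monoid_morphism (fun x : A => x ^+ p).
Proof. by split=> [|x y]; rewrite ?expr1n ?exprMn. Qed.

Definition frobenius (A : kAlg k) : {rmorphism A -> A} :=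
  HB.pack (fun x : A => x ^+ p)
    (GRing.isZmodMorphism.Build A A _ (@frobenius_zmod A))
    (GRing.isMonoidMorphism.Build A A _ (@frobenius_monoid A)).

Definition frobk : {rmorphism k -> k} := frobenius (kbase k).

Variable perf : forall a : k, exists b : k, b ^+ p = a.

Definition pth_root (a : k) : k := projT1 (cid (perf a)).

Lemma pth_rootK (a : k) : frobk (pth_root a) = a.
Proof. exact: (projT2 (cid (perf a))). Qed.

Lemma pth_root_zmod : zmod_morphism pth_root.
Proof.
by move=> x y; apply: (fmorph_inj frobk); rewrite rmorphB !pth_rootK.
Qed.

Lemma pth_root_monoid : monoid_morphism pth_root.
Proof.
by split=> [|x y]; apply: (fmorph_inj frobk);
  rewrite ?rmorphM ?rmorph1 !pth_rootK.
Qed.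

Definition frobk_inv : {rmorphism k -> k} :=
  HB.pack pth_root
    (GRing.isZmodMorphism.Build k k _ pth_root_zmod)
    (GRing.isMonoidMorphism.Build k k _ pth_root_monoid).

Definition restr (theta : {rmorphism k -> k}) (A : kAlg k) : kAlg k :=
  KAlg (kstr A \o theta : {rmorphism k -> A}).

Definition restr_hom (theta : {rmorphism k -> k}) (A B : kAlg k) (f : kHom A B) :
    kHom (restr theta A) (restr theta B) :=
  @KHom k (restr theta A) (restr theta B) f (fun c => khomP f (theta c)).

(* The base change X (x)_{k, theta} k: a k-morphism from Spec A to it is a
   k-morphism to X from Spec A, viewed over k through Spec theta. *)
Section BaseChange.
Variables (theta : {rmorphism k -> k}) (X : kfunctor k).

Lemma bc_id A (x : X (restr theta A)) : pmap (restr_hom theta (kid A)) x = x.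
Proof. by rewrite -[RHS]pmap_id; congr (pmap _ x); apply: kHom_ext. Qed.

Lemma bc_comp A B C (g : kHom B C) (f : kHom A B) (x : X (restr theta A)) :
  pmap (restr_hom theta (kcomp g f)) x =
  pmap (restr_hom theta g) (pmap (restr_hom theta f) x).
Proof. by rewrite -pmap_comp; congr (pmap _ x); apply: kHom_ext. Qed.

Definition base_change : kfunctor k :=
  @KFunctor k (fun A => X (restr theta A))
    (fun A B f => pmap (restr_hom theta f)) bc_id bc_comp.

End BaseChange.

Lemma frobenius_khom (A : kAlg k) (c : k) :
  frobenius A (kstr A c) = kstr (restr frobk A) c.
Proof. by rewrite /= rmorphXn. Qed.

Definition frobenius_hom (A : kAlg k) : kHom A (restr frobk A) :=
  @KHom k A (restr frobk A) (frobenius A) (@frobenius_khom A).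

(* On A-points, relative Frobenius X -> X^(1) is composition with the Frobenius
   of A, which is k-linear from A to [restr frobk A]. *)
Lemma rel_frob_nat (X : kfunctor k) (A B : kAlg k) (f : kHom A B) (x : X A) :
  pmap (restr_hom frobk f) (pmap (frobenius_hom A) x) =
  pmap (frobenius_hom B) (pmap f x).
Proof.
rewrite -!pmap_comp; congr (pmap _ x); apply: kHom_ext => a /=.
by rewrite rmorphXn.
Qed.

Definition rel_frob (X : kfunctor k) : ktrans X (base_change frobk X) :=
  @KTrans k X (base_change frobk X) (fun A => pmap (frobenius_hom A))
    (@rel_frob_nat X).

(* The canonical isomorphism (X^(-1))^(1) = X. *)
Lemma untwist_khom (A : kAlg k) (c : k) :
  (idfun : {rmorphism A -> A}) (kstr (restr frobk_inv (restr frobk A)) c) = kstr A c.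
Proof. by rewrite /= -[pth_root c ^+ p]/(frobk (pth_root c)) pth_rootK. Qed.

Definition untwist_hom (A : kAlg k) : kHom (restr frobk_inv (restr frobk A)) A :=
  @KHom k (restr frobk_inv (restr frobk A)) A idfun (@untwist_khom A).

Lemma twist_untwist_nat (X : kfunctor k) (A B : kAlg k) (f : kHom A B)
    (x : X (restr frobk_inv (restr frobk A))) :
  pmap f (pmap (untwist_hom A) x) =
  pmap (untwist_hom B) (pmap (restr_hom frobk_inv (restr_hom frobk f)) x).
Proof. by rewrite -!pmap_comp; congr (pmap _ x); apply: kHom_ext. Qed.

Definition twist_untwist (X : kfunctor k) :
    ktrans (base_change frobk (base_change frobk_inv X)) X :=
  @KTrans k (base_change frobk (base_change frobk_inv X)) X
    (fun A => pmap (untwist_hom A)) (@twist_untwist_nat X).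

Variable X : kfunctor k.

(* X^(n) and X^(-n), for n : nat. *)
Definition twist (n : nat) : kfunctor k := iter n (base_change frobk) X.
Definition untwist (n : nat) : kfunctor k := iter n (base_change frobk_inv) X.

(* F^(n) : X^(n) -> X^(n+1) and F^(-n-1) : X^(-n-1) -> X^(-n). *)
Definition frob (n : nat) : ktrans (twist n) (twist n.+1) := rel_frob (twist n).
Definition frobN (n : nat) : ktrans (untwist n.+1) (untwist n) :=
  ktcomp (twist_untwist (untwist n)) (rel_frob (untwist n.+1)).

(* F^(-t,0) : X^(-t) -> X and F^(-t,1) : X^(-t) -> X^(1). *)
Fixpoint frob0 (t : nat) : ktrans (untwist t) X :=
  if t is t'.+1 then ktcomp (frob0 t') (frobN t') else ktid X.
Fixpoint frob1 (t : nat) : ktrans (untwist t) (twist 1) :=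
  if t is t'.+1 then ktcomp (frob1 t') (frobN t') else frob 0.

Section Strat.
Variable t : nat.

Record strat := Strat {
  se : forall n : nat, qcoh (twist n);
  se_coh : forall n, coherent (se n);
  sig0 : shom (pull (frob0 t) (se 0)) (pull (frob1 t) (se 1));
  sig0_iso : s_iso sig0;
  sigS : forall n, shom (se n.+1) (pull (frob n.+1) (se n.+2));
  sig_iso : forall n, s_iso (sigS n)
}.

Record strat_hom (D E : strat) := StratHom {
  sm :> forall n : nat, shom (se D n) (se E n);
  sm_sig0 : scomp (pull_map (frob1 t) (sm 1)) (sig0 D) =
            scomp (sig0 E) (pull_map (frob0 t) (sm 0));
  sm_sig : forall n, scomp (pull_map (frob n.+1) (sm n.+2)) (sigS D n) =
                     scomp (sigS E n) (sm n.+1)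
}.

Lemma strat_hom_ext (D E : strat) (f g : strat_hom D E) :
  (forall n, f n = g n) -> f = g.
Proof.
case: f g => [f f0 fs] [g g0 gs] /= fg.
have {}fg : f = g by apply/functional_extensionality_dep.
by move: f0 fs g0 gs; rewrite fg => *; f_equal; apply: Prop_irrelevance.
Qed.

Lemma sm_sig0E (D E : strat) (f : strat_hom D E) A (x : untwist t A) u :
  f 1%N A (frob1 t A x) (sig0 D A x u) = sig0 E A x (f 0%N A (frob0 t A x) u).
Proof. exact: (congr1 (fun g : shom _ _ => g A x u) (sm_sig0 f)). Qed.

Lemma sm_sigE (D E : strat) (f : strat_hom D E) n A (x : twist n.+1 A) u :
  f n.+2 A (frob n.+1 A x) (sigS D n A x u) = sigS E n A x (f n.+1 A x u).
Proof. exact: (congr1 (fun g : shom _ _ => g A x u) (sm_sig f n)). Qed.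

Definition strat_id (E : strat) : strat_hom E E.
Proof.
refine (@StratHom E E (fun n => sid (se E n)) _ _).
- abstract (by apply: shom_ext).
- abstract (by move=> n; apply: shom_ext).
Defined.

Definition strat_comp (D E G : strat) (g : strat_hom E G) (f : strat_hom D E) :
  strat_hom D G.
Proof.
refine (@StratHom D G (fun n => scomp (g n) (f n)) _ _).
- abstract (by apply: shom_ext => A x u /=; rewrite !sm_sig0E).
- abstract (by move=> n; apply: shom_ext => A x u /=; rewrite !sm_sigE).
Defined.

Section HomOps.
Variables D E : strat.

Definition strat_zero : strat_hom D E.
Proof.
refine (@StratHom D E (fun n => szero (se D n) (se E n)) _ _).
- abstract (by apply: shom_ext => A x u /=; have [_ Z] := sh_semilinear (sig0 E) x;
    have := Z 0 0; rewrite !scale0r).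
- abstract (by move=> n; apply: shom_ext => A x u /=;
    have [_ Z] := sh_semilinear (sigS E n) x; have := Z 0 0; rewrite !scale0r).
Defined.

Definition strat_add (f g : strat_hom D E) : strat_hom D E.
Proof.
refine (@StratHom D E (fun n => sadd (f n) (g n)) _ _).
- abstract (by apply: shom_ext => A x u /=; rewrite !sm_sig0E (shD (sig0 E))).
- abstract (by move=> n; apply: shom_ext => A x u /=; rewrite !sm_sigE (shD (sigS E n))).
Defined.

Definition strat_scale (c : k) (f : strat_hom D E) : strat_hom D E.
Proof.
refine (@StratHom D E (fun n => sscale c (f n)) _ _).
- abstract (by apply: shom_ext => A x u /=; rewrite !sm_sig0E (shZ (sig0 E))).
- abstract (by move=> n; apply: shom_ext => A x u /=; rewrite !sm_sigE (shZ (sigS E n))).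
Defined.

Definition strat_opp (f : strat_hom D E) : strat_hom D E.
Proof.
refine (@StratHom D E (fun n => sopp (f n)) _ _).
- abstract (by apply: shom_ext => A x u /=;
    rewrite -!scaleN1r !sm_sig0E (shZ (sig0 E))).
- abstract (by move=> n; apply: shom_ext => A x u /=;
    rewrite -!scaleN1r !sm_sigE (shZ (sigS E n))).
Defined.

End HomOps.

Definition strat_tens_sig0 (D E : strat) :
    shom (pull (frob0 t) (stens (se D 0) (se E 0)))
         (pull (frob1 t) (stens (se D 1) (se E 1))) :=
  scomp (pull_tens (frob1 t) (se D 1) (se E 1))
    (scomp (stens_map (sig0 D) (sig0 E))
       (pull_tens_inv (frob0 t) (se D 0) (se E 0))).

Definition strat_tens_sig (D E : strat) (n : nat) :
    shom (stens (se D n.+1) (se E n.+1))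
         (pull (frob n.+1) (stens (se D n.+2) (se E n.+2))) :=
  scomp (pull_tens (frob n.+1) (se D n.+2) (se E n.+2))
    (stens_map (sigS D n) (sigS E n)).

Definition strat_tens (D E : strat) : strat.
Proof.
refine (@Strat (fun n => stens (se D n) (se E n)) _
          (strat_tens_sig0 D E) _ (strat_tens_sig D E) _).
- abstract (by move=> n; apply: stens_coherent; apply: se_coh).
- abstract (by apply: s_iso_comp; last exact: pull_tens_iso;
    apply: s_iso_comp; first exact: pull_tens_inv_iso; apply: s_iso_tens; apply: sig0_iso).
- abstract (by move=> n; apply: s_iso_comp; last exact: pull_tens_iso;
    apply: s_iso_tens; apply: sig_iso).
Defined.

Definition strat_one : strat.
Proof.
refine (@Strat (fun n => sunit (twist n)) _
          (scomp (pull_unit (frob1 t)) (pull_unit_inv (frob0 t))) _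
          (fun n => pull_unit (frob n.+1)) _).
- abstract (by move=> n; apply: sunit_coherent).
- abstract (by apply: s_iso_comp; [apply: pull_unit_inv_iso | apply: pull_unit_iso]).
- abstract (by move=> n; apply: pull_unit_iso).
Defined.

Definition strat_tens_map (D E D' E' : strat) (f : strat_hom D D')
  (g : strat_hom E E') : strat_hom (strat_tens D E) (strat_tens D' E').
Proof.
refine (@StratHom (strat_tens D E) (strat_tens D' E')
          (fun n => stens_map (f n) (g n)) _ _).
- abstract (apply: shom_ext => A x u;
    apply: (etrans (tens_map_comp u (sh_semilinear (sig0 D) x)
      (sh_semilinear (sig0 E) x) (sh_semilinear (f 1%N) (frob1 t A x))
      (sh_semilinear (g 1%N) (frob1 t A x))));
    apply: (etrans _ (esym (tens_map_comp u (sh_semilinear (f 0%N) (frob0 t A x))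
      (sh_semilinear (g 0%N) (frob0 t A x)) (sh_semilinear (sig0 D') x)
      (sh_semilinear (sig0 E') x))));
    congr (tens_map _ _ u); apply/funext => v; exact: sm_sig0E).
- abstract (move=> n; apply: shom_ext => A x u;
    apply: (etrans (tens_map_comp u (sh_semilinear (sigS D n) x)
      (sh_semilinear (sigS E n) x) (sh_semilinear (f n.+2) (frob n.+1 A x))
      (sh_semilinear (g n.+2) (frob n.+1 A x))));
    apply: (etrans _ (esym (tens_map_comp u (sh_semilinear (f n.+1) x)
      (sh_semilinear (g n.+1) x) (sh_semilinear (sigS D' n) x)
      (sh_semilinear (sigS E' n) x))));
    congr (tens_map _ _ u); apply/funext => v; exact: sm_sigE).
Defined.

Definition strat_assoc (D E G : strat) :
  strat_hom (strat_tens (strat_tens D E) G) (strat_tens D (strat_tens E G)).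
Proof.
refine (@StratHom (strat_tens (strat_tens D E) G) (strat_tens D (strat_tens E G))
          (fun n => sassoc (se D n) (se E n) (se G n)) _ _).
- abstract (apply: shom_ext => A x u;
    exact: (tens_assoc_nat u (sh_semilinear (sig0 D) x) (sh_semilinear (sig0 E) x)
              (sh_semilinear (sig0 G) x))).
- abstract (move=> n; apply: shom_ext => A x u;
    exact: (tens_assoc_nat u (sh_semilinear (sigS D n) x) (sh_semilinear (sigS E n) x)
              (sh_semilinear (sigS G n) x))).
Defined.

Definition strat_lunit (E : strat) : strat_hom (strat_tens strat_one E) E.
Proof.
refine (@StratHom (strat_tens strat_one E) E (fun n => slunit (se E n)) _ _).
- abstract (apply: shom_ext => A x u;
    exact: (@tens_lunit_nat A A idfun _ _ _ u (sh_semilinear (sig0 E) x))).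
- abstract (move=> n; apply: shom_ext => A x u;
    exact: (@tens_lunit_nat A A idfun _ _ _ u (sh_semilinear (sigS E n) x))).
Defined.

Definition strat_runit (E : strat) : strat_hom (strat_tens E strat_one) E.
Proof.
refine (@StratHom (strat_tens E strat_one) E (fun n => srunit (se E n)) _ _).
- abstract (apply: shom_ext => A x u;
    exact: (@tens_runit_nat A A idfun _ _ _ u (sh_semilinear (sig0 E) x))).
- abstract (move=> n; apply: shom_ext => A x u;
    exact: (@tens_runit_nat A A idfun _ _ _ u (sh_semilinear (sigS E n) x))).
Defined.

Definition strat_braid (D E : strat) : strat_hom (strat_tens D E) (strat_tens E D).
Proof.
refine (@StratHom (strat_tens D E) (strat_tens E D)
          (fun n => sbraid (se D n) (se E n)) _ _).
- abstract (apply: shom_ext => A x u;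
    exact: (tens_braid_nat u (sh_semilinear (sig0 D) x) (sh_semilinear (sig0 E) x))).
- abstract (move=> n; apply: shom_ext => A x u;
    exact: (tens_braid_nat u (sh_semilinear (sigS D n) x) (sh_semilinear (sigS E n) x))).
Defined.

Definition StratCat : ktcat k :=
  @KTCat k strat strat_hom strat_id (fun D E G g f => strat_comp g f)
    strat_zero strat_add strat_opp (fun D E c f => strat_scale c f)
    strat_one strat_tens (fun D E D' E' f g => strat_tens_map f g)
    strat_assoc strat_lunit strat_runit strat_braid.

Section FibreFunctor.
Variable x : X (kbase k).

Definition omega_ob (E : StratCat) : fdvect k := FdVect (@se_coh E 0%N (kbase k) x).

Definition omega : tfunctor StratCat (Vec k) :=
  @TFunctor k StratCat (Vec k) omega_ob
    (fun D E f => @VHom k (omega_ob D) (omega_ob E) (sm f 0%N (kbase k) x)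
                    (@sh_linear _ _ _ _ (sm f 0%N) (kbase k) x))
    (fun D E => @VHom k (vtens (omega_ob D) (omega_ob E)) (omega_ob (ten D E))
                  id (fun _ _ _ => erefl))
    (@VHom k (vunit k) (omega_ob (tone StratCat)) id (fun _ _ _ => erefl)).

End FibreFunctor.

End Strat.

Section Plus.
Variable t : nat.

Definition plus_ob (E : StratCat t) : StratCat t.+1.
Proof.
refine (@Strat t.+1 (se E) (@se_coh t E)
          (scomp (pull_comp (frob1 t) (frobN t) (se E 1))
            (scomp (pull_map (frobN t) (sig0 E))
              (pull_comp_inv (frob0 t) (frobN t) (se E 0)))) _
          (sigS E) (@sig_iso t E)).
abstract (by apply: s_iso_comp; last exact: pull_comp_iso;
  apply: s_iso_comp; first exact: pull_comp_inv_iso; apply: pull_map_iso; apply: sig0_iso).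
Defined.

Definition plus_map (D E : StratCat t) (f : hom D E) : hom (plus_ob D) (plus_ob E).
Proof.
refine (@StratHom t.+1 (plus_ob D) (plus_ob E) (sm f) _ (sm_sig f)).
abstract (apply: shom_ext => A x u; refine (@sm_sig0E t D E f A (frobN t A x) u)).
Defined.

Definition plus_mu (D E : StratCat t) :
  hom (ten (plus_ob D) (plus_ob E)) (plus_ob (ten D E)).
Proof.
refine (@StratHom t.+1 (strat_tens (plus_ob D) (plus_ob E)) (plus_ob (strat_tens D E))
          (fun n => sid (stens (se D n) (se E n))) _ _).
- abstract (by apply: shom_ext).
- abstract (by move=> n; apply: shom_ext).
Defined.

Definition plus_eps : hom (tone (StratCat t.+1)) (plus_ob (tone (StratCat t))).
Proof.
refine (@StratHom t.+1 (strat_one t.+1) (plus_ob (strat_one t))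
          (fun n => sid (sunit (twist n))) _ _).
- abstract (by apply: shom_ext).
- abstract (by move=> n; apply: shom_ext).
Defined.

Definition plus : tfunctor (StratCat t) (StratCat t.+1) :=
  @TFunctor k (StratCat t) (StratCat t.+1) plus_ob plus_map plus_mu plus_eps.

End Plus.
End Frobenius.

(* Main.v *)
From Pilot Require Import Defs.
From HB Require Import structures.
From mathcomp Require Import all_boot all_order all_algebra generic_quotient.
From mathcomp Require Import boolp ring.
From mathcomp Require classical_sets.
Import Pilot.Defs.

(* The members [E^(i)], i >= 1, are divisible by Frobenius. On a noetherian chart,
   if [M_j] is the Frobenius pullback of [M_(j+1)] for all j, then each Fitting
   ideal satisfies I_j = I_(j+1)^[p]; so the I_j increase, become stationary, and
   the limit, contained in its own square, is generated by an idempotent. Modules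
   whose Fitting ideals are generated by idempotents are projective. As smooth
   schemes over a perfect field are reduced, idempotency descends from
   I^[p^t] to I, which gives projectivity of [E^(0)] as well. Hence the fibres of
   every t-stratified bundle at all points are projective; applied to cokernels,
   this makes every morphism f split (f r f = f for some r) on each fibre, so
   kernels, cokernels and duals can be formed fibrewise. Fullness of (+) follows
   from injectivity of Frobenius on reduced charts, and faithfulness of the fibre
   functor from the fact that the support of a split morphism is open and closed
   in the connected scheme X. *)

Set Implicit Arguments.
Unset Strict Implicit.
Unset Printing Implicit Defensive.

Import GRing.Theory.
Local Open Scope ring_scope.
Local Open Scope quotient_scope.

(** * Ideals generated by idempotents *)

Section Ideals.
Variable A : comPzRingType.
Implicit Types (I J S : A -> Prop) (a b x y : A) (s : seq A).

(** A point of X^(n+1) over R is a point of X^(n) over R with its k-structure restricted along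
    Frobenius, and for perfect k this can be undone. Over a chart R the tower E^(1), E^(2), ... thus
    becomes a sequence of modules over the single ring R, linked by pullback along the Frobenius of
    R; only so can their Fitting ideals be compared. Sheaves are given by fibres over all
    k-algebras, where kernels and duals do not commute with base change in general. Splittings and
    projectivity therefore have to hold over every A, noetherian or not: they are carried from
    charts to A by base change and by a local-global principle for modules only assumed finitely
    generated. Fitting ideals suit this, being compatible with every base change, and their
    idempotent generators yield explicit factorizations through free modules, without local rings or
    ranks. Cokernels commute with base change unconditionally, so they can be formed before anything
    is known to be split. *)

Definition ideal I : Prop :=
  [/\ I 0, forall x y, I x -> I y -> I (x + y) & forall a x, I x -> I (a * x)].

Definition igen S a : Prop := forall I, ideal I -> (forall x, S x -> I x) -> I a.

Lemma igen_ideal S : ideal (igen S).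
Proof.
split=> [I [] //|x y Sx Sy I iI SI|a x Sx I iI SI]; case: (iI) => _ ID IM.
  by apply: ID; [apply: Sx | apply: Sy].
by apply: IM; apply: Sx.
Qed.

Lemma mem_igen S x : S x -> igen S x.
Proof. by move=> Sx I _; apply. Qed.

Lemma igen_sub S I x : ideal I -> (forall y, S y -> I y) -> igen S x -> I x.
Proof. by move=> iI SI; apply. Qed.

Lemma igen_mono S S' x : (forall y, S y -> S' y) -> igen S x -> igen S' x.
Proof.
move=> SS'; apply: igen_sub; first exact: igen_ideal.
by move=> y /SS'; exact: mem_igen.
Qed.

Lemma igen_ind S (P : A -> Prop) : P 0 -> (forall x y, P x -> P y -> P (x + y)) ->
  (forall a x, P x -> P (a * x)) -> (forall x, S x -> P x) ->
  forall a, igen S a -> P a.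
Proof. by move=> P0 PD PM SP a; apply. Qed.

Lemma ideal_sum I (T : Type) (r : seq T) (P : pred T) (F : T -> A) :
  ideal I -> (forall i, I (F i)) -> I (\sum_(i <- r | P i) F i).
Proof. by case=> I0 ID _ IF; elim/big_ind: _. Qed.

Lemma ideal_mulr I a x : ideal I -> I x -> I (x * a).
Proof. by case=> _ _ IM Ix; rewrite mulrC; apply: IM. Qed.

Lemma ideal_opp I x : ideal I -> I x -> I (- x).
Proof. by case=> _ _ IM Ix; rewrite -mulN1r; apply: IM. Qed.

Lemma ideal_sub I x y : ideal I -> I x -> I y -> I (x - y).
Proof. by move=> iI Ix Iy; case: (iI) => _ ID _; apply: ID => //; apply: ideal_opp. Qed.

Lemma igen_nil x : igen (fun y => y \in [::]) x -> x = 0.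
Proof. by move: x; apply: igen_ind => // [x y -> ->|a x ->]; rewrite ?addr0 ?mulr0. Qed.

Lemma igen_cons x s a : igen (fun y => y \in x :: s) a ->
  exists b c, a = b * x + c /\ igen (fun y => y \in s) c.
Proof.
have [s0 sD sM] := igen_ideal (fun y => y \in s).
move: a; apply: igen_ind.
- by exists 0, 0; rewrite mul0r addr0.
- move=> _ _ [b [c [-> sc]]] [b' [c' [-> sc']]].
  by exists (b + b'), (c + c'); rewrite mulrDl addrACA; split=> //; apply: sD.
- move=> d _ [b [c [-> sc]]]; exists (d * b), (d * c).
  by rewrite mulrDr mulrA; split=> //; apply: sM.
move=> y; rewrite inE => /orP[/eqP->|ys].
  by exists 1, 0; rewrite mul1r addr0.
by exists 0, y; rewrite mul0r add0r; split=> //; apply: mem_igen.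
Qed.

Lemma igen_sum S a : igen S a ->
  exists (n : nat) (c x : 'I_n -> A), (forall i, S (x i)) /\ a = \sum_i c i * x i.
Proof.
move: a; apply: igen_ind.
- exists 0%N, (fun=> 0), (fun=> 0); rewrite big_ord0; split=> //; by case.
- move=> _ _ [n [c [x [Sx ->]]]] [m [d [y [Sy ->]]]].
  exists (n + m)%N, (fun i => match split i with inl i => c i | inr i => d i end),
    (fun i => match split i with inl i => x i | inr i => y i end); split.
    by move=> i; case: (split i).
  rewrite big_split_ord; congr (_ + _); apply: eq_bigr => i _.
    by rewrite (unsplitK (inl i)).
  by rewrite (unsplitK (inr i)).
- move=> a' _ [n [c [x [Sx ->]]]]; exists n, (fun i => a' * c i), x; split=> //.
  by rewrite mulr_sumr; apply: eq_bigr => i _; rewrite mulrA.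
move=> x Sx; exists 1%N, (fun=> 1), (fun=> x).
by rewrite big_ord1 mul1r.
Qed.

Definition noetherian : Prop :=
  forall I, ideal I -> exists s, forall x, I x <-> igen (fun y => y \in s) x.

Definition reduced : Prop := forall a n, a ^+ n = 0 -> a = 0.

(** Taking [x = e] shows that [e] is idempotent, so for an ideal [I] this means being generated by
    an idempotent. *)
Definition idem_ideal I : Prop := exists2 e, I e & forall x, I x -> x = e * x.

Lemma idem_ideal_ext I J : (forall x, I x <-> J x) -> idem_ideal I -> idem_ideal J.
Proof. by move=> IJ [e /IJ Je eI]; exists e => // x /IJ; apply: eI. Qed.

(* Nakayama's lemma, eliminating the generators one at a time. *)
Lemma idem_ideal_fg I s : ideal I -> (forall x, I x <-> igen (fun y => y \in s) x) ->
  (forall x, I x -> igen (fun z => exists u v, [/\ I u, I v & z = u * v]) x) ->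
  idem_ideal I.
Proof.
move=> iI Is II; have [I0 ID IM] := iI.
have H n : exists2 e, I e &
    forall x, I x -> igen (fun y => y \in drop n s) ((1 - e) * x).
  elim: n => [|n [e Ie eI]].
    by exists 0 => // x /Is; rewrite drop0 subr0 mul1r.
  case: (ltnP n (size s)) => ns; last first.
    exists e => // x Ix; have := eI _ Ix; rewrite !drop_oversize //; exact: leqW.
  rewrite (drop_nth 0 ns) in eI; set x := s`_n in eI; set t := drop n.+1 s in eI *.
  have tI := igen_ideal (fun y => y \in t).
  have eII z : I z -> exists2 b, I b & igen (fun y => y \in t) ((1 - e) * z - b * x).
    move=> /II; move: z; apply: igen_ind.
    - by exists 0 => //; rewrite mulr0 mul0r subr0; case: tI.
    - move=> u v [b Ib bu] [c Ic cv]; exists (b + c); first exact: ID.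
      have -> : (1 - e) * (u + v) - (b + c) * x =
        ((1 - e) * u - b * x) + ((1 - e) * v - c * x) by ring.
      by case: tI => _ D _; apply: D.
    - move=> a u [b Ib bu]; exists (a * b); first exact: IM.
      by rewrite -mulrA mulrCA -mulrBr; case: tI => _ _; apply.
    move=> _ [u [v [Iu Iv ->]]]; have [b [c [E tc]]] := igen_cons (eI _ Iv).
    exists (u * b); first by rewrite mulrC; apply: IM.
    by rewrite mulrCA E mulrDr mulrA addrC addKr; case: tI => _ _; apply.
  have Ix : I x by apply/Is; apply: mem_igen; apply/(nthP 0); exists n.
  have [b Ib bx] := eII _ Ix.
  (* Chosen so that one minus it is [(1 - e - b) * (1 - e)]: the factor [1 - e] brings [z] into the
     span of [x] and [t], and [1 - e - b] then kills [x] modulo [t]. *)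
  exists (e + (e + b) - (e + b) * e).
    by apply: ideal_sub (IM _ _ Ie) => //; apply: (ID) => //; apply: ID.
  have -> : 1 - (e + (e + b) - (e + b) * e) = (1 - e - b) * (1 - e) by ring.
  move=> z Iz; have [c [d [E td]]] := igen_cons (eI _ Iz).
  have -> : (1 - e - b) * (1 - e) * z = c * ((1 - e) * x - b * x) + (1 - e - b) * d.
    by rewrite -mulrA E; ring.
  by have [_ D M] := tI; apply: D; apply: M.
have [e Ie eI] := H (size s); exists e => // x /eI.
rewrite drop_size => /igen_nil/eqP; rewrite mulrBl mul1r subr_eq0 => /eqP //.
Qed.

Lemma noetherian_chain (I : nat -> A -> Prop) : noetherian ->
  (forall n, ideal (I n)) -> (forall n x, I n x -> I n.+1 x) ->
  exists n, forall m x, I m x -> I n x.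
Proof.
move=> nA iI Imono.
have Ile m n x : (m <= n)%N -> I m x -> I n x.
  move=> /subnK <-; elim: (n - m)%N => // d IH /IH; rewrite addSn; exact: Imono.
have iU : ideal (fun x => exists n, I n x).
  split=> [|x y [n nx] [m my]|a x [n nx]].
  - by exists 0%N; case: (iI 0%N).
  - exists (maxn n m); case: (iI (maxn n m)) => _ D _; apply: D.
      exact: Ile (leq_maxl _ _) nx.
    exact: Ile (leq_maxr _ _) my.
  - by exists n; case: (iI n) => _ _; apply.
have [s Us] := nA _ iU.
have [n sn] : exists n, forall x, x \in s -> I n x.
  have : forall x, x \in s -> exists n, I n x by move=> x xs; apply/Us; apply: mem_igen.
  elim: {Us} s => [|x s IH] xs; first by exists 0%N.
  have /IH[n nI] : forall y, y \in s -> exists n, I n y.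
    by move=> y ys; apply: xs; rewrite inE ys orbT.
  have [m mx] := xs x (mem_head _ _).
  exists (maxn m n) => y; rewrite inE => /orP[/eqP->|/nI].
    exact: Ile (leq_maxl _ _) mx.
  exact: Ile (leq_maxr _ _).
exists n => m x mx; have /Us sx : exists n, I n x by exists m.
exact: igen_sub sx.
Qed.

End Ideals.

(** For [f] the [q]-th power map this is the Frobenius power of [I]. *)
Definition iext (A B : comPzRingType) (f : A -> B) (I : A -> Prop) : B -> Prop :=
  igen (fun y => exists2 x, I x & y = f x).

Lemma idem_ideal_iext (A B : comPzRingType) (f : {rmorphism A -> B}) (I : A -> Prop) :
  idem_ideal I -> idem_ideal (iext f I).
Proof.
move=> [e Ie eI]; exists (f e); first by apply: mem_igen; exists e.
apply: igen_ind => [|x y {1}-> {1}->|a x {1}->|_ [x Ix ->]].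
- by rewrite mulr0.
- by rewrite mulrDr.
- by rewrite mulrCA.
- by rewrite -rmorphM -eI.
Qed.

Section PowerMaps.
Variables (A : comPzRingType) (f : {rmorphism A -> A}) (q : nat).
Hypothesis fE : forall x, f x = x ^+ q.

(** The idempotent [e] of the Frobenius power already lies in [I]. For [x] in [I],
    [x ^+ q = e * x ^+ q], so [((e - 1) * x) ^+ q] vanishes and reducedness gives [x = e * x]. *)
Lemma idem_ideal_root (I : A -> Prop) : (0 < q)%N -> reduced A -> ideal I ->
  idem_ideal (iext f I) -> idem_ideal I.
Proof.
move=> q0 redA iI [e Ie eI]; have eI' : I e.
  apply: igen_sub Ie => // _ [x Ix ->]; rewrite fE -(prednK q0) exprS.
  exact: ideal_mulr.
exists e => // x Ix; apply/eqP; rewrite eq_sym -subr_eq0; apply/eqP.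
apply: (redA _ q); rewrite -[X in _ - X]mul1r -mulrBl exprMn.
have ee : e * (1 - e) = 0 by rewrite mulrBr mulr1 -eI // subrr.
have -> : x ^+ q = e * x ^+ q by rewrite -fE; apply: eI; apply: mem_igen; exists x.
rewrite -(prednK q0) [(e - 1) ^+ _]exprS -opprB mulNr mulNr mulrCA.
by rewrite mulrA [X in X * _]mulrA -mulrA mulrA ee !mul0r oppr0.
Qed.

(* The ideals increase since [x ^+ q] lies in any ideal containing [x]; once the
   chain is stationary, [I = iext f I] is contained in the square of [I]. *)
Lemma idem_ideal_chain (I : nat -> A -> Prop) : (1 < q)%N -> noetherian A ->
  (forall n, ideal (I n)) -> (forall n x, I n x <-> iext f (I n.+1) x) ->
  idem_ideal (I 0).
Proof.
move=> q1 nA iI If.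
have I_S n x : I n x -> I n.+1 x.
  move=> /If; apply: igen_sub => // _ [y Iy ->].
  by rewrite fE -(prednK (ltnW q1)) exprS; apply: ideal_mulr.
have [n nI] := noetherian_chain nA iI I_S.
suff idn : idem_ideal (I n).
  elim: n {nI} idn => // n IH idn; apply: IH.
  by apply: idem_ideal_ext (idem_ideal_iext f idn) => x; split=> /If.
have [s Is] := nA _ (iI n).
apply: (idem_ideal_fg (iI n) Is) => x /If.
apply: igen_mono => _ [y /nI Iy ->].
exists y, (y ^+ q.-1); split=> //; last by rewrite fE -exprS prednK // ltnW.
have : (0 < q.-1)%N by rewrite -subn1 subn_gt0.
case: q.-1 => // m _; rewrite exprS; exact: ideal_mulr.
Qed.

End PowerMaps.

(** * Quotient modules and base change *)

Definition submod (A : comPzRingType) (M : lmodType A) (P : M -> Prop) : Prop :=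
  [/\ P 0, forall u v, P u -> P v -> P (u + v) & forall a u, P u -> P (a *: u)].

Definition mspan (A : comPzRingType) (M : lmodType A) (S : M -> Prop) (u : M) : Prop :=
  forall P, submod P -> (forall v, S v -> P v) -> P u.

Section Span.
Variables (A : comPzRingType) (M : lmodType A) (S : M -> Prop).

Lemma mspan_submod : submod (mspan S).
Proof.
split=> [P [] //|u v Su Sv P sP SP|a u Su P sP SP]; case: (sP) => _ PD PM.
  by apply: PD; [apply: Su | apply: Sv].
by apply: PM; apply: Su.
Qed.

Lemma mem_mspan u : S u -> mspan S u.
Proof. by move=> Su P _; apply. Qed.

Lemma mspan_ind (P : M -> Prop) : P 0 -> (forall u v, P u -> P v -> P (u + v)) ->
  (forall a u, P u -> P (a *: u)) -> (forall u, S u -> P u) ->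
  forall u, mspan S u -> P u.
Proof. by move=> P0 PD PM SP u; apply. Qed.

Lemma submodN (P : M -> Prop) u : submod P -> P u -> P (- u).
Proof. by case=> _ _ PM Pu; rewrite -scaleN1r; apply: PM. Qed.

Lemma submod_sum (P : M -> Prop) (T : Type) (r : seq T) (Q : pred T) (F : T -> M) :
  submod P -> (forall i, P (F i)) -> P (\sum_(i <- r | Q i) F i).
Proof. by case=> P0 PD _ PF; elim/big_ind: _. Qed.

Definition qmod_rel (u v : M) : bool := `[< mspan S (u - v) >].

Lemma qmod_relP u v : reflect (mspan S (u - v)) (qmod_rel u v).
Proof. exact: asboolP. Qed.

Lemma qmod_rel_refl : reflexive qmod_rel.
Proof. by move=> u; apply/qmod_relP; rewrite subrr; case: mspan_submod. Qed.

Lemma qmod_rel_sym : symmetric qmod_rel.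
Proof.
move=> u v; apply/qmod_relP/qmod_relP => /(submodN mspan_submod);
  by rewrite opprB.
Qed.

Lemma qmod_rel_trans : transitive qmod_rel.
Proof.
move=> v u w /qmod_relP uv /qmod_relP vw; apply/qmod_relP.
by rewrite -(subrKA v) ; case: mspan_submod => _ + _; apply.
Qed.

Canonical qmod_equiv := EquivRel qmod_rel qmod_rel_refl qmod_rel_sym qmod_rel_trans.

(** The quotient by the submodule spanned by an arbitrary set [S], so that no proof of closure
    enters the type. *)
Definition qmod : Type := {eq_quot qmod_equiv}.
HB.instance Definition _ := Choice.on qmod.
HB.instance Definition _ := EqQuotient.on qmod.

Definition qpi (u : M) : qmod := \pi_qmod u.

Lemma qpi_eq u v : qpi u = qpi v <-> mspan S (u - v).
Proof.
split=> [/(eqmodP qmod_equiv)/qmod_relP //|uv].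
by apply/(eqmodP qmod_equiv)/qmod_relP.
Qed.

Lemma qpi_surj x : exists u, x = qpi u.
Proof. by exists (repr x); rewrite /qpi reprK. Qed.

Definition qmod_add (x y : qmod) : qmod := qpi (repr x + repr y).
Definition qmod_opp (x : qmod) : qmod := qpi (- repr x).
Definition qmod_scale (a : A) (x : qmod) : qmod := qpi (a *: repr x).

Lemma qpi_repr u : mspan S (repr (qpi u) - u).
Proof. by apply/qpi_eq; rewrite /qpi reprK. Qed.

Lemma qmod_addE u v : qmod_add (qpi u) (qpi v) = qpi (u + v).
Proof.
apply/qpi_eq; rewrite opprD addrACA; case: mspan_submod => _ + _; apply; exact: qpi_repr.
Qed.

Lemma qmod_oppE u : qmod_opp (qpi u) = qpi (- u).
Proof. by apply/qpi_eq; rewrite -opprD; apply: submodN mspan_submod _; exact: qpi_repr. Qed.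

Lemma qmod_scaleE a u : qmod_scale a (qpi u) = qpi (a *: u).
Proof.
by apply/qpi_eq; rewrite -scalerBr; case: mspan_submod => _ _; apply; exact: qpi_repr.
Qed.

Lemma qmod_addA : associative qmod_add.
Proof.
move=> x y z; have [u ->] := qpi_surj x; have [v ->] := qpi_surj y.
by have [w ->] := qpi_surj z; rewrite !qmod_addE addrA.
Qed.
Lemma qmod_addC : commutative qmod_add.
Proof.
move=> x y; have [u ->] := qpi_surj x; have [v ->] := qpi_surj y.
by rewrite !qmod_addE addrC.
Qed.
Lemma qmod_add0 : left_id (qpi 0) qmod_add.
Proof. by move=> x; have [u ->] := qpi_surj x; rewrite qmod_addE add0r. Qed.
Lemma qmod_addN : left_inverse (qpi 0) qmod_opp qmod_add.
Proof. by move=> x; have [u ->] := qpi_surj x; rewrite qmod_oppE qmod_addE addNr. Qed.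

HB.instance Definition _ :=
  GRing.isZmodule.Build qmod qmod_addA qmod_addC qmod_add0 qmod_addN.

Lemma qpiD u v : qpi u + qpi v = qpi (u + v).
Proof. exact: qmod_addE. Qed.

Lemma qmod_scaleA a b x : qmod_scale a (qmod_scale b x) = qmod_scale (a * b) x.
Proof. by have [u ->] := qpi_surj x; rewrite !qmod_scaleE scalerA. Qed.
Lemma qmod_scale1 : left_id 1 qmod_scale.
Proof. by move=> x; have [u ->] := qpi_surj x; rewrite qmod_scaleE scale1r. Qed.
Lemma qmod_scaleDr : right_distributive qmod_scale +%R.
Proof.
move=> a x y; have [u ->] := qpi_surj x; have [v ->] := qpi_surj y.
by rewrite qpiD !qmod_scaleE qpiD scalerDr.
Qed.
Lemma qmod_scaleDl x : {morph qmod_scale^~ x : a b / a + b}.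
Proof.
move=> a b; have [u ->] := qpi_surj x.
by rewrite !qmod_scaleE qpiD scalerDl.
Qed.

HB.instance Definition _ := GRing.Zmodule_isLmodule.Build A qmod
  qmod_scaleA qmod_scale1 qmod_scaleDr qmod_scaleDl.

Lemma qpi_linear : linear qpi.
Proof. by move=> a u v; rewrite -qpiD -qmod_scaleE. Qed.

Lemma qpi0 u : qpi u = 0 <-> mspan S u.
Proof. by rewrite [0]/(qpi 0) qpi_eq subr0. Qed.

End Span.

Arguments qpi_linear {A M} S _ _ _.

Section Linear.
Variable A : comPzRingType.

Lemma linearZE (M N : lmodType A) (f : M -> N) : linear f -> forall a u, f (a *: u) = a *: f u.
Proof. by move=> /linear_semilinear[]. Qed.

Lemma linear0E (M N : lmodType A) (f : M -> N) : linear f -> f 0 = 0.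
Proof. by move=> lf; have := linearZE lf 0 0; rewrite !scale0r. Qed.

Lemma linearNE (M N : lmodType A) (f : M -> N) : linear f -> forall u, f (- u) = - f u.
Proof. by move=> lf u; rewrite -!scaleN1r linearZE. Qed.

Lemma linearBE (M N : lmodType A) (f : M -> N) : linear f -> forall u v, f (u - v) = f u - f v.
Proof. by move=> lf u v; rewrite linearDE // linearNE. Qed.

Lemma linear_sumE (M N : lmodType A) (f : M -> N) : linear f ->
  forall (T : Type) (r : seq T) (P : pred T) (F : T -> M),
  f (\sum_(i <- r | P i) F i) = \sum_(i <- r | P i) f (F i).
Proof.
move=> lf T r P F; elim/big_rec2: _ => [|i x y _ <-]; first exact: linear0E.
exact: linearDE.
Qed.

Lemma linear_funcomp (M N P : lmodType A) (f : M -> N) (g : N -> P) :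
  linear f -> linear g -> linear (fun u => g (f u)).
Proof. by move=> lf lg a u v; rewrite lf lg. Qed.

Lemma linear_ker (M N : lmodType A) (f : M -> N) : linear f -> submod (fun u => f u = 0).
Proof.
move=> lf; split=> [|u v fu fv|a u fu]; first exact: linear0E.
  by rewrite linearDE // fu fv addr0.
by rewrite linearZE // fu scaler0.
Qed.

Lemma qmod_lift (M N : lmodType A) (S : M -> Prop) (f : M -> N) : linear f ->
  (forall u, S u -> f u = 0) ->
  exists2 g : qmod S -> N, linear g & forall u, g (qpi S u) = f u.
Proof.
move=> lf f0; have f0' u : mspan S u -> f u = 0.
  by have [k0 kD kZ] := linear_ker lf; move: u; apply: mspan_ind.
have gE u : f (repr (qpi S u)) = f u.
  by apply/eqP; rewrite -subr_eq0 -linearBE // f0' //; exact: qpi_repr.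
exists (fun x => f (repr x)) => // a x y.
have [u ->] := qpi_surj x; have [v ->] := qpi_surj y.
by rewrite -qpi_linear !gE lf.
Qed.

End Linear.

Section SemiLinear.
Variables (A B : comPzRingType) (f : {rmorphism A -> B}).
Variables (M : lmodType A) (N : lmodType B) (g : M -> N).

Lemma semilinear0 : semilinear f g -> g 0 = 0.
Proof. by case=> _ gZ; have := gZ 0 0; rewrite rmorph0 !scale0r. Qed.

Lemma semilinearN : semilinear f g -> forall u, g (- u) = - g u.
Proof. by case=> _ gZ u; rewrite -!scaleN1r gZ rmorphN rmorph1. Qed.

Lemma semilinear_sum : semilinear f g ->
  forall (T : Type) (r : seq T) (P : pred T) (F : T -> M),
  g (\sum_(i <- r | P i) F i) = \sum_(i <- r | P i) g (F i).
Proof.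
move=> sg T r P F; elim/big_rec2: _ => [|i x y _ <-]; first exact: semilinear0.
by case: sg => ->.
Qed.

Hypothesis bc : is_base_change f g.

Lemma bc_semilinear : semilinear f g.
Proof. by case: bc. Qed.

Lemma bc_lift (P : lmodType B) (h : M -> P) : semilinear f h ->
  exists2 h' : N -> P, linear h' & forall u, h' (g u) = h u.
Proof. by case: bc => _ /(_ P h) H /H [h' [[h'l h'E] _]]; exists h'. Qed.

Lemma bc_uniq (P : lmodType B) (h h' : N -> P) : linear h -> linear h' ->
  (forall u, h (g u) = h' (g u)) -> forall v, h v = h' v.
Proof.
move=> lh lh' E; have sh : semilinear f (fun u => h (g u)).
  have [hD hZ] := (linear_semilinear h).1 lh; have [gD gZ] := bc_semilinear.
  by split=> *; rewrite ?gD ?gZ ?hD ?hZ.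
have [k [_ ku]] := bc.2 _ _ sh.
have <- : k = h by apply: ku.
have <- // : k = h' by apply: ku; split=> // u; rewrite E.
Qed.

(** The quotient map by the span of the image and the zero map agree after [g], so the uniqueness
    part of the universal property makes them equal. *)
Lemma bc_span v : mspan (fun w => exists u, w = g u) v.
Proof.
pose S := fun w => exists u, w = g u; apply/(qpi0 S v).
have l0 : linear (fun _ : N => 0 : qmod S) by move=> a u w; rewrite scaler0 addr0.
apply: (bc_uniq (qpi_linear S) l0) => u.
by apply/qpi0; apply: mem_mspan; exists u.
Qed.

End SemiLinear.

Lemma bc_iso (A B : comPzRingType) (f : {rmorphism A -> B})
  (M : lmodType A) (N N' : lmodType B) (g : M -> N) (h : N -> N') :
  is_base_change f g -> linear h -> bijective h -> is_base_change f (fun u => h (g u)).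
Proof.
move=> bc lh [k hK kK].
have lk : linear k by move=> a u v; rewrite -{1}[u]kK -{1}[v]kK -lh hK.
split; first exact: (semilinear_comp (bc_semilinear bc) ((linear_semilinear h).1 lh)).
move=> P j sj; have [j' lj' j'E] := bc_lift bc sj.
exists (fun v => j' (k v)); split.
  by split=> [|u]; [exact: linear_funcomp|rewrite hK].
move=> l [ll lE]; apply/funext => v; rewrite -[v in RHS]kK.
apply: (bc_uniq bc lj' (linear_funcomp lh ll)) => u.
by rewrite lE j'E.
Qed.

(** * Coordinates and relations with respect to generators *)

Section Comb.
Variables (A : comPzRingType) (M : lmodType A).

Definition comb n (e : 'I_n -> M) (c : 'rV[A]_n) : M := \sum_j c 0 j *: e j.

Definition gens n (e : 'I_n -> M) : Prop := forall u, exists c, u = comb e c.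

Lemma comb_linear n (e : 'I_n -> M) : linear (comb e).
Proof.
move=> a u v; rewrite /comb scaler_sumr -big_split; apply: eq_bigr => j _ /=.
by rewrite !mxE scalerDl scalerA.
Qed.

Lemma comb_delta n (e : 'I_n -> M) j : comb e (delta_mx 0 j) = e j.
Proof.
rewrite /comb (bigD1 j) //= mxE !eqxx scale1r big1 ?addr0 // => i ij.
by rewrite mxE eqxx (negbTE ij) scale0r.
Qed.

Lemma comb_row_mx n m (e : 'I_n -> M) (e' : 'I_m -> M) (E : 'I_(n + m) -> M) c c' :
  (forall i, E (lshift m i) = e i) -> (forall i, E (rshift n i) = e' i) ->
  comb E (row_mx c c') = comb e c + comb e' c'.
Proof.
move=> El Er; rewrite /comb big_split_ord; congr (_ + _); apply: eq_bigr => i _.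
  by rewrite row_mxEl El.
by rewrite row_mxEr Er.
Qed.

Lemma comb_mul n m (e : 'I_n -> M) (e' : 'I_m -> M) (B : 'M[A]_(m, n)) (c : 'rV_m) :
  (forall i, e' i = comb e (row i B)) -> comb e' c = comb e (c *m B).
Proof.
move=> eB; rewrite /comb; under eq_bigr do rewrite eB /comb scaler_sumr.
rewrite exchange_big; apply: eq_bigr => j _ /=.
rewrite !mxE scaler_suml; apply: eq_bigr => i _.
by rewrite scalerA mxE.
Qed.

Lemma fg_gens : finitely_generated M <-> exists n (e : 'I_n -> M), gens e.
Proof.
split=> -[n [e He]]; exists n, e => u; have [c ->] := He u.
  by exists (\row_j c j); apply: eq_bigr => j _; rewrite mxE.
by exists (c 0).
Qed.

End Comb.

Lemma row_comb (A : comPzRingType) n (c : 'rV[A]_n) : c = \sum_j c 0 j *: delta_mx 0 j.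
Proof. by rewrite [LHS]matrix_sum_delta big_ord1. Qed.

Lemma comb_semilinear (A B : comPzRingType) (f : {rmorphism A -> B}) (M : lmodType A)
    (N : lmodType B) (g : M -> N) n (e : 'I_n -> M) c : semilinear f g ->
  g (comb e c) = comb (fun i => g (e i)) (map_mx f c).
Proof.
move=> sg; rewrite /comb (semilinear_sum sg); apply: eq_bigr => j _.
by rewrite sg.2 mxE.
Qed.

Section BaseChangeRel.
Variables (A B : comPzRingType) (f : {rmorphism A -> B}).
Variables (M : lmodType A) (N : lmodType B) (g : M -> N).
Hypothesis bc : is_base_change f g.
Variables (n : nat) (e : 'I_n -> M).
Hypothesis ge : gens e.

Lemma bc_gens : gens (fun i => g (e i)).
Proof.
have lE := comb_linear (fun i => g (e i)).
move=> v; move: v (bc_span bc v); apply: mspan_ind.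
- by exists 0; rewrite (linear0E lE).
- by move=> _ _ [c ->] [d ->]; exists (c + d); rewrite (linearDE lE).
- by move=> a _ [c ->]; exists (a *: c); rewrite (linearZE lE).
- move=> _ [u ->]; have [c ->] := ge u; exists (map_mx f c).
  exact: comb_semilinear (bc_semilinear bc).
Qed.

(* Relations of the base change come from relations of [M]: map the base change
   to the quotient of the free module by the latter. *)
Lemma bc_rel (c : 'rV[B]_n) : comb (fun i => g (e i)) c = 0 ->
  mspan (fun r => exists2 d, comb e d = 0 & r = map_mx f d) c.
Proof.
pose S := fun r : 'rV[B]_n => exists2 d, comb e d = 0 & r = map_mx f d.
move=> c0; apply/(qpi0 S).
have [co coE] := choice ge.
pose h u := qpi S (map_mx f (co u)).
have hE d : h (comb e d) = qpi S (map_mx f d).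
  apply/qpi_eq; apply: mem_mspan; exists (co (comb e d) - d); last by rewrite map_mxB.
  by rewrite (linearBE (comb_linear e)) -coE subrr.
have sh : semilinear f h.
  have lq := @qpi_linear _ _ S.
  split=> [u v|a u].
    rewrite {1}(coE u) {1}(coE v).
    by rewrite -(linearDE (comb_linear e)) hE map_mxD (linearDE lq).
  by rewrite {1}(coE u) -(linearZE (comb_linear e)) hE map_mxZ (linearZE lq).
have [h' lh' h'E] := bc_lift bc sh.
have := congr1 h' c0; rewrite (linear0E lh') => <-.
rewrite {1}[c]row_comb (linear_sumE (qpi_linear S)) (linear_sumE lh').
apply: eq_bigr => j _; rewrite (linearZE (qpi_linear S)) (linearZE lh') h'E.
by rewrite -{1}(comb_delta e j) hE map_delta_mx.
Qed.

End BaseChangeRel.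

(** * Fitting ideals *)

Section DetSpan.
Variables (A : comPzRingType) (I : A -> Prop).
Hypothesis iI : ideal I.

(** The determinant is linear in each row of [K], so rows in the span are replaced by rows in [S]
    one at a time; in the induction [k] counts the rows not yet known to lie in [S]. *)
Lemma det_rows_span n s (S : 'rV[A]_n -> Prop) (N : 'M[A]_(n, s)) :
  (forall K : 'M_(s, n), (forall i, S (row i K)) -> I (\det (K *m N))) ->
  forall K : 'M_(s, n), (forall i, mspan S (row i K)) -> I (\det (K *m N)).
Proof.
move=> SI.
suff H k (K : 'M_(s, n)) : (forall i : 'I_s, (k <= i)%N -> S (row i K)) ->
    (forall i, mspan S (row i K)) -> I (\det (K *m N)).
  by move=> K; apply: (H s) => i; rewrite leqNgt ltn_ord.
elim: k K => [|k IH] K SK mK; first by apply: SI => i; apply: SK.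
have [ks|sk] := ltnP k s; last first.
  by apply: IH => // i ki; have := leq_trans sk ki; rewrite leqNgt ltn_ord.
pose k0 := Ordinal ks.
pose Kv (v : 'rV[A]_n) : 'M_(s, n) := \matrix_(i, j) if i == k0 then v 0 j else K i j.
have rk v : row k0 (Kv v) = v by apply/rowP => j; rewrite !mxE eqxx.
have rnk v i : i != k0 -> row i (Kv v) = row i K.
  by move=> ik; apply/rowP => j; rewrite !mxE (negbTE ik).
have r'k v w : row' k0 (Kv v *m N) = row' k0 (Kv w *m N).
  apply/row_matrixP => i; apply/rowP => j; rewrite !mxE; apply: eq_bigr => l _.
  by rewrite !mxE eq_sym (negbTE (neq_lift _ _)).
have lin a b v w : \det (Kv (a *: v + b *: w) *m N) =
    a * \det (Kv v *m N) + b * \det (Kv w *m N).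
  apply: (@determinant_multilinear _ _ _ _ _ k0); try exact: r'k.
  by rewrite !row_mul !rk mulmxDl !scalemxAl.
have -> : K = Kv (row k0 K).
  by apply/matrixP => i j; rewrite !mxE; case: eqP => // ->.
have [I0 ID IM] := iI.
move: (row k0 K) (mK k0); apply: mspan_ind => [|u v Iu Iv|a u Iu|u Su].
- by have := lin 0 0 0 0; rewrite !scale0r !mul0r addr0 => ->; rewrite addr0.
- by have := lin 1 1 u v; rewrite !scale1r !mul1r => ->; apply: ID.
- by have := lin a 0 u 0; rewrite scaler0 mul0r !addr0 => ->; apply: IM.
apply: IH => i.
  by have [->|ik] := eqVneq i k0; rewrite ?rk // rnk // => ki; apply: SK;
    rewrite ltn_neqAle ki andbT eq_sym.
by have [->|ik] := eqVneq i k0; rewrite ?rk ?rnk //; apply: mem_mspan.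
Qed.

End DetSpan.

(* The ideal of s x s minors of the relations between the [e i]. Arbitrary [N]
   in place of selections of columns give the same ideal (Cauchy-Binet). *)
Definition dideal (A : comPzRingType) (M : lmodType A) n (e : 'I_n -> M) s : A -> Prop :=
  igen (fun a => exists (K : 'M_(s, n)) (N : 'M_(n, s)),
    (forall i, comb e (row i K) = 0) /\ a = \det (K *m N)).

Lemma dideal_ideal (A : comPzRingType) (M : lmodType A) n (e : 'I_n -> M) s :
  ideal (dideal e s).
Proof. exact: igen_ideal. Qed.

Lemma dideal_det (A : comPzRingType) (M : lmodType A) n (e : 'I_n -> M) s
    (K : 'M_(s, n)) (N : 'M_(n, s)) :
  (forall i, comb e (row i K) = 0) -> dideal e s (\det (K *m N)).
Proof. by move=> K0; apply: mem_igen; exists K, N. Qed.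

(** Relations over [B] are spanned by images of relations over [A], and arbitrary columns by images
    of columns over [A]. Multilinearity of the determinant then reduces every minor to minors coming
    from [A]. *)
Lemma dideal_bc (A B : comPzRingType) (f : {rmorphism A -> B})
    (M : lmodType A) (N : lmodType B) (g : M -> N) n (e : 'I_n -> M) s :
  is_base_change f g -> gens e ->
  forall x, dideal (fun i => g (e i)) s x <-> iext f (dideal e s) x.
Proof.
move=> bc ge x; have iJ := igen_ideal (fun y => exists2 x, dideal e s x & y = f x).
split; last first.
  apply: igen_sub; first exact: dideal_ideal.
  move=> _ [a ea ->]; move: a ea; have [D0 DD DM] := dideal_ideal (fun i => g (e i)) s.
  apply: igen_ind => [|a b ga gb|a b gb|_ [K [L [K0 ->]]]].
  - by rewrite rmorph0.
  - by rewrite rmorphD; apply: DD.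
  - by rewrite rmorphM; apply: DM.
  - rewrite -det_map_mx map_mxM; apply: dideal_det => i.
    have sg := bc_semilinear bc.
    by rewrite -map_row -(comb_semilinear _ _ sg) K0 (semilinear0 sg).
apply: igen_sub => // _ [K [L [K0 ->]]].
apply: (det_rows_span iJ) (fun i => bc_rel bc ge (K0 i)) => {K0}K KS.
have /choice[K1 K1E] : forall i, exists d, comb e d = 0 /\ row i K = map_mx f d.
  by move=> i; have [d d0 dE] := KS i; exists d.
have -> : K = map_mx f (\matrix_i K1 i).
  by apply/row_matrixP => i; rewrite -map_row rowK; case: (K1E i).
(* Transposition turns the columns of [L] into rows, so that the same multilinearity argument
   replaces them by vectors with entries from [A]. *)
rewrite -det_tr trmx_mul.
apply: (det_rows_span iJ (S := fun r => exists d : 'rV[A]_n, r = map_mx f d)).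
  move=> L' L'S; have [L1 L1E] := choice L'S.
  have -> : L' = map_mx f (\matrix_i L1 i).
    by apply/row_matrixP => i; rewrite -map_row rowK L1E.
  rewrite map_trmx -map_mxM det_map_mx; apply: mem_igen; eexists; last by [].
  rewrite -det_tr trmx_mul !trmxK; apply: dideal_det => i.
  by rewrite rowK; case: (K1E i).
move=> i; have sS := mspan_submod (fun r : 'rV[B]_n => exists d : 'rV[A]_n, r = map_mx f d).
have [_ _ mZ] := sS; rewrite [row i _]row_comb; apply: (submod_sum _ _ sS) => j.
apply: mZ; apply: mem_mspan.
by exists (delta_mx 0 j); rewrite map_delta_mx.
Qed.

(** * Determinants of bordered matrices and of rank-one perturbations *)

Section Bordered.
Variable A : comPzRingType.

Lemma lift_lift0 n (j : 'I_n.+1) (b : 'I_n) :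
  lift (lift ord0 j) (lift ord0 b) = lift ord0 (lift j b).
Proof. by apply: val_inj; rewrite /= /bump /= !add1n ltnS addnS. Qed.

(** The Schur complement formula cleared of denominators: expand along the first row, then each
    cofactor along the first column. *)
Lemma det_bordered n (x : 'M[A]_1) (w : 'M_(1, n)) (k : 'M_(n, 1)) (G : 'M_n) :
  \det (block_mx x w k G) = x 0 0 * \det G - (w *m \adj G *m k) 0 0.
Proof.
set M := block_mx _ _ _ _; have M0 i : M (lift ord0 i) ord0 = k i 0.
  by have := block_mxEdl x w k G i 0; congr (M _ _ = _); apply: val_inj.
have MG i j : M (lift ord0 i) (lift ord0 j) = G i j.
  by have := block_mxEdr x w k G i j; congr (M _ _ = _); apply: val_inj.
have Mw j : M ord0 (lift ord0 j) = w 0 j.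
  by have := block_mxEur x w k G 0 j; congr (M _ _ = _); apply: val_inj.
have M00 : M ord0 ord0 = x 0 0.
  by have := block_mxEul x w k G 0 0; congr (M _ _ = _); apply: val_inj.
clearbody M; rewrite (expand_det_row M ord0) big_ord_recl M00; congr (_ * _ + _).
  rewrite /cofactor addn0 expr0 mul1r; congr (\det _).
  by apply/matrixP => i j; rewrite !mxE MG.
case: n => [|n] in w k G M M0 MG Mw M00 *.
  by rewrite big_ord0 -mulmxA mxE big_ord0 oppr0.
rewrite -mulmxA mxE -sumrN; apply: eq_bigr => j _.
rewrite Mw -mulrN; congr (_ * _).
rewrite /cofactor (expand_det_col _ ord0) mulr_sumr mxE -sumrN; apply: eq_bigr => i _.
rewrite [\adj G _ _]mxE !mxE.
have -> : lift (lift ord0 j) ord0 = ord0 :> 'I_(1 + n.+1) by apply: val_inj.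
rewrite M0 /cofactor.
have -> : row' i (col' ord0 (row' ord0 (col' (lift ord0 j) M))) = row' i (col' j G).
  by apply/matrixP => a b; rewrite !mxE lift_lift0 MG.
rewrite add0n addn0 exprD [(-1) ^+ lift ord0 j]exprS mulN1r; ring.
Qed.

(** The matrix determinant lemma. Multiplying the block matrix with rows [(1, - q)] and [(c, G)] by
    the unipotent one with rows [(1, q)] and [(0, 1)] clears the top right corner and turns [G] into
    [c *m q + G]. *)
Lemma det_rank1 n (c : 'M[A]_(n, 1)) (q : 'M_(1, n)) (G : 'M_n) :
  \det (c *m q + G) = \det G + (q *m \adj G *m c) 0 0.
Proof.
have := det_bordered 1%:M (- q) c G.
rewrite !mulNmx [X in _ - X]mxE opprK [X in X * _]mxE eqxx mul1r => <-.
have <- : \det (block_mx (1%:M : 'M[A]_1) 0 c (c *m q + G)) = \det (c *m q + G).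
  by rewrite det_lblock det1 mul1r.
have E : \det (block_mx (1%:M : 'M[A]_1) q 0 (1%:M : 'M_n)) = 1.
  by rewrite det_ublock !det1 mulr1.
rewrite -[RHS]mulr1 -[X in _ = _ * X]E -det_mulmx mulmx_block.
by rewrite ?mulmx1 ?mulmx0 ?mul1mx ?addr0 ?subrr.
Qed.

End Bordered.

Section Fitting.
Variables (A : comPzRingType) (M : lmodType A).
Implicit Types (n m s : nat).

Lemma row'_col'_mul n s (K : 'M[A]_(s.+1, n)) (N : 'M_(n, s.+1)) i j :
  row' i (col' j (K *m N)) = row' i K *m col' j N.
Proof.
by apply/matrixP => a b; rewrite !mxE; apply: eq_bigr => l _; rewrite !mxE.
Qed.

Lemma comb_row' n s (e : 'I_n -> M) (K : 'M_(s.+1, n)) i :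
  (forall i, comb e (row i K) = 0) -> forall a, comb e (row a (row' i K)) = 0.
Proof.
move=> K0 a; rewrite -[RHS](K0 (lift i a)); congr comb.
by apply/rowP => j; rewrite !mxE.
Qed.

Lemma det_cofactor_ideal n (I : A -> Prop) (G : 'M_n.+1) : ideal I ->
  (forall i j, I (cofactor G i j)) -> I (\det G).
Proof.
move=> iI GI; rewrite (expand_det_row G ord0); apply: ideal_sum => // j.
by case: (iI) => _ _; apply.
Qed.

Lemma det_rank1_ideal n (I : A -> Prop) (c : 'M_(n.+1, 1)) (q : 'M_(1, n.+1)) G :
  ideal I -> (forall i j, I (cofactor G i j)) -> I (\det (c *m q + G)).
Proof.
move=> iI GI; rewrite det_rank1; have [_ ID IM] := iI.
apply: ID; first exact: det_cofactor_ideal.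
rewrite -mulmxA mxE; apply: ideal_sum => // i; apply: (IM); rewrite mxE.
by apply: ideal_sum => // j; rewrite mulrC mxE; apply: IM.
Qed.

Lemma dideal_S n (e : 'I_n -> M) s x : dideal e s.+1 x -> dideal e s x.
Proof.
apply: igen_sub; first exact: dideal_ideal.
move=> _ [K [N [K0 ->]]]; apply: det_cofactor_ideal => [|i j].
  exact: dideal_ideal.
have [_ _ DM] := dideal_ideal e s; apply: DM.
by rewrite row'_col'_mul; apply: dideal_det; apply: comb_row'.
Qed.

Lemma dideal_le n (e : 'I_n -> M) s t x : (s <= t)%N -> dideal e t x -> dideal e s x.
Proof. by move=> /subnK <-; elim: (t - s)%N => // d IH /dideal_S. Qed.

Lemma dideal0 n (e : 'I_n -> M) x : dideal e 0 x.
Proof.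
rewrite -[x]mulr1 -(det_mx00 ((0 : 'M_(0, n)) *m 0)).
by case: (dideal_ideal e 0) => _ _; apply; apply: dideal_det => -[].
Qed.

(* [C *m Q] is a sum of [m] matrices of rank one, each of which lowers the size of
   the available minors by one. *)
Lemma dideal_rank m n (e : 'I_n -> M) s (C : 'M_(m + s, m)) Q (L : 'M_(m + s, n)) N :
  (forall i, comb e (row i L) = 0) -> dideal e s (\det (C *m Q + L *m N)).
Proof.
elim: m C Q L N => [|m IH] C Q L N L0.
  by rewrite [C]thinmx0 mul0mx add0r; apply: dideal_det.
rewrite -[C](@hsubmxK _ _ 1 m) -[Q](@vsubmxK _ 1 m) (@mul_row_col _ _ 1 m) -addrA.
set C2 := @rsubmx _ _ 1 m C; set Q2 := @dsubmx _ 1 m _ Q.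
apply: det_rank1_ideal => [|i j]; first exact: dideal_ideal.
have [_ _ DM] := dideal_ideal e s; apply: DM.
have -> : row' i (col' j (C2 *m Q2 + L *m N)) =
    row' i C2 *m col' j Q2 + row' i L *m col' j N.
  by rewrite -!row'_col'_mul; apply/matrixP => a b; rewrite !mxE.
by apply: IH; apply: comb_row'.
Qed.

(** Redundant generators, [m] of them, shift the size of the minors by [m]. With [B] expressing [e']
    through [e], a relation [(C, C')] of the enlarged family gives the relation [C + C' *m B] of
    [e], and the rest of the product factors through rank [m]. Conversely the relations [(- B, 1)]
    border any minor by an identity block. *)
Lemma dideal_cat n m (e : 'I_n -> M) (e' : 'I_m -> M) (E : 'I_(n + m) -> M) s x :
  gens e -> (forall i, E (lshift m i) = e i) -> (forall i, E (rshift n i) = e' i) ->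
  dideal E (m + s) x <-> dideal e s x.
Proof.
move=> ge El Er; have [b bE] := choice (fun i => ge (e' i)).
pose B := \matrix_i b i; have e'E i : e' i = comb e (row i B) by rewrite rowK.
split; (apply: igen_sub; first exact: dideal_ideal); move=> _ [K [N [K0 ->]]].
  rewrite -[K]hsubmxK -[N]vsubmxK mul_row_col.
  set C := lsubmx K; set C' := rsubmx K; set N1 := usubmx N; set N2 := dsubmx N.
  have -> : C *m N1 + C' *m N2 = C' *m (N2 - B *m N1) + (C + C' *m B) *m N1.
    by rewrite mulmxBr mulmxDl mulmxA [RHS]addrC -addrA [X in _ = _ + X]addrC subrK.
  apply: dideal_rank => i.
  rewrite linearD /= row_mul (linearDE (comb_linear e)) -(comb_mul _ e'E).
  by rewrite -(comb_row_mx _ _ El Er) -row_row_mx hsubmxK.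
have -> : \det (K *m N) = \det (block_mx (- B) 1%:M K 0 *m block_mx 0 N 1%:M 0).
  rewrite mulmx_block !(mulmx0, mul0mx, mul1mx, mulmx1, addr0, add0r).
  by rewrite det_ublock det1 mul1r.
apply: dideal_det => i; rewrite -[i]splitK; case: (split i) => {}i /=.
  rewrite rowKu row_row_mx (comb_row_mx _ _ El Er) (comb_mul _ e'E) linearN /= row1 -rowE.
  by rewrite (linearNE (comb_linear e)) addNr.
by rewrite rowKd row_row_mx (comb_row_mx _ _ El Er) K0 row0 (linear0E (comb_linear e')) addr0.
Qed.

Lemma dideal_inj n m (E : 'I_m -> M) (h : 'I_n -> 'I_m) s x : injective h ->
  dideal (fun i => E (h i)) s x -> dideal E s x.
Proof.
move=> hI; pose H : 'M[A]_(n, m) := \matrix_(i, j) (h i == j)%:R.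
have rH i : row i H = delta_mx 0 (h i).
  by apply/rowP => j; rewrite !mxE eqxx eq_sym.
have EH i : E (h i) = comb E (row i H) by rewrite rH comb_delta.
have HH : H *m H^T = 1%:M.
  apply/row_matrixP => i; rewrite row_mul rH -rowE row1; apply/rowP => j.
  by rewrite !mxE eqxx /= -(inj_eq hI).
apply: igen_sub; first exact: dideal_ideal.
move=> _ [K [N [K0 ->]]]; rewrite -[K]mulmx1 -HH mulmxA -mulmxA.
by apply: dideal_det => i; rewrite row_mul -(comb_mul _ EH).
Qed.

(** The [j]-th Fitting ideal. Truncated subtraction makes it the unit ideal for [j >= n], the
    determinant of size zero being [1]. *)
Definition fitting n (e : 'I_n -> M) (j : nat) : A -> Prop := dideal e (n - j).

Lemma fitting_cat n m (e : 'I_n -> M) (e' : 'I_m -> M) (E : 'I_(n + m) -> M) j x :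
  gens e -> (forall i, E (lshift m i) = e i) -> (forall i, E (rshift n i) = e' i) ->
  fitting E j x <-> fitting e j x.
Proof.
move=> ge El Er; rewrite /fitting; have [jn|nj] := leqP j n.
  have -> : (n + m - j = m + (n - j))%N by rewrite addnC addnBA.
  exact: dideal_cat El Er.
have /eqP-> : (n - j == 0)%N by rewrite subn_eq0 ltnW.
split=> _; first exact: dideal0.
apply: (@dideal_le _ _ _ (m + 0)); last by apply/(dideal_cat 0 x ge El Er); apply: dideal0.
by rewrite addn0 leq_subLR leq_add2r ltnW.
Qed.

(** Both families are compared with their concatenation; the two orders of concatenation differ by
    the swap [h]. *)
Lemma fitting_gens n m (e : 'I_n -> M) (e' : 'I_m -> M) j x :
  gens e -> gens e' -> fitting e j x <-> fitting e' j x.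
Proof.
move=> ge ge'.
pose E k l (f : 'I_k -> M) (g : 'I_l -> M) (i : 'I_(k + l)) :=
  match split i with inl i => f i | inr i => g i end.
have El k l (f : 'I_k -> M) (g : 'I_l -> M) i : E k l f g (lshift l i) = f i.
  by rewrite /E (unsplitK (inl i)).
have Er k l (f : 'I_k -> M) (g : 'I_l -> M) i : E k l f g (rshift k i) = g i.
  by rewrite /E (unsplitK (inr i)).
rewrite -(fitting_cat _ _ ge (El _ _ _ e') (Er _ _ e e')).
rewrite -(fitting_cat _ _ ge' (El _ _ _ e) (Er _ _ e' e)).
pose h k l (i : 'I_(k + l)) : 'I_(l + k) :=
  match split i with inl i => rshift l i | inr i => lshift k i end.
have hK k l : cancel (@h k l) (@h l k).
  move=> i; rewrite -{2}[i]splitK /h; case: (split i) => {}i /=.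
    by rewrite (unsplitK (inr i)).
  by rewrite (unsplitK (inl i)).
have hE k l f g i : E k l f g i = E l k g f (h k l i).
  by rewrite /h -{1}[i]splitK; case: (split i) => {}i /=; rewrite ?El ?Er.
have mn : (m + n - j = n + m - j)%N by rewrite addnC.
rewrite /fitting mn; split=> H.
  apply: (@dideal_inj _ _ _ (@h n m)); first exact: can_inj (@hK n m).
  by rewrite (_ : (fun i => _) = E n m e e') //; apply/funext => i; rewrite -hE.
apply: (@dideal_inj _ _ _ (@h m n)); first exact: can_inj (@hK m n).
by rewrite (_ : (fun i => _) = E m n e' e) //; apply/funext => i; rewrite -hE.
Qed.

End Fitting.

(** * Projectivity from idempotent Fitting ideals *)

Section FreeFactor.
Variables (A : comPzRingType) (M : lmodType A).

(** Multiplication by [a] factors through a finite free module. Such [a] form an ideal, so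
    projectivity, the case [a = 1], can be obtained from a partition of unity. *)
Definition free_factor (a : A) : Prop :=
  exists (n : nat) (e : 'I_n -> M) (phi : 'I_n -> M -> A^o),
    (forall i, linear (phi i)) /\ forall u, a *: u = \sum_i (phi i u : A) *: e i.

Definition fg_projective : Prop := free_factor 1.

Lemma free_factor_ideal : ideal free_factor.
Proof.
split=> [|a b [n [e [f [lf fE]]]] [m [e' [f' [lf' fE']]]]|a b [n [e [f [lf fE]]]]].
- exists 0%N, (fun=> 0), (fun=> fun=> 0); split=> [[]//|u].
  by rewrite scale0r big_ord0.
- exists (n + m)%N, (fun i => match split i with inl i => e i | inr i => e' i end),
    (fun i => match split i with inl i => f i | inr i => f' i end); split.
    by move=> i; case: (split i).
  move=> u; rewrite scalerDl fE fE' big_split_ord; congr (_ + _); apply: eq_bigr => i _.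
    by rewrite (unsplitK (inl i)).
  by rewrite (unsplitK (inr i)).
- exists n, e, (fun i u => a *: f i u); split=> [i c u v|u].
    by rewrite lf scalerDr !scalerA [c * a]mulrC.
  by rewrite -scalerA fE scaler_sumr; apply: eq_bigr => i _; rewrite scalerA.
Qed.

(* The functional [det G *: v - v N adj(G) K] lifts [det G] times the identity, and
   sends relations to minors of size [s.+1] by [det_bordered]. *)
Lemma free_factor_det n (e : 'I_n -> M) s (K : 'M_(s, n)) (N : 'M_(n, s)) b :
  gens e -> (forall i, comb e (row i K) = 0) ->
  (forall x, dideal e s.+1 x -> b * x = 0) -> free_factor (b * \det (K *m N)).
Proof.
move=> ge K0 b0; set G := K *m N.
pose Phi (v : 'rV[A]_n) := \det G *: v - v *m N *m \adj G *m K.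
have PhiL : linear Phi.
  move=> a u v; rewrite /Phi !mulmxDl -!scalemxAl scalerDr scalerBr !scalerA.
  by rewrite [a * _]mulrC opprD addrACA.
have Phi_rel v : comb e v = 0 -> b *: Phi v = 0.
  move=> v0; apply/rowP => j; rewrite mxE [RHS]mxE; apply: b0.
  have -> : Phi v 0 j = \det G * v 0 j - (v *m N *m \adj G *m K) 0 j.
    by rewrite /Phi mxE; congr (_ + _); rewrite mxE.
  have -> : \det G * v 0 j - (v *m N *m \adj G *m K) 0 j =
      \det (block_mx (v *m delta_mx j 0) (v *m N) (K *m delta_mx j 0) G).
    have cE (w : 'rV[A]_n) : (w *m delta_mx j (0 : 'I_1)) 0 0 = w 0 j.
      by rewrite -colE mxE.
    by rewrite det_bordered [in RHS]mulmxA !cE mulrC.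
  rewrite -mul_col_row; apply: (@dideal_det _ _ _ _ (1 + s)) => i.
  rewrite -[i]splitK; case: (split i) => {}i /=; last by rewrite rowKd.
  by rewrite rowKu row_id.
have [co coE] := choice ge.
(* The choice [co] of coordinates is not linear, but its defects of linearity are relations, which
   [b *: Phi] kills. *)
exists n, e, (fun j u => b * Phi (co u) 0 j); split=> [j a u v|u].
  have /Phi_rel/rowP/(_ j) : comb e (co (a *: u + v) - (a *: co u + co v)) = 0.
    by rewrite (linearBE (comb_linear e)) (comb_linear e) -!coE subrr.
  rewrite (linearBE PhiL) PhiL !mxE => /eqP; rewrite mulrBr subr_eq0 => /eqP->.
  by rewrite mulrDr mulrCA.
under eq_bigr do rewrite -scalerA; rewrite -scaler_sumr.
rewrite -[\sum_i _]/(comb e (Phi (co u))) (linearBE (comb_linear e)).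
rewrite (linearZE (comb_linear e)) -coE.
rewrite -(comb_mul (e' := fun=> 0)) => [|i]; last by rewrite K0.
by rewrite [comb (fun=> 0) _]big1 ?subr0 ?scalerA // => i _; rewrite scaler0.
Qed.

(** A square matrix of size [n.+1] that factors through [n] columns is singular: padding by a zero
    column and a zero row makes both factors square. *)
Lemma dideal_oversize n (e : 'I_n -> M) x : dideal e n.+1 x -> x = 0.
Proof.
move: x; apply: igen_ind => [//|x y -> ->|a x ->|_ [K [N [_ ->]]]]; rewrite ?addr0 ?mulr0 //.
have -> : K *m N = row_mx (0 : 'M_(n.+1, 1)) K *m col_mx (0 : 'M_(1, n.+1)) N.
  by rewrite mul_row_col mul0mx add0r.
rewrite det_mulmx (expand_det_col _ ord0) big1 ?mul0r // => i _.
have := row_mxEl (0 : 'M_(n.+1, 1)) K i 0; rewrite [RHS]mxE => E.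
have -> : row_mx (0 : 'M_(n.+1, 1)) K i ord0 = 0.
  by rewrite -[RHS]E; congr (row_mx _ _ _ _); apply: val_inj.
exact: mul0r.
Qed.

Definition idem_fitting : Prop :=
  exists n (e : 'I_n -> M), gens e /\ forall s, idem_ideal (dideal e s).

(* With [x s] the idempotent generating the [s]-th ideal, [x s * (1 - x s.+1)]
   factors through a free module; these telescope to [x 0 = 1]. *)
Lemma idem_fitting_projective : idem_fitting -> fg_projective.
Proof.
move=> [n [e [ge ide]]]; have [T0 TD TM] := free_factor_ideal.
have /choice[x xE] : forall s, exists x, dideal e s x /\ forall y, dideal e s y -> y = x * y.
  by move=> s; have [x xs xP] := ide s; exists x.
suff H d s : (s + d = n.+1)%N -> free_factor (x s).
  have := H _ _ (add0n n.+1); congr free_factor.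
  by rewrite -[LHS]mulr1; apply/esym; apply: (xE 0%N).2; apply: dideal0.
elim: d s => [|d IH] s.
  by rewrite addn0 => ->; have := (xE n.+1).1 => /dideal_oversize->.
rewrite addnS -addSn => /IH Ts.
have -> : x s = (1 - x s.+1) * x s + x s * x s.+1 by ring.
apply: (TD); last exact: (TM).
have := (xE s).1; move: (x s); apply: igen_ind => [|a b Ta Tb|a b Tb|_ [K [N [K0 ->]]]].
- by rewrite mulr0.
- by rewrite mulrDr; apply: TD.
- by rewrite mulrCA; apply: TM.
- apply: free_factor_det => // y /(xE s.+1).2 yE.
  by rewrite mulrBl mul1r -yE subrr.
Qed.

Lemma idem_fitting_gens n (e : 'I_n -> M) : gens e -> idem_fitting ->
  forall j, idem_ideal (fitting e j).
Proof.
move=> ge [m [e' [ge' ide']]] j.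
by apply: idem_ideal_ext (ide' (m - j)%N) => x; apply: fitting_gens.
Qed.

Lemma idem_fittingI n (e : 'I_n -> M) : gens e ->
  (forall j, idem_ideal (fitting e j)) -> idem_fitting.
Proof.
move=> ge ide; exists n, e; split=> // s; have [sn|ns] := leqP s n.
  by have := ide (n - s)%N; rewrite /fitting subKn.
exists 0; first by case: (dideal_ideal e s).
by move=> x /(dideal_le ns)/dideal_oversize->; rewrite mulr0.
Qed.

End FreeFactor.

Section BaseChangeFitting.
Variables (A B : comPzRingType) (f : {rmorphism A -> B}).
Variables (M : lmodType A) (N : lmodType B) (g : M -> N).
Hypothesis bc : is_base_change f g.

Lemma bc_idem_fitting : idem_fitting M -> idem_fitting N.
Proof.
move=> [n [e [ge ide]]]; exists n, (fun i => g (e i)); split.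
  exact: (bc_gens bc).
move=> s; apply: idem_ideal_ext (idem_ideal_iext f (ide s)) => x.
by split=> /(dideal_bc _ bc ge).
Qed.

(** The coordinate functionals of [M] extend along the base change, so [g u = 0] makes every
    coordinate of [u] vanish in [B], hence in [A]. *)
Lemma bc_inj : fg_projective M -> injective f -> forall u, g u = 0 -> u = 0.
Proof.
move=> [n [e [phi [lphi phiE]]]] fI u gu.
have sphi i : semilinear f (fun u => f (phi i u) : B^o).
  have [pD pZ] := (linear_semilinear (phi i)).1 (lphi i).
  by split=> *; rewrite ?pD ?pZ ?rmorphD ?rmorphM.
rewrite -[u]scale1r phiE big1 // => i _.
have [h lh hE] := bc_lift bc (sphi i).
have -> : phi i u = 0 by apply: fI; rewrite rmorph0 -hE gu (linear0E lh).
exact: scale0r.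
Qed.

End BaseChangeFitting.

(** * Fitting ideals along Frobenius pullbacks *)

Section FrobeniusDescent.
Variables (A : comPzRingType) (f : {rmorphism A -> A}) (q : nat).
Hypothesis fE : forall x, f x = x ^+ q.

Lemma fitting_bc (M N : lmodType A) (g : M -> N) n (e : 'I_n -> M) m (e' : 'I_m -> N) j x :
  is_base_change f g -> gens e -> gens e' ->
  fitting e' j x <-> iext f (fitting e j) x.
Proof.
move=> bc ge ge'; rewrite -(fitting_gens _ _ (bc_gens bc ge) ge').
exact: dideal_bc.
Qed.

Lemma idem_fitting_descent (M N : lmodType A) (g : M -> N) : (0 < q)%N -> reduced A ->
  is_base_change f g -> finitely_generated M -> idem_fitting N -> idem_fitting M.
Proof.
move=> q0 redA bc /fg_gens[n [e ge]] idN.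
apply: (idem_fittingI ge) => j; apply: (idem_ideal_root fE) => //; first exact: igen_ideal.
apply: idem_ideal_ext (idem_fitting_gens (bc_gens bc ge) idN j) => x.
exact: fitting_bc bc ge (bc_gens bc ge).
Qed.

(** The number [r n] of generators varies along the tower, while the Fitting index [j] does not: for
    each fixed [j] the ideals form a chain to which [idem_ideal_chain] applies. *)
Lemma idem_fitting_tower (M : nat -> lmodType A) (g : forall n, M n.+1 -> M n) :
  (1 < q)%N -> noetherian A -> (forall n, is_base_change f (g n)) ->
  (forall n, finitely_generated (M n)) -> idem_fitting (M 0).
Proof.
move=> q1 nA bc fg; have fg' n := (fg_gens (M n)).1 (fg n).
have [r rE] := choice fg'.
have [e ge] : exists e : forall n, 'I_(r n) -> M n, forall n, gens (e n).
  exists (fun n => projT1 (cid (rE n))) => n; exact: projT2 (cid (rE n)).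
apply: (idem_fittingI (ge 0%N)) => j.
apply: (idem_ideal_chain fE (I := fun n => fitting (e n) j)) => // n.
  exact: igen_ideal.
by move=> x; apply: fitting_bc.
Qed.

End FrobeniusDescent.

(** * Localization *)

Lemma ord_exists_uniform n (P : 'I_n -> nat -> Prop) :
  (forall i a b, (a <= b)%N -> P i a -> P i b) -> (forall i, exists a, P i a) ->
  exists a, forall i, P i a.
Proof.
move=> Pm /choice[a aP]; exists (\max_i a i) => i.
by apply: Pm (aP i); apply: leq_bigmax.
Qed.

Lemma radical_ideal (A : comPzRingType) (I : A -> Prop) : ideal I ->
  ideal (fun x => exists n, I (x ^+ n)).
Proof.
move=> iI; have [I0 ID IM] := iI; split.
- by exists 1%N; rewrite expr1.
- move=> x y [n xn] [m ym]; exists (n + m)%N; rewrite exprDn.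
  apply: ideal_sum => // i; rewrite -mulr_natl; apply: (IM).
  have [mi|im] := leqP m i.
    by apply: (IM); rewrite -(subnK mi) exprD; apply: IM.
  have ni : (n <= n + m - i)%N by rewrite -addnBA ?leq_addr // ltnW.
  apply: (ideal_mulr _ iI); rewrite -(subnK ni) exprD; exact: IM.
- by move=> a x [n xn]; exists n; rewrite exprMn; apply: IM.
Qed.

(** The radical of [I] contains every [a i], hence [1]. *)
Lemma ideal_unit_powers (A : comPzRingType) (I : A -> Prop) n (a c : 'I_n -> A) :
  ideal I -> \sum_i c i * a i = 1 -> (forall i, exists m, I (a i ^+ m)) -> I 1.
Proof.
move=> iI ca Ia; have iR := radical_ideal iI.
pose R x := exists m, I (x ^+ m); suff [m] : R 1 by rewrite expr1n.
have [_ _ RM] := iR; rewrite -ca; apply: (ideal_sum _ _ iR) => i; exact: RM.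
Qed.

Section Localization.
Variables (k : fieldType) (A B : kAlg k) (a : A) (l : kHom A B).
Hypothesis loc : is_localization a l.
Variables (M : lmodType A) (N : lmodType B) (g : M -> N).
Hypothesis bc : is_base_change l g.
Variables (n : nat) (e : 'I_n -> M).
Hypothesis ge : gens e.

Lemma scale_pow_mono (V : lmodType A) (u : V) i j : (i <= j)%N ->
  a ^+ i *: u = 0 -> a ^+ j *: u = 0.
Proof. by move=> ij ui; rewrite -(subnK ij) exprD -scalerA ui scaler0. Qed.

Lemma loc_row_ker m (c : 'rV[A]_m) : map_mx l c = 0 -> exists i, a ^+ i *: c = 0.
Proof.
move=> c0; have [_ _ ker] := loc.
have [||i iE] := @ord_exists_uniform m (fun j i => a ^+ i *: (c 0 j : A^o) = 0).
- by move=> j i i'; apply: scale_pow_mono.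
- by move=> j; apply: ker; have := congr1 (fun r : 'rV_m => r 0 j) c0; rewrite !mxE.
by exists i; apply/rowP => j; rewrite !mxE; apply: iE.
Qed.

Lemma loc_mx_lift m1 m2 (P : 'M[B]_(m1, m2)) : exists i Q, map_mx l Q = l a ^+ i *: P.
Proof.
have [_ lift _] := loc.
have [||i iE] := @ord_exists_uniform m1
    (fun i1 i => exists q : 'rV_m2, map_mx l q = l a ^+ i *: row i1 P).
- move=> i1 i j ij [q qE]; exists (a ^+ (j - i) *: q).
  by rewrite map_mxZ qE scalerA rmorphXn -exprD subnK.
- move=> i1; have [||i iE] := @ord_exists_uniform m2
    (fun i2 i => exists q, l q = l a ^+ i * P i1 i2).
  + move=> i2 i j ij [q qE]; exists (a ^+ (j - i) * q).
    by rewrite rmorphM qE mulrA rmorphXn -exprD subnK.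
  + by move=> i2; have [q [i qE]] := lift (P i1 i2); exists i, q; rewrite mulrC.
  have [q qE] := choice iE; exists i, (\row_j q j).
  by apply/rowP => j; rewrite !mxE.
have [q qE] := choice iE; exists i, (\matrix_j q j).
by apply/row_matrixP => j; rewrite -map_row rowK qE linearZ.
Qed.

(** As [N] is only known through its universal property, denominators are cleared on relations. By
    [bc_rel] the coordinates of [u] become, in [B], a combination of relations of [M]; a power of
    [a] turns it into the image of a single relation [d], and a further power equates [d] with the
    coordinates in [A]. *)
Lemma loc_torsion u : g u = 0 -> exists i, a ^+ i *: u = 0.
Proof.
have lE := comb_linear e; have [c ->] := ge u.
rewrite (comb_semilinear _ _ (bc_semilinear bc)) => /(bc_rel bc ge) c0.
have [i [d [d0 dE]]] : exists i d, comb e d = 0 /\ map_mx l d = l a ^+ i *: map_mx l c.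
  move: (map_mx l c) c0; apply: mspan_ind.
  - by exists 0%N, 0; rewrite (linear0E lE) map_mx0 scaler0.
  - move=> r r' [i [d [d0 dE]]] [i' [d' [d'0 d'E]]].
    exists (i + i')%N, (a ^+ i' *: d + a ^+ i *: d').
    rewrite lE (linearZE lE) d0 d'0 !scaler0 addr0; split=> //.
    by rewrite map_mxD !map_mxZ dE d'E !scalerA !rmorphXn -!exprD scalerDr addnC.
  - move=> b r [i [d [d0 dE]]]; have [_ lift _] := loc.
    have [q [j qE]] := lift b; exists (i + j)%N, (q *: d).
    rewrite (linearZE lE) d0 scaler0 map_mxZ dE -qE !scalerA exprD; split=> //.
    by congr (_ *: _); ring.
  - by move=> _ [d d0 ->]; exists 0%N, d; rewrite expr0 scale1r.
have [|j jE] := @loc_row_ker _ (a ^+ i *: c - d).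
  by rewrite map_mxB map_mxZ dE rmorphXn subrr.
exists (j + i)%N; rewrite exprD -scalerA -(linearZE lE).
have -> : a ^+ i *: c = (a ^+ i *: c - d) + d by rewrite subrK.
by rewrite -(linearZE lE) scalerDr jE add0r (linearZE lE) d0 scaler0.
Qed.

(* The relations between the [e i] are not known to be finitely generated yet,
   so [c *m Q] is only killed by a power of [a] depending on [c]. *)
Lemma loc_splitting : fg_projective N -> exists i (Q : 'M[A]_n),
  (forall j, comb e (row j Q) = a ^+ i *: e j) /\
  forall c, comb e c = 0 -> map_mx l (c *m Q) = 0.
Proof.
move=> [m [h [phi [lphi phiE]]]]; have sg := bc_semilinear bc.
have [r rE] := choice (fun i => bc_gens bc ge (h i)).
(* Row [i] consists of coordinates of [g (e i)] computed through the dual basis of [N]. Hence [P]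
   kills the images of relations and reproduces the generators. *)
pose P := \matrix_(i, j) \sum_s (phi s (g (e i)) : B) * r s 0 j.
have rowP_ (u : 'rV[A]_n) : map_mx l u *m P = \sum_s (phi s (g (comb e u)) : B) *: r s.
  apply/rowP => j; rewrite mxE summxE.
  under eq_bigr do rewrite !mxE mulr_sumr; rewrite exchange_big; apply: eq_bigr => s _ /=.
  rewrite (comb_semilinear _ _ sg) (linear_sumE (lphi s)) mxE mulr_suml.
  by apply: eq_bigr => t _; rewrite (linearZE (lphi s)) mxE mulrA.
have eP j : comb (fun i => g (e i)) (row j P) = g (e j).
  have -> : row j P = map_mx l (delta_mx 0 j) *m P by rewrite map_delta_mx rowE.
  rewrite rowP_ comb_delta (linear_sumE (comb_linear _)) -[RHS]scale1r phiE.
  by apply: eq_bigr => s _; rewrite (linearZE (comb_linear _)) -rE.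
have [i [Q QE]] := loc_mx_lift P.
have [||i' i'E] := @ord_exists_uniform n
    (fun j s => a ^+ s *: (comb e (row j Q) - a ^+ i *: e j) = 0).
- by move=> j s s'; apply: scale_pow_mono.
- move=> j; apply: loc_torsion; rewrite sg.1 (semilinearN sg) sg.2.
  rewrite (comb_semilinear _ _ sg) map_row QE linearZ /= (linearZE (comb_linear _)) eP.
  by rewrite rmorphXn subrr.
exists (i' + i)%N, (a ^+ i' *: Q); split=> [j|c c0].
  rewrite linearZ /= (linearZE (comb_linear e)); apply/eqP.
  by rewrite exprD -scalerA -subr_eq0 -scalerBr i'E.
rewrite -scalemxAr map_mxZ map_mxM QE -scalemxAr rowP_ c0 big1 ?scaler0 // => s _.
by rewrite (semilinear0 sg) (linear0E (lphi s)) scale0r.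
Qed.

End Localization.

(** * Vanishing and projectivity are local *)

Section LocalGlobal.
Variables (k : fieldType) (A : kAlg k) (m : nat) (a : 'I_m -> A) (B : 'I_m -> kAlg k).
Variables (l : forall i, kHom A (B i)) (M : lmodType A) (N : forall i, lmodType (B i)).
Variable g : forall i, M -> N i.
Hypothesis a1 : exists c : 'I_m -> A, \sum_i c i * a i = 1.
Hypothesis loc : forall i, is_localization (a i) (l i).
Hypothesis bc : forall i, is_base_change (l i) (@g i).
Hypothesis fg : finitely_generated M.

Lemma local_zero u : (forall i, @g i u = 0) -> u = 0.
Proof.
move=> gu; have [n [e ge]] := (fg_gens M).1 fg; have [c c1] := a1.
rewrite -[u]scale1r; apply: (ideal_unit_powers (I := fun x => x *: u = 0) _ c1).
  split=> [|x y xu yu|x y yu]; first exact: scale0r.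
    by rewrite scalerDl xu yu addr0.
  by rewrite -scalerA yu scaler0.
by move=> i; apply: (loc_torsion (loc i) (bc i) ge).
Qed.

(** Finite presentation is derived on the way. For a relation [d], a power of [a i] kills
    [d *m Q i], so a multiple of [d] by a power of [a i] lies in the row span of [S i]. Hence the
    finitely many rows of the [S i] span all relations, one exponent serves for all of them, and
    some power of each [a i] factors through a free module. *)
Lemma local_fg_projective : (forall i, fg_projective (N i)) -> fg_projective M.
Proof.
move=> pN; have [n [e ge]] := (fg_gens M).1 fg; have [c c1] := a1.
have lE := comb_linear e.
have spl i : exists jQ : nat * 'M[A]_n,
    (forall j, comb e (row j jQ.2) = a i ^+ jQ.1 *: e j) /\
    forall c, comb e c = 0 -> map_mx (l i) (c *m jQ.2) = 0.
  by have [j [Q QE]] := loc_splitting (loc i) (bc i) ge (pN i); exists (j, Q).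
have [Z ZE] := choice spl; pose p i := (Z i).1; pose Q i := (Z i).2.
have Qe i j : comb e (row j (Q i)) = a i ^+ p i *: e j by case: (ZE i).
have Qr i d : comb e d = 0 -> exists s, a i ^+ s *: (d *m Q i) = 0.
  by move=> d0; apply: (loc_row_ker (loc i)); apply: (ZE i).2.
pose S i := (a i ^+ p i)%:M - Q i.
pose R (d : 'rV[A]_n) := exists ij : 'I_m * 'I_n, d = row ij.2 (S ij.1).
have S0 i j : comb e (row j (S i)) = 0.
  rewrite linearB /= (linearBE lE) Qe.
  by rewrite -scalemx1 linearZ /= row1 (linearZE lE) comb_delta subrr.
have relR d : comb e d = 0 -> mspan R d.
  move=> d0; have [R0 RD RZ] := mspan_submod R.
  rewrite -[d]scale1r; apply: (ideal_unit_powers (I := fun x => mspan R (x *: d)) _ c1).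
    split=> [|x y xd yd|x y yd]; first by rewrite scale0r.
      by rewrite scalerDl; apply: RD.
    by rewrite -scalerA; apply: RZ.
  move=> i; have [s sE] := Qr i d d0; exists (s + p i)%N.
  have -> : a i ^+ (s + p i) *: d = (a i ^+ s *: d) *m S i.
    rewrite mulmxBr -[_ *m Q i]scalemxAl sE subr0 mul_mx_scalar scalerA mulrC.
    by rewrite exprD.
  rewrite [_ *: d]row_comb mulmx_suml.
  apply: (submod_sum _ _ (mspan_submod R)) => j; rewrite -scalemxAl -rowE; apply: RZ.
  by apply: mem_mspan; exists (i, j).
have unif i : exists s, forall d, comb e d = 0 -> a i ^+ s *: (d *m Q i) = 0.
  have [||s sE] := @ord_exists_uniform m
      (fun i' s => forall j, a i ^+ s *: (row j (S i') *m Q i) = 0).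
  - by move=> i' s s' ss' H j; apply: scale_pow_mono ss' (H j).
  - move=> i'; apply: (@ord_exists_uniform n
      (fun j s => a i ^+ s *: (row j (S i') *m Q i) = 0)) => [j s s'|j].
      exact: scale_pow_mono.
    exact: Qr.
  exists s => d /relR; move: d; apply: mspan_ind => [|u v u0 v0|x u u0|_ [ij ->]].
  - by rewrite mul0mx scaler0.
  - by rewrite mulmxDl scalerDr u0 v0 addr0.
  - by rewrite -scalemxAl scalerA mulrC -scalerA u0 scaler0.
  - exact: sE.
apply: (ideal_unit_powers (free_factor_ideal M) c1) => i.
have [s sE] := unif i; exists (s + p i)%N.
have [co coE] := choice ge.
exists n, e, (fun j u => (a i ^+ s *: (co u *m Q i)) 0 j); split=> [j b u v|u].
  have : comb e (co (b *: u + v) - (b *: co u + co v)) = 0.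
    by rewrite (linearBE lE) lE -!coE subrr.
  move=> /sE; rewrite mulmxBl mulmxDl -scalemxAl scalerBr scalerDr => /eqP.
  rewrite subr_eq0 => /eqP->; rewrite scalerA mulrC -scalerA.
  by rewrite mxE; congr (_ + _); rewrite mxE.
rewrite -[\sum_i _]/(comb e _) (linearZE lE) -(comb_mul (e' := fun j => a i ^+ p i *: e j)) //.
have -> : comb (fun j => a i ^+ p i *: e j) (co u) = a i ^+ p i *: u.
  rewrite {2}(coE u) /comb scaler_sumr; apply: eq_bigr => j _.
  by rewrite !scalerA mulrC.
by rewrite scalerA -exprD.
Qed.

End LocalGlobal.

(** * Quotient and fraction rings *)

Section QuotientRing.
Variables (A : comPzRingType) (S : A -> Prop).

Definition qring : Type := @qmod A A^o S.
HB.instance Definition _ := GRing.Zmodule.on qring.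

Definition qrpi (a : A) : qring := @qpi A A^o S a.

Lemma qrpi_surj x : exists a, x = qrpi a.
Proof. exact: (@qpi_surj A A^o S x). Qed.

Lemma qrpi0 a : qrpi a = 0 <-> igen S a.
Proof. exact: (@qpi0 A A^o S a). Qed.

Lemma qrpi_eq a b : qrpi a = qrpi b <-> igen S (a - b).
Proof. exact: (@qpi_eq A A^o S a b). Qed.

Definition qring_mul (x y : qring) : qring := qrpi (repr x * repr y : A).

Lemma qring_mulE a b : qring_mul (qrpi a) (qrpi b) = qrpi (a * b).
Proof.
have [_ SD SM] := igen_ideal S; apply/qrpi_eq.
have Ha := @qpi_repr A A^o S a; have Hb := @qpi_repr A A^o S b.
set x := repr _ in Ha *; set y := repr _ in Hb *.
have -> : (x : A) * y - a * b = y * (x - a) + a * (y - b) :> A by ring.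
by apply: SD; apply: SM.
Qed.

Lemma qring_mulA : associative qring_mul.
Proof.
move=> x y z; have [a ->] := qrpi_surj x; have [b ->] := qrpi_surj y.
by have [c ->] := qrpi_surj z; rewrite !qring_mulE mulrA.
Qed.
Lemma qring_mulC : commutative qring_mul.
Proof.
move=> x y; have [a ->] := qrpi_surj x; have [b ->] := qrpi_surj y.
by rewrite !qring_mulE mulrC.
Qed.
Lemma qring_mul1 : left_id (qrpi 1) qring_mul.
Proof. by move=> x; have [a ->] := qrpi_surj x; rewrite qring_mulE mul1r. Qed.
Lemma qring_mulDl : left_distributive qring_mul +%R.
Proof.
move=> x y z; have [a ->] := qrpi_surj x; have [b ->] := qrpi_surj y.
have [c ->] := qrpi_surj z.
have D u v : qrpi u + qrpi v = qrpi (u + v) by exact: (@qpiD A A^o S u v).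
by rewrite D !qring_mulE D mulrDl.
Qed.

HB.instance Definition _ := GRing.Zmodule_isComPzRing.Build qring
  qring_mulA qring_mulC qring_mul1 qring_mulDl.

Lemma qrpi_zmod : zmod_morphism qrpi.
Proof. move=> a b; exact: (linearBE (@qpi_linear A A^o S) a b). Qed.

Lemma qrpi_monoid : monoid_morphism qrpi.
Proof. by split=> // a b; rewrite -qring_mulE. Qed.

HB.instance Definition _ := GRing.isZmodMorphism.Build A qring qrpi qrpi_zmod.
HB.instance Definition _ := GRing.isMonoidMorphism.Build A qring qrpi qrpi_monoid.

Lemma qring_lift (B : comPzRingType) (f : {rmorphism A -> B}) :
  (forall a, S a -> f a = 0) ->
  exists g : {rmorphism qring -> B}, forall a, g (qrpi a) = f a.
Proof.
move=> f0; have f0' a : igen S a -> f a = 0.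
  by move: a; apply: igen_ind => // [|x y x0 y0|x y y0];
    rewrite ?rmorph0 ?rmorphD ?rmorphM ?x0 ?y0 ?addr0 ?mulr0.
pose g (x : qring) := f (repr x).
have gE a : g (qrpi a) = f a.
  apply/eqP; rewrite -subr_eq0 -rmorphB; apply/eqP/f0'.
  exact: (@qpi_repr A A^o S a).
have gB : zmod_morphism g.
  move=> x y; have [a ->] := qrpi_surj x; have [b ->] := qrpi_surj y.
  by rewrite -rmorphB !gE rmorphB.
have gM : monoid_morphism g.
  split=> [|x y]; first by rewrite -[1]/(qrpi 1) gE rmorph1.
  have [a ->] := qrpi_surj x; have [b ->] := qrpi_surj y.
  by rewrite -rmorphM !gE rmorphM.
pose g' : {rmorphism qring -> B} := HB.pack g
  (GRing.isZmodMorphism.Build _ _ g gB) (GRing.isMonoidMorphism.Build _ _ g gM).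
by exists g'.
Qed.

End QuotientRing.

(** * Maximal ideals and residue fields *)

Section MaximalIdeals.
Variable A : comPzRingType.

Lemma maximal_ideal (I : A -> Prop) : ideal I -> ~ I 1 ->
  exists J, [/\ ideal J, forall x, I x -> J x, ~ J 1 &
    forall x, ~ J x -> exists y, J (1 - x * y)].
Proof.
move=> iI I1; pose T := {J : A -> Prop | [/\ ideal J, forall x, I x -> J x & ~ J 1]}.
pose R (J K : T) := `[< forall x, sval J x -> sval K x >].
have [|||C totC|J Jmax] := @classical_sets.Zorn T R.
- by move=> J; apply/asboolP.
- by move=> J K L /asboolP JK /asboolP KL; apply/asboolP => x /JK /KL.
- move=> [J pJ] [K pK] /asboolP /= JK /asboolP /= KJ.
  have E : J = K by apply/funext => x; apply/propext; split; auto.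
  by move: pJ pK; rewrite E => *; f_equal; apply: Prop_irrelevance.
(* The empty chain is bounded by [I] itself, since its union is empty and not an ideal. *)
- case: (pselect (exists J, C J)) => [[J0 CJ0]|nC]; last first.
    exists (exist _ I (And3 iI (fun _ h => h) I1)) => s Cs.
    by case: nC; exists s.
  pose U x := exists2 J, C J & sval J x.
  have iU : ideal U.
    split=> [|x y [J CJ Jx] [K CK Ky]|a x [J CJ Jx]].
    + by exists J0 => //; case: (svalP J0) => -[].
    + case: (totC _ _ CJ CK) => /asboolP JK.
        by exists K => //; case: (svalP K) => -[_ D _] _ _; apply: D => //; apply: JK.
      by exists J => //; case: (svalP J) => -[_ D _] _ _; apply: D => //; apply: JK.
    + by exists J => //; case: (svalP J) => -[_ _ M] _ _; apply: M.
  have IU x : I x -> U x by move=> Ix; exists J0 => //; case: (svalP J0) => _ + _; apply.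
  have U1 : ~ U 1 by case=> J _; case: (svalP J).
  exists (exist _ U (And3 iU IU U1)) => s Cs; apply/asboolP => x sx.
  by exists s.
have [iJ IJ J1] := svalP J; exists (sval J); split=> // x Jx.
(* The ideal generated by [J] and [x]; were it proper, maximality would put [x] in [J]. *)
pose K z := exists2 y, sval J (z - x * y) & True.
have iK : ideal K.
  have [J0 JD JM] := iJ; split=> [|u v [y uy _] [z vz _]|c u [y uy _]].
  - by exists 0; rewrite // mulr0 subr0.
  - by exists (y + z); rewrite // mulrDr opprD addrACA; apply: JD.
  - by exists (c * y); rewrite // mulrCA -mulrBr; apply: JM.
have JK z : sval J z -> K z by exists 0; rewrite // mulr0 subr0.
case: (pselect (K 1)) => [[y]|K1]; first by exists y.
have E := Jmax (exist _ K (And3 iK (fun z Iz => JK z (IJ z Iz)) K1)) (introT (asboolP _) JK).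
case: Jx; rewrite -E /=; exists 1; rewrite // mulr1 subrr; by case: iJ.
Qed.

End MaximalIdeals.

Section QuotientAlgebra.
Variables (k : fieldType) (A : kAlg k) (S : A -> Prop).

Definition kquot : kAlg k := KAlg ((@qrpi A S) \o kstr A : {rmorphism k -> qring S}).

Definition kqpi : kHom A kquot :=
  @KHom k A kquot (@qrpi A S : {rmorphism A -> qring S}) (fun _ => erefl).

Lemma kqpi_surj (x : kquot) : exists a, x = kqpi a.
Proof. exact: (@qrpi_surj A S x). Qed.

Lemma kqpi0 a : kqpi a = 0 <-> igen S a.
Proof. exact: (@qrpi0 A S a). Qed.

Lemma kquot_lift (B : kAlg k) (f : kHom A B) : (forall a, S a -> f a = 0) ->
  exists g : kHom kquot B, forall a, g (kqpi a) = f a.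
Proof.
move=> /qring_lift[g gE]; have gP c : g (kstr kquot c) = kstr B c.
  by rewrite -(khomP f) -gE.
by exists (@KHom k kquot B g gP).
Qed.

End QuotientAlgebra.

(** Coverings and nonemptiness are tested on field-valued points only; this supplies such a point,
    on which a given proper ideal vanishes. *)
Lemma residue_field (k : fieldType) (A : kAlg k) (I : A -> Prop) : ideal I -> ~ I 1 ->
  exists (K : kAlg k) (h : kHom A K), is_field K /\ forall x, I x -> h x = 0.
Proof.
move=> iI I1; have [J [iJ IJ J1 Jmax]] := maximal_ideal iI I1.
have JE x : kqpi J x = 0 <-> J x.
  by rewrite kqpi0; split=> [|Jx]; [apply: igen_sub | apply: mem_igen].
exists (kquot J), (kqpi J); split=> [|x /IJ/JE //]; split=> [E|x].
  by apply: J1; apply/JE; rewrite rmorph1.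
have [a ->] := kqpi_surj x => a0.
have [b ab] : exists b, J (1 - a * b) by apply: Jmax => /JE.
exists (kqpi J b); apply/eqP; rewrite eq_sym -subr_eq0 -(rmorph1 (kqpi J)) -rmorphM -rmorphB.
exact/eqP/JE.
Qed.

(** * Inverting one element of a ring *)

Section LocalizationRing.
Local Open Scope quotient_scope.
Variables (A : comPzRingType) (a : A).

(** Equality of the fractions [x.1 / a ^+ x.2]; the extra power of [a] accounts for zero
    divisors. *)
Definition loc_rel (x y : A * nat) : bool :=
  `[< exists i, a ^+ i * (x.1 * a ^+ y.2) = a ^+ i * (y.1 * a ^+ x.2) >].

Lemma loc_rel_refl : reflexive loc_rel.
Proof. by move=> x; apply/asboolP; exists 0%N. Qed.

Lemma loc_rel_sym : symmetric loc_rel.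
Proof. by move=> x y; apply/asboolP/asboolP => -[i iE]; exists i. Qed.

Lemma loc_rel_trans : transitive loc_rel.
Proof.
move=> [y m] [x n] [z q] /asboolP[i /= iE] /asboolP[j /= jE].
apply/asboolP; exists (i + j + m)%N => /=; rewrite !exprD.
transitivity (a ^+ i * (x * a ^+ m) * a ^+ j * a ^+ q); first by ring.
rewrite iE; transitivity (a ^+ j * (y * a ^+ q) * a ^+ i * a ^+ n); first by ring.
by rewrite jE; ring.
Qed.

Canonical loc_equiv := EquivRel loc_rel loc_rel_refl loc_rel_sym loc_rel_trans.

Definition locring : Type := {eq_quot loc_equiv}.
HB.instance Definition _ := Choice.on locring.
HB.instance Definition _ := EqQuotient.on locring.

Definition frac (c : A) (n : nat) : locring := \pi_locring (c, n).

Lemma frac_eq c n d m :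
  frac c n = frac d m <-> exists i, a ^+ i * (c * a ^+ m) = a ^+ i * (d * a ^+ n).
Proof.
split=> [/(eqmodP loc_equiv)/asboolP //|H].
by apply/(eqmodP loc_equiv); apply/asboolP.
Qed.

Lemma frac_repr c n : exists i,
  a ^+ i * ((repr (frac c n)).1 * a ^+ n) = a ^+ i * (c * a ^+ (repr (frac c n)).2).
Proof. by apply/frac_eq; rewrite /frac -surjective_pairing reprK. Qed.

Lemma frac_surj x : exists c n, x = frac c n.
Proof. by exists (repr x).1, (repr x).2; rewrite /frac -surjective_pairing reprK. Qed.

Definition loc_add (x y : locring) : locring :=
  frac ((repr x).1 * a ^+ (repr y).2 + (repr y).1 * a ^+ (repr x).2)
    ((repr x).2 + (repr y).2).
Definition loc_opp (x : locring) : locring := frac (- (repr x).1) (repr x).2.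
Definition loc_mul (x y : locring) : locring :=
  frac ((repr x).1 * (repr y).1) ((repr x).2 + (repr y).2).

Lemma loc_addE c n d m :
  loc_add (frac c n) (frac d m) = frac (c * a ^+ m + d * a ^+ n) (n + m).
Proof.
have [i iE] := frac_repr c n; have [j jE] := frac_repr d m; rewrite /loc_add.
case: (repr (frac c n)) iE => c' n' /= iE; case: (repr (frac d m)) jE => d' m' /= jE.
apply/frac_eq; exists (i + j)%N; rewrite !exprD.
transitivity ((a ^+ i * (c' * a ^+ n)) * a ^+ j * a ^+ m * a ^+ m' +
  (a ^+ j * (d' * a ^+ m)) * a ^+ i * a ^+ n * a ^+ n'); first by ring.
by rewrite iE jE; ring.
Qed.

Lemma loc_oppE c n : loc_opp (frac c n) = frac (- c) n.
Proof.
have [i iE] := frac_repr c n; rewrite /loc_opp.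
case: (repr (frac c n)) iE => c' n' /= iE.
by apply/frac_eq; exists i; rewrite !mulNr !mulrN iE.
Qed.

Lemma loc_mulE c n d m : loc_mul (frac c n) (frac d m) = frac (c * d) (n + m).
Proof.
have [i iE] := frac_repr c n; have [j jE] := frac_repr d m; rewrite /loc_mul.
case: (repr (frac c n)) iE => c' n' /= iE; case: (repr (frac d m)) jE => d' m' /= jE.
apply/frac_eq; exists (i + j)%N; rewrite !exprD.
transitivity ((a ^+ i * (c' * a ^+ n)) * (a ^+ j * (d' * a ^+ m))); first by ring.
by rewrite iE jE; ring.
Qed.

Lemma frac_congr c n d m : c * a ^+ m = d * a ^+ n -> frac c n = frac d m.
Proof. by move=> E; apply/frac_eq; exists 0%N; rewrite E. Qed.

Lemma loc_addA : associative loc_add.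
Proof.
move=> x y z; have [c [n ->]] := frac_surj x; have [d [m ->]] := frac_surj y.
have [e [q ->]] := frac_surj z; rewrite !loc_addE; apply: frac_congr.
by rewrite !exprD; ring.
Qed.
Lemma loc_addC : commutative loc_add.
Proof.
move=> x y; have [c [n ->]] := frac_surj x; have [d [m ->]] := frac_surj y.
by rewrite !loc_addE; apply: frac_congr; rewrite !exprD; ring.
Qed.
Lemma loc_add0 : left_id (frac 0 0) loc_add.
Proof.
move=> x; have [c [n ->]] := frac_surj x; rewrite loc_addE.
by apply: frac_congr; rewrite !exprD expr0; ring.
Qed.
Lemma loc_addN : left_inverse (frac 0 0) loc_opp loc_add.
Proof.
move=> x; have [c [n ->]] := frac_surj x; rewrite loc_oppE loc_addE.
by apply: frac_congr; rewrite expr0; ring.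
Qed.

HB.instance Definition _ :=
  GRing.isZmodule.Build locring loc_addA loc_addC loc_add0 loc_addN.

Lemma loc_mulA : associative loc_mul.
Proof.
move=> x y z; have [c [n ->]] := frac_surj x; have [d [m ->]] := frac_surj y.
by have [e [q ->]] := frac_surj z; rewrite !loc_mulE mulrA addnA.
Qed.
Lemma loc_mulC : commutative loc_mul.
Proof.
move=> x y; have [c [n ->]] := frac_surj x; have [d [m ->]] := frac_surj y.
by rewrite !loc_mulE mulrC addnC.
Qed.
Lemma loc_mul1 : left_id (frac 1 0) loc_mul.
Proof. by move=> x; have [c [n ->]] := frac_surj x; rewrite loc_mulE mul1r. Qed.
Lemma loc_mulDl : left_distributive loc_mul +%R.
Proof.
move=> x y z; have [c [n ->]] := frac_surj x; have [d [m ->]] := frac_surj y.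
have [e [q ->]] := frac_surj z; rewrite -[+%R]/loc_add loc_addE !loc_mulE loc_addE.
by apply: frac_congr; rewrite !exprD; ring.
Qed.

HB.instance Definition _ := GRing.Zmodule_isComPzRing.Build locring
  loc_mulA loc_mulC loc_mul1 loc_mulDl.

Definition loc_map (c : A) : locring := frac c 0.

Lemma loc_map_zmod : zmod_morphism loc_map.
Proof.
move=> c d; rewrite -[X in _ = X]/(loc_add (frac c 0) (loc_opp (frac d 0))).
by rewrite loc_oppE loc_addE expr0 !mulr1.
Qed.

Lemma loc_map_monoid : monoid_morphism loc_map.
Proof. by split=> // c d; rewrite -[RHS]/(loc_mul (frac c 0) (frac d 0)) loc_mulE. Qed.

HB.instance Definition _ := GRing.isZmodMorphism.Build A locring loc_map loc_map_zmod.
HB.instance Definition _ := GRing.isMonoidMorphism.Build A locring loc_map loc_map_monoid.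

End LocalizationRing.

Lemma localization_exists (k : fieldType) (A : kAlg k) (a : A) :
  exists (B : kAlg k) (l : kHom A B), is_localization a l.
Proof.
pose B : kAlg k := KAlg (loc_map a \o kstr A : {rmorphism k -> locring a}).
exists B, (@KHom k A B (loc_map a : {rmorphism A -> locring a}) (fun _ => erefl)).
have mulE (x y : locring a) : x * y = loc_mul x y by [].
split=> [|b|c].
- exists (frac a 1 1); rewrite mulE loc_mulE; apply: frac_congr.
  by rewrite add0n expr1 expr0 !mulr1 mul1r.
- have [c [n ->]] := frac_surj b; exists c, n.
  rewrite -rmorphXn mulE loc_mulE; apply: frac_congr.
  by rewrite addn0 expr0 mulr1.
- move=> /(frac_eq a c 0 0 0)[i]; rewrite expr0 !mulr1 mulr0 => iE; by exists i.
Qed.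

(** * Smooth algebras are noetherian and reduced *)

Section HilbertBasis.
Variable A : comNzRingType.

(** Hilbert's argument with the ideals [L d] of coefficients in degree [d] of members of [J] of
    degree at most [d]. From [D] on these are stationary, so a member of degree [d] has its leading
    term cancelled by a shifted element of degree at most [minn d D]. *)
Lemma poly_noetherian : noetherian A -> noetherian {poly A}.
Proof.
move=> nA J iJ; have [J0 JD JM] := iJ.
pose L d (c : A) := exists p : {poly A}, [/\ J p, (size p <= d.+1)%N & p`_d = c].
have iL d : ideal (L d).
  split=> [|_ _ [p [Jp sp <-]] [q [Jq sq <-]]|a _ [p [Jp sp <-]]].
  - by exists 0; rewrite size_poly0 coef0.
  - exists (p + q); rewrite coefD; split=> //; first exact: JD.
    by rewrite (leq_trans (size_polyD _ _)) // geq_max sp.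
  - exists (a%:P * p); rewrite coefCM; split=> //; first exact: JM.
    by rewrite mul_polyC (leq_trans (size_scale_leq _ _)).
have LS d c : L d c -> L d.+1 c.
  move=> [p [Jp sp <-]]; exists ('X * p); rewrite coefXM; split=> //; first exact: JM.
  by rewrite (leq_trans (size_polyMleq _ _)) // size_polyX.
have [D LD] := noetherian_chain nA iL LS.
have /choice[T TE] : forall d, exists T : seq {poly A}, (forall t, t \in T -> J t) /\
    forall c, L d c -> exists q : {poly A},
      [/\ igen (fun y => y \in T) q, (size q <= d.+1)%N & q`_d = c].
  move=> d.
  have [s sE] := nA _ (iL d).
  have wP x : exists p : {poly A}, x \in s -> [/\ J p, (size p <= d.+1)%N & p`_d = x].
    case: (pselect (x \in s)) => [xs|nxs]; last by exists 0.
    by have [p pP] : L d x by [apply/sE; apply: mem_igen]; exists p.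
  have [w wE] := choice wP; exists (map w s); split=> [_ /mapP[x xs ->]|c /sE].
    by case: (wE x xs).
  have [g0 gD gM] := igen_ideal (fun y => y \in map w s).
  move: c; apply: igen_ind.
  - by exists 0; rewrite size_poly0 coef0.
  - move=> _ _ [p [gp sp <-]] [q [gq sq <-]]; exists (p + q); rewrite coefD; split=> //.
      exact: gD.
    by rewrite (leq_trans (size_polyD _ _)) // geq_max sp.
  - move=> a _ [p [gp sp <-]]; exists (a%:P * p); rewrite coefCM; split=> //.
      exact: gM.
    by rewrite mul_polyC (leq_trans (size_scale_leq _ _)).
  - move=> x xs; exists (w x); have [_ sw cw] := wE x xs; split=> //.
    by apply: mem_igen; apply: map_f.
pose S := flatten [seq T d | d <- iota 0 D.+1].
have TS d t : (d <= D)%N -> t \in T d -> t \in S.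
  by move=> dD tT; apply/flattenP; exists (T d) => //; apply: map_f; rewrite mem_iota.
have SJ q : igen (fun y => y \in S) q -> J q.
  apply: igen_sub => // t /flattenP[_ /mapP[d _ ->]]; exact: (TE d).1.
exists S => p; split; last exact: SJ.
have [g0 gD gM] := igen_ideal (fun y => y \in S).
have [n] := ubnP (size p); elim: n p => // n IH p; rewrite ltnS => sp Jp.
have [->//|p0] := eqVneq p 0.
have [d dE] : exists d, size p = d.+1.
  by exists (size p).-1; rewrite prednK // lt0n size_poly_eq0.
pose e := minn d D; have Lp : L e p`_d.
  have Ld : L d p`_d by exists p; rewrite dE.
  by rewrite /e; case: (leqP d D) => // _; apply: LD Ld.
have [q [gq sq qe]] := (TE e).2 _ Lp.
have gSq : igen (fun y => y \in S) q.
  by apply: igen_mono gq => t; apply: TS; apply: geq_minr.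
have ed : (e <= d)%N := geq_minl _ _.
have -> : p = (p - 'X^(d - e) * q) + 'X^(d - e) * q by rewrite subrK.
apply: gD; last exact: gM.
apply: IH; last by apply: ideal_sub => //; apply: JM; apply: SJ.
apply: leq_trans sp; rewrite dE ltnS; apply/leq_sizeP => j dj.
rewrite coefB coefXnM ltnNge (leq_trans (leq_subr _ _) dj) /=.
move: dj; rewrite leq_eqVlt => /orP[/eqP<-|dj].
  by rewrite subKn // qe subrr.
rewrite (nth_default _ (s := p)) ?dE // (nth_default _ (s := q)) ?subr0 //.
by rewrite (leq_trans sq) // ltn_subRL subnK.
Qed.

End HilbertBasis.

(** A Frobenius splitting: [psi] is linear over [p]-th powers, whence [psi (x ^+ p) = x]. It
    recovers membership of [x] in an ideal from membership of [x ^+ p] in its Frobenius power. *)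
Definition frobenius_split (p : nat) (A : comPzRingType) : Prop :=
  exists psi : A -> A, [/\ forall x y, psi (x + y) = psi x + psi y,
    forall x y, psi (x ^+ p * y) = x * psi y & psi 1 = 1].

(** Keep the monomials whose exponent is divisible by [p], divide the exponent by [p] and apply
    [psi] to the coefficients. Linearity over [p]-th powers follows by induction on [P], Frobenius
    being additive. *)
Lemma poly_frobenius_split (p : nat) (A : comNzRingType) : prime p -> p%:R = 0 :> A ->
  frobenius_split p A -> frobenius_split p {poly A}.
Proof.
move=> pp p0 [psi [psiD psiM psi1]]; have pgt := prime_gt0 pp.
have psi0 : psi 0 = 0 by have := psiM 0 0; rewrite mulr0 mul0r.
pose Psi (P : {poly A}) := \poly_(i < size P) psi P`_(p * i).
have PsiE P i : (Psi P)`_i = psi P`_(p * i).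
  rewrite coef_poly; case: ltnP => // si; rewrite nth_default ?psi0 //.
  by rewrite (leq_trans si) // leq_pmull.
have PsiD P Q : Psi (P + Q) = Psi P + Psi Q.
  by apply/polyP => i; rewrite coefD !PsiE coefD psiD.
have p0P : p%:R = 0 :> {poly A} by rewrite -polyC_natr p0.
exists Psi; split=> //; last first.
  apply/polyP => i; rewrite PsiE !coef1 muln_eq0 (gtn_eqF pgt) /=.
  by case: eqP.
move=> P Q; elim/poly_ind: P Q => [|P c IH] Q.
  rewrite expr0n (gtn_eqF pgt) !mul0r; apply/polyP => i.
  by rewrite PsiE !coef0.
rewrite (frobenius_add pp p0P) mulrDl PsiD exprMn -mulrA IH mulrDl; congr (_ + _).
  rewrite -mulrA; congr (_ * _); apply/polyP => i; rewrite PsiE coefXnM coefXM.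
  case: i => [|i]; first by rewrite muln0 pgt.
  by rewrite mulnS ltnNge leq_addr /= addKn PsiE.
apply/polyP => i; rewrite PsiE -polyC_exp !coefCM psiM.
by rewrite PsiE.
Qed.

Section PolyEval.
Variables (P : comNzRingType) (R : comPzRingType) (f : {rmorphism P -> R}) (r : R).

(** Evaluation at [r] with coefficients sent through [f], into a ring that may be zero. *)
Definition poly_eval (q : {poly P}) : R := \sum_(i < size q) f q`_i * r ^+ i.

Lemma poly_evalE n (q : {poly P}) : (size q <= n)%N ->
  poly_eval q = \sum_(i < n) f q`_i * r ^+ i.
Proof.
move=> qn; rewrite /poly_eval (big_ord_widen _ (fun i => f q`_i * r ^+ i) qn) big_mkcond /=.
by apply: eq_bigr => i _; case: ltnP => // si; rewrite nth_default // rmorph0 mul0r.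
Qed.

Lemma poly_evalD (q q' : {poly P}) : poly_eval (q + q') = poly_eval q + poly_eval q'.
Proof.
pose n := maxn (size q) (size q').
rewrite (poly_evalE (size_polyD q q')) (@poly_evalE n q) ?leq_maxl //.
rewrite (@poly_evalE n q') ?leq_maxr // -big_split; apply: eq_bigr => i _ /=.
by rewrite coefD rmorphD mulrDl.
Qed.

Lemma poly_evalCM c (q : {poly P}) : poly_eval (c%:P * q) = f c * poly_eval q.
Proof.
have sz : (size (c%:P * q)%R <= size q)%N by rewrite mul_polyC size_scale_leq.
rewrite (poly_evalE sz) /poly_eval mulr_sumr; apply: eq_bigr => i _.
by rewrite coefCM rmorphM mulrA.
Qed.

Lemma poly_evalMX (q : {poly P}) : poly_eval (q * 'X) = poly_eval q * r.
Proof.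
have sz : (size (q * 'X)%R <= (size q).+1)%N.
  by rewrite (leq_trans (size_polyMleq _ _)) // size_polyX addn2.
rewrite (poly_evalE sz) big_ord_recl coefMX rmorph0 mul0r add0r mulr_suml.
by apply: eq_bigr => i _; rewrite coefMX /= exprSr mulrA.
Qed.

Lemma poly_evalC c : poly_eval c%:P = f c.
Proof.
have sz : (size c%:P <= 1)%N by rewrite size_polyC leq_b1.
by rewrite (poly_evalE sz) big_ord1 coefC mulr1.
Qed.

Lemma poly_eval_zmod : zmod_morphism poly_eval.
Proof.
move=> q q'; apply/eqP; rewrite eq_sym subr_eq -poly_evalD subrK eqxx //.
Qed.

Lemma poly_eval_monoid : monoid_morphism poly_eval.
Proof.
split=> [|q q']; first by rewrite -[1]/(1%:P) poly_evalC rmorph1.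
elim/poly_ind: q => [|q c IH].
  by rewrite mul0r -[0]/(0%:P) poly_evalC rmorph0 mul0r.
rewrite mulrDl -mulrA ['X * q']mulrC mulrA !poly_evalD !poly_evalMX IH.
by rewrite poly_evalCM poly_evalC mulrDl; congr (_ + _); rewrite mulrAC.
Qed.

HB.instance Definition _ := GRing.isZmodMorphism.Build {poly P} R poly_eval poly_eval_zmod.
HB.instance Definition _ := GRing.isMonoidMorphism.Build {poly P} R poly_eval poly_eval_monoid.

End PolyEval.

(** * Polynomial presentations, infinitesimal lifting and reducedness *)

Section SmoothAlgebras.
Variables (k : fieldType) (p : nat) (chark : p \in [pchar k]).
Hypothesis perf : forall a : k, exists b : k, b ^+ p = a.

Let pp : prime p := pcharf_prime chark.

Lemma perfect_frobenius_split : frobenius_split p k.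
Proof.
exists (frobk_inv chark perf); split=> [x y|x y|].
- exact: rmorphD.
- rewrite rmorphM; congr (_ * _); apply: (fmorph_inj (frobk chark)).
  exact: (pth_rootK chark perf).
- exact: rmorph1.
Qed.

Lemma noetherian_field : noetherian k.
Proof.
move=> I iI; have [I0 _ IM] := iI.
case: (pselect (exists2 x, I x & x != 0)) => [[x Ix x0]|nI].
  exists [:: x] => y; split=> [_|].
    rewrite -[y](divfK x0); have [_ _] := igen_ideal (fun y => y \in [:: x]); apply.
    by apply: mem_igen; rewrite mem_seq1.
  by apply: igen_sub => // z; rewrite mem_seq1 => /eqP->.
exists [::] => y; split=> [Iy|/igen_nil -> //].
have -> : y = 0 by apply/eqP; apply: contra_notT nI => y0; exists y.
by have [] := igen_ideal (fun y : k => y \in [::]).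
Qed.

(** One variable per generator of [R]; building the polynomial ring by adjoining one variable at a
    time lets both properties be proved by induction. *)
Lemma polynomial_presentation (R : kAlg k) : fin_gen_alg R ->
  exists (P : kAlg k) (f : kHom P R),
    [/\ noetherian P, frobenius_split p P & forall r, exists x, f x = r].
Proof.
move=> [s sE].
suff [P [kP [f [p0 nP fP [fk fs]]]]] : exists (P : comNzRingType) (kP : {rmorphism k -> P})
    (f : {rmorphism P -> R}), [/\ p%:R = 0 :> P, noetherian P, frobenius_split p P &
    (forall c, f (kP c) = kstr R c) /\ forall r, r \in s -> exists x, f x = r].
  exists (KAlg kP), (@KHom k (KAlg kP) R f fk); split=> //.
  apply: sE => [c|//|_ _ [x <-] [y <-]|_ _ [x <-] [y <-]].
  - by exists (kP c).
  - by exists (x + y); rewrite rmorphD.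
  - by exists (x * y); rewrite rmorphM.
elim: s {sE} => [|r s [P [kP [f [p0 nP fP [fk fs]]]]]].
  exists k, (idfun : {rmorphism k -> k}), (kstr R); split=> //.
  - exact: pcharf0.
  - exact: noetherian_field.
  - exact: perfect_frobenius_split.
exists {poly P}, (polyC \o kP : {rmorphism k -> {poly P}}), (poly_eval f r); split.
- by rewrite -polyC_natr p0.
- exact: poly_noetherian.
- exact: poly_frobenius_split.
split=> [c|q]; first by rewrite /= poly_evalC.
rewrite inE => /orP[/eqP->|/fs[x <-]]; last by exists x%:P; rewrite /= poly_evalC.
by exists 'X; rewrite /= -['X]mul1r poly_evalMX -[1]/(1%:P) poly_evalC rmorph1 mul1r.
Qed.

Definition formally_smooth_alg (R : kAlg k) : Prop :=
  forall (A B : kAlg k) (q : kHom A B), (forall b : B, exists a, q a = b) ->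
    (forall a a' : A, q a = 0 -> q a' = 0 -> a * a' = 0) ->
    forall y : kHom R B, exists x : kHom R A, kcomp q x = y.

Lemma fin_gen_noetherian (R : kAlg k) : fin_gen_alg R -> noetherian R.
Proof.
move=> /polynomial_presentation[P [f [nP _ fs]]] I iI; have [I0 ID IM] := iI.
have iJ : ideal (fun x => I (f x)).
  split=> [|x y|a x]; rewrite ?rmorph0 ?rmorphD ?rmorphM //; [exact: ID|exact: IM].
have [s sE] := nP _ iJ; exists (map f s) => r; split=> [Ir|].
  have [x xr] := fs r; move: Ir; rewrite -xr => /sE.
  have [g0 gD gM] := igen_ideal (fun y => y \in map f s).
  move: x {xr}; apply: igen_ind => [|x y|a x|x xs]; rewrite ?rmorph0 ?rmorphD ?rmorphM //.
  - exact: gD.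
  - exact: gM.
  - by apply: mem_igen; apply: map_f.
apply: igen_sub => // _ /mapP[x xs ->]; apply/(sE x); exact: mem_igen.
Qed.

Section Lifting.
Variables (R P : kAlg k) (f : kHom P R).
Hypothesis fsurj : forall r, exists x, f x = r.
Hypothesis fsm : formally_smooth_alg R.

(* A section of [P / (S) -> R], for generators [S] of an ideal contained in the
   kernel of [f]. *)
Definition section_mod (S : P -> Prop) : Prop :=
  exists s : kHom R (kquot S), forall r x, s r = kqpi S x -> f x = r.

(** The map from the quotient by the kernel to [R] has zero kernel, so formal smoothness lifts the
    identity of [R] through it. *)
Lemma section_mod_ker : section_mod (fun x => f x = 0).
Proof.
have iK : ideal (fun x => f x = 0).
  by split=> [|x y x0 y0|a x x0]; rewrite ?rmorph0 ?rmorphD ?rmorphM ?x0 ?y0 ?addr0 ?mulr0.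
have [q qE] := @kquot_lift _ _ (fun x => f x = 0) _ f (fun _ h => h).
have qsurj b : exists a, q a = b by have [x <-] := fsurj b; exists (kqpi _ x).
have [|s sE] := fsm qsurj _ (kid R).
  move=> a a'; have [x ->] := kqpi_surj a; rewrite qE => x0 _.
  suff -> : kqpi (fun x => f x = 0) x = 0 by rewrite mul0r.
  by apply/kqpi0; apply: mem_igen.
exists s => r x sr; have := congr1 (fun h : kHom R R => h r) sE.
by rewrite /= sr qE.
Qed.

(** The kernel of [P / (S') -> P / (S)] has square zero, so the section lifts by formal
    smoothness. *)
Lemma section_mod_square (S S' : P -> Prop) : section_mod S ->
  (forall x, S' x -> igen S x) -> (forall x y, S x -> S y -> igen S' (x * y)) ->
  section_mod S'.
Proof.
move=> [s sE] SS' S2; have [g0 gD gM] := igen_ideal S'.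
have [q qE] : exists q : kHom (kquot S') (kquot S), forall x, q (kqpi S' x) = kqpi S x.
  by apply: kquot_lift => x /SS'; apply: (kqpi0 S x).2.
have S2' x y : igen S x -> igen S y -> igen S' (x * y).
  move=> Sx Sy; move: x Sx; apply: igen_ind => [|x x' xy x'y|a x xy|x Sx].
  - by rewrite mul0r.
  - by rewrite mulrDl; apply: gD.
  - by rewrite -mulrA; apply: gM.
  move: y Sy; apply: igen_ind => [|y y' xy xy'|a y xy|y Sy].
  - by rewrite mulr0.
  - by rewrite mulrDr; apply: gD.
  - by rewrite mulrCA; apply: gM.
  - exact: S2.
have qsurj b : exists a, q a = b.
  by have [x ->] := kqpi_surj b; exists (kqpi S' x).
have [|s' s'E] := fsm qsurj _ s.
  move=> a a'; have [x ->] := kqpi_surj a; have [y ->] := kqpi_surj a'.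
  rewrite !qE => /kqpi0 Sx /kqpi0 Sy; rewrite -rmorphM; apply/kqpi0; exact: S2'.
exists s' => r x sr; apply: sE.
by rewrite -s'E /= sr qE.
Qed.

(** The exponent is raised one unit at a time: for [n >= 1] the square of [x ^+ n] is a multiple of
    [x ^+ n.+1], as [section_mod_square] requires. *)
Lemma section_mod_pow (x : P) (T : P -> Prop) n : (0 < n)%N ->
  section_mod (fun y => y = x \/ T y) -> section_mod (fun y => y = x ^+ n \/ T y).
Proof.
case: n => // n _; elim: n => [|n IH] // /IH sn.
apply: (section_mod_square sn) => [y [->|Ty]|y z [->|Ty] [->|Tz]].
- have [_ _ M] := igen_ideal (fun y => y = x ^+ n.+1 \/ T y).
  by rewrite [x ^+ n.+2]exprS; exact: M (mem_igen (or_introl erefl)).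
- exact: (mem_igen (or_intror Ty)).
- have [_ _ M] := igen_ideal (fun y => y = x ^+ n.+2 \/ T y).
  have -> : x ^+ n.+1 * x ^+ n.+1 = x ^+ n * x ^+ n.+2.
    by rewrite -!exprD addSnnS.
  exact: M (mem_igen (or_introl erefl)).
- have [_ _ M] := igen_ideal (fun y => y = x ^+ n.+2 \/ T y).
  exact: M (mem_igen (or_intror Tz)).
- have [_ _ M] := igen_ideal (fun y => y = x ^+ n.+2 \/ T y).
  rewrite mulrC; exact: M (mem_igen (or_intror Ty)).
- have [_ _ M] := igen_ideal (fun y => y = x ^+ n.+2 \/ T y).
  exact: M (mem_igen (or_intror Tz)).
Qed.

(** Generators are treated one after the other; [T] collects those already replaced by their
    powers. *)
Lemma section_mod_seq_pow (s : seq P) (T : P -> Prop) n : (0 < n)%N ->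
  section_mod (fun y => y \in s \/ T y) ->
  section_mod (fun y => (exists2 x, x \in s & y = x ^+ n) \/ T y).
Proof.
move=> n0; elim: s T => [|x s IH] T sT.
  congr section_mod: sT; apply/funext => y; apply/propext; split=> [[//|]|[[x]//|]]; by right.
have : section_mod (fun y => y = x \/ (y \in s \/ T y)).
  congr section_mod: sT; apply/funext => y; apply/propext; rewrite inE; split.
    by case=> [/orP[/eqP|]|]; auto.
  by case=> [->|[->|]]; rewrite ?eqxx ?orbT; auto.
move=> /(section_mod_pow n0) sx.
have /IH : section_mod (fun y => y \in s \/ (y = x ^+ n \/ T y)).
  by congr section_mod: sx; apply/funext => y; apply/propext; split; tauto.
congr section_mod; apply/funext => y; apply/propext; split.
  case=> [[z zs ->]|[->|]]; [left|left|by right].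
    by exists z; rewrite // inE zs orbT.
  by exists x; rewrite // mem_head.
case=> [[z]|]; last by auto.
by rewrite inE => /orP[/eqP->|zs] ->; [right; left|left; exists z].
Qed.

End Lifting.

(* If [a ^+ p = 0], lift [a] to [x] in [P] with [x ^+ p] in the ideal generated
   by the [p]-th powers of generators of the kernel; a Frobenius splitting then
   shows that [x] lies in the kernel. *)
Lemma smooth_reduced (R : kAlg k) : fin_gen_alg R -> formally_smooth_alg R -> reduced R.
Proof.
move=> fgR fsm; have [P [f [nP [psi [psiD psiM psi1]] fs]]] := polynomial_presentation fgR.
have red1 a : a ^+ p = 0 :> R -> a = 0.
  have iK : ideal (fun x => f x = 0).
    by split=> [|x y x0 y0|c x x0]; rewrite ?rmorph0 ?rmorphD ?rmorphM ?x0 ?y0 ?addr0 ?mulr0.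
  have [s sE] := nP _ iK.
  have : section_mod f (fun y => y \in s \/ False).
    apply: (section_mod_square fsm (section_mod_ker fs fsm)) => [x [xs|//]|x y x0 y0].
      by apply: mem_igen; apply/sE; apply: mem_igen.
    have /sE : f (x * y) = 0 by rewrite rmorphM x0 mul0r.
    by apply: igen_mono => z; left.
  move=> /(section_mod_seq_pow fsm (prime_gt0 pp))[t tE] ap.
  have [x xE] := kqpi_surj (t a); have fx := tE _ _ xE.
  have psi0 : psi 0 = 0 by have := psiM 0 0; rewrite mulr0 mul0r.
  have : igen (fun y => (exists2 x, x \in s & y = x ^+ p) \/ False) (x ^+ p).
    by apply/kqpi0; rewrite rmorphXn -xE -rmorphXn ap rmorph0.
  (* The splitting sends the Frobenius power of the kernel into the kernel; the multiplier [b] makes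
     the statement stable under multiplication. *)
  have H z : igen (fun y => (exists2 x, x \in s & y = x ^+ p) \/ False) z ->
      forall b, f (psi (b * z)) = 0.
    move: z; apply: igen_ind => [b|y z y0 z0 b|c y y0 b|_ [[y ys ->]|//] b].
    - by rewrite mulr0 psi0 rmorph0.
    - by rewrite mulrDr psiD rmorphD y0 z0 addr0.
    - by rewrite mulrA.
    - have /sE y0 : igen (fun y => y \in s) y by apply: mem_igen.
      by rewrite mulrC psiM rmorphM y0 mul0r.
  move=> /H/(_ 1); rewrite mulrC psiM psi1 mulr1 => <-; exact: esym.
(* As [n <= p ^ n], a vanishing power yields a vanishing iterated Frobenius, which [red1] strips off
   one step at a time. *)
move=> a n; have : (n <= p ^ n)%N by rewrite ltnW // ltn_expl // prime_gt1.
move=> npn an; have {npn an} : a ^+ (p ^ n) = 0 by rewrite -(subnK npn) exprD an mulr0.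
elim: n => [|n IH]; first by rewrite expn0 expr1.
by rewrite expnSr exprM => /red1.
Qed.

End SmoothAlgebras.

(** * Charts and projectivity *)

Section Charts.
Variable k : fieldType.

Definition good_chart (R : kAlg k) : Prop := noetherian R /\ reduced R.

(** Zariski locally on its ring, every point is pulled back from a point over a noetherian reduced
    ring. Smoothness enters the later argument through this property, which is stable under
    Frobenius twists. *)
Definition locally_charted (Y : kfunctor k) : Prop :=
  forall A (y : Y A), exists (m : nat) (a : 'I_m -> A) (B : 'I_m -> kAlg k)
    (l : forall i, kHom A (B i)),
    [/\ exists c : 'I_m -> A, \sum_i c i * a i = 1,
        forall i, is_localization (a i) (l i) &
        forall i, exists (R : kAlg k) (u : Y R) (h : kHom R (B i)),
          good_chart R /\ pmap h u = pmap (l i) y].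

(** A point is lifted in [X] first. The lift stays in [U], because openness amounts to generating
    the unit ideal, which can be checked modulo an ideal of square zero. *)
Lemma chart_formally_smooth (X : kfunctor k) (U : subfun X) (R : kAlg k) :
  formally_smooth X -> open_subfun U -> represents U R -> formally_smooth_alg R.
Proof.
move=> smX opU [u repU] A B q qsurj q0 y.
have Uy : U B (pmap y u) by apply: (repU B (pmap y u)).2.
have [x xE] := smX A B q qsurj q0 (pmap y u).
have Ux : U A x.
  have [I IE] := opU A x.
  have [n [a [c [Ia cE]]]] : generates_unit q I by apply/IE; rewrite xE.
  rewrite -[x]pmap_id; apply/IE.
  have [d dE] := choice (fun i => qsurj (c i)).
  set v := \sum_i d i * a i; have qv : q (1 - v) = 0.
    rewrite rmorphB rmorph1 rmorph_sum; apply/eqP; rewrite subr_eq0; apply/eqP.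
    by rewrite -cE; apply: eq_bigr => i _; rewrite rmorphM dE.
  (* As [1 - v] has square zero, [2%:R - v] is the inverse of [v]. *)
  exists n, a, (fun i => d i * (2%:R - v)); split=> //.
  transitivity (v * (2%:R - v)).
    by rewrite mulr_suml; apply: eq_bigr => i _ /=; rewrite mulrAC.
  have -> : v * (2%:R - v) = 1 - (1 - v) * (1 - v) by ring.
  by rewrite q0 // subr0.
have [h [hE _]] := (repU A x).1 Ux; exists h.
have [h' [_ h'u]] := (repU B (pmap y u)).1 Uy.
by rewrite -(h'u y) // (h'u (kcomp q h)) // pmap_comp hE xE.
Qed.

Section SmoothCharts.
Variables (p : nat) (chark : p \in [pchar k]).
Hypothesis perf : forall a : k, exists b : k, b ^+ p = a.

(** The ideals cutting out the affine charts around [y] generate the unit ideal: at a residue field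
    where all of them vanish, the image of [y] would lie in no chart. Finitely many of their
    elements thus give localizations of [A], each of which maps into a chart. *)
Lemma smooth_charted (X : kfunctor k) : smooth X -> locally_charted X.
Proof.
move=> [cov smX] A y.
pose chart U R I := [/\ open_subfun U, represents (X := X) U R, fin_gen_alg R &
  forall (B : kAlg k) (f : kHom A B), U B (pmap f y) <-> generates_unit f I].
pose S a := exists U R (I : A -> Prop), chart U R I /\ I a.
have S1 : igen S 1.
  apply: contrapT => nS.
  have [K [h [fK hS]]] := residue_field (igen_ideal S) nS.
  have [U [R [opU repU fgR UK]]] := cov K fK (pmap h y).
  have [I IE] := opU A y.
  have [n [a [c [Ia cE]]]] := (IE K h).1 UK.
  case: fK => + _; apply; rewrite -cE big1 // => i _.
  rewrite hS ?mulr0 //; apply: mem_igen; exists U, R, I; split=> //; split=> // B f.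
have [n [c [a [Sa ac]]]] := igen_sum S1.
pose loc i := localization_exists (a i).
pose B i := projT1 (cid (loc i)); pose l i := projT1 (cid (projT2 (cid (loc i)))).
have lP i : is_localization (a i) (l i) := projT2 (cid (projT2 (cid (loc i)))).
exists n, a, B, l; split=> // [|i]; first by exists c.
have [U [R [I [[opU [u uE] fgR IE] Ia]]]] := Sa i.
have UB : U (B i) (pmap (l i) y).
  apply/IE; have [[b bE] _ _] := lP i.
  by exists 1%N, (fun=> a i), (fun=> b); split=> //; rewrite big_ord1 mulrC.
have [h [hE _]] := (uE _ _).1 UB; exists R, u, h; split=> //; split.
  exact: (fin_gen_noetherian chark perf).
apply: (smooth_reduced chark perf) => //.
by apply: (chart_formally_smooth smX opU); exists u.
Qed.

End SmoothCharts.

(** Twisting changes only the [k]-structure of the test algebras, so the same rings serve as charts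
    once [theta'] has restored that structure. *)
Lemma base_change_charted (Y : kfunctor k) (theta theta' : {rmorphism k -> k}) :
  cancel theta theta' -> cancel theta' theta ->
  locally_charted Y -> locally_charted (base_change theta Y).
Proof.
move=> thK th'K chY A y; have [m [a [B [l [a1 lP hP]]]]] := chY _ y.
have eP (C : kAlg k) c : (idfun : {rmorphism C -> C}) (kstr C c) =
    kstr (restr theta (restr theta' C)) c by rewrite /= thK.
pose e (C : kAlg k) : kHom C (restr theta (restr theta' C)) :=
    @KHom k C (restr theta (restr theta' C)) idfun (eP C).
have lP' i c : l i (kstr A c) = kstr (restr theta' (B i)) c.
  by rewrite /= -(khomP (l i)) /= th'K.
pose l' i : kHom A (restr theta' (B i)) := @KHom k A (restr theta' (B i)) (l i) (lP' i).
exists m, a, (fun i => restr theta' (B i)), l'; split=> // i.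
have [R [u [h [gR hE]]]] := hP i.
exists (restr theta' R), (pmap (e R) u : base_change theta Y (restr theta' R)).
exists (restr_hom theta' h); split=> //=.
transitivity (pmap (e (B i)) (pmap h u)).
  by rewrite -!pmap_comp; congr (pmap _ u); apply: kHom_ext.
rewrite hE -pmap_comp; apply: (congr1 (fun h => @pmap _ Y (restr theta A) _ h y)).
exact: kHom_ext.
Qed.

Lemma charted_projective (Y : kfunctor k) (E : qcoh Y) : locally_charted Y -> coherent E ->
  (forall R (u : Y R), good_chart R -> idem_fitting (E R u)) ->
  forall A (y : Y A), fg_projective (E A y).
Proof.
move=> chY cE idE A y; have [m [a [B [l [a1 lP hP]]]]] := chY A y.
pose g i := tr (q := E) (erefl (pmap (l i) y)).
apply: (local_fg_projective (g := g) a1 lP) => [i||i].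
- exact: tr_bc.
- exact: cE.
have [R [u [h [gR hE]]]] := hP i.
exact: (idem_fitting_projective (bc_idem_fitting (tr_bc E hE) (idE R u gR))).
Qed.

(** Vanishing may be checked on charts, even after an injective extension [R']: base change of a
    projective module along an injection is injective. Frobenius on a reduced chart will play the
    role of that extension. *)
Lemma charted_zero (Y : kfunctor k) (E E' : qcoh Y) (f : shom E E') :
  locally_charted Y -> (forall A (y : Y A), fg_projective (E' A y)) ->
  (forall R (u : Y R), good_chart R -> exists (R' : kAlg k) (h : kHom R R'),
     injective h /\ forall v, f R' (pmap h u) v = 0) ->
  forall A (y : Y A) v, f A y v = 0.
Proof.
move=> chY pE' f0 A y v; have [m [a [B [l [a1 lP hP]]]]] := chY A y.
have fg' : finitely_generated (E' A y).
  have [n [e [phi [_ phiE]]]] := pE' A y.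
  by exists n, e => u; exists (fun i => phi i u); rewrite -phiE scale1r.
apply: (local_zero (g := fun i => tr (q := E') (erefl (pmap (l i) y))) a1 lP) => // i.
  exact: tr_bc.
have [R [u [h [gR hE]]]] := hP i; have [R' [h' [h'I f0']]] := f0 R u gR.
have fR w : f R u w = 0.
  apply: (bc_inj (tr_bc E' (erefl (pmap h' u)))) => //.
  by rewrite -sh_nat f0'.
have fl := @sh_linear _ _ _ _ f (B i) (pmap (l i) y).
rewrite -sh_nat; move: (tr _ v); apply: (bc_uniq (tr_bc E hE) fl) => [c x x'|w].
  by rewrite scaler0 addr0.
by rewrite sh_nat fR tr0.
Qed.

End Charts.

Lemma linear_base_change (A : comPzRingType) (f : {rmorphism A -> A}) (M N : lmodType A)
    (g : M -> N) : f =1 id -> linear g -> bijective g -> is_base_change f g.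
Proof.
move=> fid lg [h hK kK]; have lh : linear h.
  by move=> a u v; rewrite -{1}[u]kK -{1}[v]kK -lg hK.
have [gD gZ] := (linear_semilinear g).1 lg.
split; first by split=> // a u; rewrite gZ fid.
move=> P j [jD jZ]; exists (fun v => j (h v)); split.
  split=> [|u]; last by rewrite hK.
  by move=> a u v; rewrite lh jD jZ fid.
by move=> j' [_ j'E]; apply/funext => v; rewrite -j'E kK.
Qed.

(** Changing the [k]-structure leaves the ring itself unchanged; the resulting comparison of fibres
    is a base change along an identity map, and this makes it a linear bijection. *)
Lemma base_change_bij (A : comPzRingType) (f : {rmorphism A -> A}) (M N : lmodType A)
    (g : M -> N) : f =1 id -> is_base_change f g -> linear g /\ bijective g.
Proof.
move=> fid bc; have [gD gZ] := bc_semilinear bc.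
have lg : linear g by move=> a u v; rewrite gD gZ fid.
have [|h lh hE] := bc_lift bc (h := fun u => u).
  by split=> // a u; rewrite fid.
split=> //; exists h => //; apply: (bc_uniq bc (linear_funcomp lh lg)) => [//|u].
by rewrite hE.
Qed.

Lemma s_iso_bij (k : fieldType) (Y : kfunctor k) (E E' : qcoh Y) (f : shom E E') :
  s_iso f <-> forall A (y : Y A), bijective (f A y).
Proof.
split=> [[g [gf fg]] A y|bf].
  exists (g A y) => u; first exact: (congr1 (fun h : shom E E => h A y u) gf).
  exact: (congr1 (fun h : shom E' E' => h A y u) fg).
pose g A (y : Y A) := projT1 (cid (let: Bijective g gf fg := bf A y in
  ex_intro (fun g => cancel (f A y) g /\ cancel g (f A y)) g (conj gf fg))).
have gP A (y : Y A) : cancel (f A y) (g A y) /\ cancel (g A y) (f A y).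
  by rewrite /g; case: cid.
have gl A (y : Y A) : linear (g A y).
  by move=> a u v; rewrite -{1}[u](gP A y).2 -{1}[v](gP A y).2 -sh_linear (gP A y).1.
have gn A B (h : kHom A B) (x : Y A) (y : Y B) (e : pmap h x = y) (u : E' A x) :
    g B y (tr e u) = tr e (g A x u).
  by rewrite -{1}[u](gP A x).2 -sh_nat (gP B y).1.
exists (SHom gl gn); split; apply: shom_ext => A y u /=; first exact: (gP A y).1.
exact: (gP A y).2.
Qed.

(** * Projectivity of the fibres of t-stratified bundles *)

Section StratProjective.
Variables (k : fieldType) (p : nat) (chark : p \in [pchar k]).
Hypothesis perf : forall a : k, exists b : k, b ^+ p = a.
Variable X : kfunctor k.

Local Notation F := (frobk chark).
Local Notation F' := (frobk_inv chark perf).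

Lemma frobk_invK : cancel F' F.
Proof. exact: (pth_rootK chark perf). Qed.

Lemma frobkK : cancel F F'.
Proof. by move=> c; apply: (fmorph_inj F); exact: frobk_invK. Qed.

Lemma twist_charted n : locally_charted X -> locally_charted (twist chark X n).
Proof. by move=> chX; elim: n => // n; apply: base_change_charted frobkK frobk_invK. Qed.

Lemma untwist_charted n : locally_charted X -> locally_charted (untwist chark perf X n).
Proof. by move=> chX; elim: n => // n; apply: base_change_charted frobk_invK frobkK. Qed.

(* A point of [X^(n+1)] over [R] is a point of [X^(n)] over [restr F R], whose
   image under [F^(n)] is its pullback along Frobenius. *)
Lemma frob_frobenius n (R : kAlg k) (y : twist chark X n.+1 R) :
  pmap (frobenius_hom chark R) y =
  frob chark X n (restr F R) (y : twist chark X n (restr F R)).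
Proof.
rewrite /= -[LHS]/(@pmap _ (twist chark X n) _ _ (restr_hom F (frobenius_hom chark R)) y).
by apply: (congr1 (fun h => @pmap _ (twist chark X n) _ _ h y)); apply: kHom_ext.
Qed.

(** After pullback along the Frobenius of [R], every point of X^(-n) comes from X^(-n-1). The
    parameter [theta] accumulates the changes of [k]-structure on the fixed ring [R] when the step
    is iterated. *)
Lemma untwist_frob n (theta : {rmorphism k -> k}) (R : kAlg k)
    (v : untwist chark perf X n (restr theta R)) :
  exists (w : untwist chark perf X n.+1 (restr (theta \o F) R))
    (h : kHom (restr theta R) (restr (theta \o F) R)),
    (forall r, h r = r ^+ p) /\ frobN chark perf X n _ w = pmap h v.
Proof.
have iP c : (idfun : {rmorphism R -> R}) (kstr (restr theta R) c) =
    kstr (restr F' (restr (theta \o F) R)) c.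
  by rewrite -[RHS]/(kstr R (theta (F (F' c)))) frobk_invK.
pose i : kHom (restr theta R) (restr F' (restr (theta \o F) R)) := 
    @KHom k (restr theta R) (restr F' (restr (theta \o F) R)) idfun iP.
have hP c : frobenius chark R (kstr (restr theta R) c) = kstr (restr (theta \o F) R) c.
  by rewrite /= !rmorphXn.
pose h : kHom (restr theta R) (restr (theta \o F) R) :=
  @KHom k (restr theta R) (restr (theta \o F) R) (frobenius chark R) hP.
exists (pmap i v), h; split=> //=.
rewrite -[X in pmap _ X = _]/(@pmap _ (untwist chark perf X n) _ _
  (restr_hom F' (frobenius_hom chark _)) (pmap i v)).
by rewrite -!pmap_comp; apply: (congr1 (fun h => pmap h v)); apply: kHom_ext.
Qed.

(** [sig0] lives on X^(-t); this makes it available at any point of [X] after pullback along the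
    [p ^ t]-th power map. *)
Lemma untwist_point t (R : kAlg k) (u : X R) :
  exists (theta : {rmorphism k -> k}) (v : untwist chark perf X t (restr theta R))
    (h : kHom R (restr theta R)),
    (forall r, h r = r ^+ (p ^ t)) /\ frob0 chark perf X t _ v = pmap h u.
Proof.
elim: t => [|t [theta [v [h [hE vE]]]]].
  pose h : kHom R (restr idfun R) := @KHom k R (restr idfun R) idfun (fun _ => erefl).
  by exists idfun, (pmap h u), h.
have [w [h' [h'E wE]]] := untwist_frob v.
exists (theta \o F : {rmorphism k -> k}), w, (kcomp h' h); split=> [r|].
  by rewrite /= h'E hE -exprM expnSr.
by rewrite -[LHS]/(frob0 chark perf X t _ (frobN chark perf X t _ w)) wE -kt_nat vE pmap_comp.
Qed.

Lemma frob1E t A (v : untwist chark perf X t A) :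
  frob1 chark perf X t A v = frob chark X 0 A (frob0 chark perf X t A v).
Proof. by elim: t A v => // t IH A v; exact: IH. Qed.

Variables (t : nat) (E : strat chark perf X t).

(** Pulling the fibre of E^(n+2) back along Frobenius gives its fibre at the image under F^(n+1) of
    the untwisted point, which [sigS] identifies with a fibre of E^(n+1). *)
Lemma strat_frobenius n (R : kAlg k) (y : twist chark X n.+2 R) :
  exists g : se E n.+2 R y -> se E n.+1 (restr F R) y,
    is_base_change (frobenius chark R) g.
Proof.
have e := frob_frobenius y.
have [s sK Ks] := (s_iso_bij (sigS E n)).1 (sig_iso E n) (restr F R) y.
have ls : linear s.
  by move=> a u v; rewrite -{1}[u]Ks -{1}[v]Ks -sh_linear sK.
exists (fun u => s (tr (q := se E n.+2) e u)).
apply: (bc_iso (tr_bc (se E n.+2) e) ls).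
by exists (sigS E n (restr F R) y).
Qed.

Lemma strat_idem_fittingS n (R : kAlg k) (u : twist chark X n.+1 R) :
  good_chart R -> idem_fitting (se E n.+1 R u).
Proof.
move=> [nR redR].
(* [th j] is the [j]-fold inverse Frobenius of [k]. With the [k]-structure of [R] restricted along
   it, the point [u] becomes a point of X^(j+n+1), so all stages of the tower live over the ring
   [R]. *)
pose th := fix th j : {rmorphism k -> k} :=
  if j is j'.+1 then (th j' \o F' : {rmorphism k -> k}) else idfun.
pose R_ j := restr (th j) R.
have iP j c : (idfun : {rmorphism R -> R}) (kstr (R_ j) c) = kstr (restr F (R_ j.+1)) c.
  by rewrite -[RHS]/(kstr R (th j (F' (F c)))) frobkK.
pose i j : kHom (R_ j) (restr F (R_ j.+1)) := @KHom k (R_ j) (restr F (R_ j.+1)) idfun (iP j).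
pose i0 : kHom R (R_ 0) := @KHom k R (R_ 0) idfun (fun _ => erefl).
pose u_ := fix u_ j : twist chark X (j + n).+1 (R_ j) :=
  if j is j'.+1 then pmap (i j') (u_ j') else pmap i0 u.
pose M j : lmodType R := se E (j + n).+1 (R_ j) (u_ j).
have step j : exists g : M j.+1 -> M j, is_base_change (frobenius chark R) g.
  have [g bg] := @strat_frobenius (j + n) (R_ j.+1) (u_ j.+1).
  have bi := tr_bc (se E (j + n).+1) (erefl (pmap (i j) (u_ j))).
  have [li [s sK Ks]] := @base_change_bij R idfun _ _ _ (fun _ => erefl) bi.
  have ls : linear s by move=> a x y; rewrite -{1}[x]Ks -{1}[y]Ks -li sK.
  exists (fun x => s (g x)); apply: (bc_iso bg ls).
  by exists (tr (q := se E (j + n).+1) (erefl (pmap (i j) (u_ j)))).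
pose g j := projT1 (cid (step j)).
have gP j : is_base_change (frobenius chark R) (g j) := projT2 (cid (step j)).
have id0 : idem_fitting (M 0).
  apply: (@idem_fitting_tower R (frobenius chark R) p _ M g) => // [|j].
    exact: prime_gt1 (pcharf_prime chark).
  exact: se_coh.
have b0 := tr_bc (se E n.+1) (erefl (pmap i0 u)).
have [l0 [s sK Ks]] := @base_change_bij R idfun _ _ _ (fun _ => erefl) b0.
have ls : linear s by move=> a x y; rewrite -{1}[x]Ks -{1}[y]Ks -l0 sK.
have bs : is_base_change (idfun : {rmorphism R -> R}) s.
  apply: linear_base_change => //.
  by exists (tr (q := se E n.+1) (erefl (pmap i0 u))).
exact: (bc_idem_fitting bs id0).
Qed.

(** [sig0] only speaks of the fibre of E^(0) pulled back along the [p ^ t]-th power map;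
    [idem_fitting_descent] removes that pullback, using that the chart is reduced. *)
Lemma strat_idem_fitting0 (R : kAlg k) (u : X R) :
  good_chart R -> idem_fitting (se E 0 R u).
Proof.
move=> [nR redR]; have [th [v [h [hE vE]]]] := untwist_point t u.
have id1 : idem_fitting (se E 1 (restr th R) (frob1 chark perf X t _ v)).
  exact: strat_idem_fittingS.
have [s sK Ks] := (s_iso_bij (sig0 E)).1 (sig0_iso E) (restr th R) v.
have ls : linear s.
  by move=> a x y; rewrite -{1}[x]Ks -{1}[y]Ks -sh_linear sK.
have bs : is_base_change (idfun : {rmorphism R -> R}) s.
  apply: (@linear_base_change R) => //.
  by exists (sig0 E (restr th R) v).
have id0 := bc_idem_fitting bs id1.
apply: (@idem_fitting_descent R h (p ^ t)%N hE _ _ _ _ redR (tr_bc (se E 0) (esym vE))) => //.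
  by rewrite expn_gt0 prime_gt0 // (pcharf_prime chark).
exact: se_coh.
Qed.

Lemma strat_projective : locally_charted X ->
  forall n A (y : twist chark X n A), fg_projective (se E n A y).
Proof.
move=> chX n; apply: charted_projective; [exact: twist_charted|exact: se_coh|].
move=> R u gR; case: n u => [|n] u; [exact: strat_idem_fitting0|exact: strat_idem_fittingS].
Qed.

End StratProjective.

(** * Fibrewise kernels, cokernels, duals and sums *)

Section Submodule.
Variables (A : comPzRingType) (M : lmodType A) (P : M -> Prop).

Definition smod (sP : submod P) : Type := {u : M | `[< P u >]}.

Variable sP : submod P.

HB.instance Definition _ := Choice.on (smod sP).

Definition sinj (u : smod sP) : M := sval u.

Lemma sinjP u : P (sinj u).
Proof. exact/asboolP/(svalP u). Qed.

Definition smk (u : M) (Pu : P u) : smod sP := exist _ u (introT (asboolP _) Pu).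

Lemma sinj_inj : injective sinj.
Proof. exact: val_inj. Qed.

Definition smod_zero : smod sP := smk (let: And3 P0 _ _ := sP in P0).
Definition smod_add (u v : smod sP) : smod sP :=
  smk (let: And3 _ PD _ := sP in PD _ _ (sinjP u) (sinjP v)).
Definition smod_opp (u : smod sP) : smod sP := smk (submodN sP (sinjP u)).
Definition smod_scale a (u : smod sP) : smod sP :=
  smk (let: And3 _ _ PZ := sP in PZ a _ (sinjP u)).

Lemma smod_addA : associative smod_add.
Proof. by move=> u v w; apply: sinj_inj; rewrite /= addrA. Qed.
Lemma smod_addC : commutative smod_add.
Proof. by move=> u v; apply: sinj_inj; rewrite /= addrC. Qed.
Lemma smod_add0 : left_id smod_zero smod_add.
Proof. by move=> u; apply: sinj_inj; rewrite /= add0r. Qed.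
Lemma smod_addN : left_inverse smod_zero smod_opp smod_add.
Proof. by move=> u; apply: sinj_inj; rewrite /= addNr. Qed.

HB.instance Definition _ :=
  GRing.isZmodule.Build (smod sP) smod_addA smod_addC smod_add0 smod_addN.

Lemma smod_scaleA a b u : smod_scale a (smod_scale b u) = smod_scale (a * b) u.
Proof. by apply: sinj_inj; rewrite /= scalerA. Qed.
Lemma smod_scale1 : left_id 1 smod_scale.
Proof. by move=> u; apply: sinj_inj; rewrite /= scale1r. Qed.
Lemma smod_scaleDr : right_distributive smod_scale +%R.
Proof. by move=> a u v; apply: sinj_inj; rewrite /= scalerDr. Qed.
Lemma smod_scaleDl u : {morph smod_scale^~ u : a b / a + b}.
Proof. by move=> a b; apply: sinj_inj; rewrite /= scalerDl. Qed.

HB.instance Definition _ := GRing.Zmodule_isLmodule.Build A (smod sP)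
  smod_scaleA smod_scale1 smod_scaleDr smod_scaleDl.

Lemma sinj_linear : linear sinj.
Proof. by []. Qed.

Lemma smk_linear (N : lmodType A) (f : N -> M) (Pf : forall v, P (f v)) :
  linear f -> linear (fun v => smk (Pf v)).
Proof. by move=> lf a u v; apply: sinj_inj; rewrite /= lf. Qed.

End Submodule.

(** * Dual modules and dual bases *)

Section Dual.
Variables (A : comPzRingType) (M : lmodType A).

Record dual := Dual { dfun :> M -> A^o; dual_linear : linear dfun }.

Arguments dual_linear d _ _ _ : rename.

Lemma dual_ext (f g : dual) : f =1 g -> f = g.
Proof.
case: f g => [f fl] [g gl] /= /funext fg.
by move: fl gl; rewrite fg => *; f_equal; apply: Prop_irrelevance.
Qed.

HB.instance Definition _ := gen_eqMixin dual.
HB.instance Definition _ := gen_choiceMixin dual.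

Lemma dual_zero_linear : linear (fun _ : M => 0 : A^o).
Proof. by move=> a u v; rewrite scaler0 addr0. Qed.
Lemma dual_add_linear (f g : dual) : linear (fun u => f u + g u).
Proof. by move=> a u v; rewrite !dual_linear scalerDr addrACA. Qed.
Lemma dual_opp_linear (f : dual) : linear (fun u => - f u).
Proof. by move=> a u v; rewrite dual_linear opprD scalerN. Qed.
Lemma dual_scale_linear c (f : dual) : linear (fun u => c *: f u).
Proof. by move=> a u v; rewrite dual_linear scalerDr !scalerA mulrC. Qed.

Definition dual_zero := Dual dual_zero_linear.
Definition dual_add f g := Dual (dual_add_linear f g).
Definition dual_opp f := Dual (dual_opp_linear f).
Definition dual_scale c f := Dual (dual_scale_linear c f).

Lemma dual_addA : associative dual_add.
Proof. by move=> f g h; apply: dual_ext => u; rewrite /= addrA. Qed.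
Lemma dual_addC : commutative dual_add.
Proof. by move=> f g; apply: dual_ext => u; rewrite /= addrC. Qed.
Lemma dual_add0 : left_id dual_zero dual_add.
Proof. by move=> f; apply: dual_ext => u; rewrite /= add0r. Qed.
Lemma dual_addN : left_inverse dual_zero dual_opp dual_add.
Proof. by move=> f; apply: dual_ext => u; rewrite /= addNr. Qed.

HB.instance Definition _ :=
  GRing.isZmodule.Build dual dual_addA dual_addC dual_add0 dual_addN.

Lemma dual_scaleA a b f : dual_scale a (dual_scale b f) = dual_scale (a * b) f.
Proof. by apply: dual_ext => u; rewrite /= scalerA. Qed.
Lemma dual_scale1 : left_id 1 dual_scale.
Proof. by move=> f; apply: dual_ext => u; rewrite /= scale1r. Qed.
Lemma dual_scaleDr : right_distributive dual_scale +%R.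
Proof. by move=> a f g; apply: dual_ext => u; rewrite /= scalerDr. Qed.
Lemma dual_scaleDl f : {morph dual_scale^~ f : a b / a + b}.
Proof. by move=> a b; apply: dual_ext => u; rewrite /= scalerDl. Qed.

HB.instance Definition _ := GRing.Zmodule_isLmodule.Build A dual
  dual_scaleA dual_scale1 dual_scaleDr dual_scaleDl.

Lemma dual_addE (f g : dual) u : (f + g) u = f u + g u. Proof. by []. Qed.
Lemma dual_scaleE a (f : dual) u : (a *: f) u = a *: f u. Proof. by []. Qed.

Lemma dual_sumE n (F : 'I_n -> dual) u : (\sum_i F i) u = \sum_i F i u.
Proof. by elim/big_ind2: _ => // x1 x2 y1 y2 <- <-. Qed.

Lemma fg_projective_dual : fg_projective M <->
  exists n (e : 'I_n -> M) (phi : 'I_n -> dual), forall u, u = \sum_i (phi i u : A) *: e i.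
Proof.
split=> [[n [e [phi [lphi phiE]]]]|[n [e [phi phiE]]]].
  by exists n, e, (fun i => Dual (lphi i)) => u; rewrite -phiE scale1r.
exists n, e, phi; split=> [i|u]; [exact: dual_linear | by rewrite scale1r].
Qed.

Lemma dual_basis n (e : 'I_n -> M) (phi : 'I_n -> dual) :
  (forall u, u = \sum_i (phi i u : A) *: e i) ->
  forall psi : dual, psi = \sum_i (psi (e i) : A) *: phi i.
Proof.
move=> phiE psi; apply: dual_ext => u.
rewrite dual_sumE {1}(phiE u) (linear_sumE (@dual_linear psi)); apply: eq_bigr => i _.
by rewrite (linearZE (@dual_linear psi)) [LHS]mulrC.
Qed.

End Dual.

Arguments dual_linear {A M} d _ _ _.

Lemma dual_comp_linear (A : comPzRingType) (M N : lmodType A) (f : M -> N) (lf : linear f)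
  (psi : dual N) : linear (fun u => psi (f u) : A^o).
Proof. exact: linear_funcomp lf (dual_linear psi). Qed.

Definition dual_map (A : comPzRingType) (M N : lmodType A) (f : M -> N) (lf : linear f)
  (psi : dual N) : dual M := Dual (dual_comp_linear lf psi).

Lemma dual_map_linear (A : comPzRingType) (M N : lmodType A) (f : M -> N) (lf : linear f) :
  linear (dual_map lf).
Proof. by move=> a u v; apply: dual_ext. Qed.

(** * Base change of duals, sums, cokernels and split kernels *)

Section PointwiseBaseChange.
Variables (A B : comPzRingType) (f : {rmorphism A -> B}).

Lemma range_submod (M N : lmodType A) (h : M -> N) : linear h ->
  submod (fun v => exists u, v = h u).
Proof.
move=> lh; split=> [|_ _ [u ->] [v ->]|a _ [u ->]].
- by exists 0; rewrite linear0E.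
- by exists (u + v); rewrite linearDE.
- by exists (a *: u); rewrite linearZE.
Qed.

Lemma qpi_range (M N : lmodType A) (h : M -> N) v : linear h ->
  qpi (fun v => exists u, v = h u) v = 0 <-> exists u, v = h u.
Proof.
move=> lh; rewrite qpi0; split=> [H|[u ->]]; last by apply: mem_mspan; exists u.
by apply: (H (fun v => exists u, v = h u)); first exact: range_submod.
Qed.

Section DualBC.
Variables (M : lmodType A) (N : lmodType B) (g : M -> N).
Hypothesis bc : is_base_change f g.

Lemma dual_pull_exists (phi : dual M) : exists psi : dual N, forall u, psi (g u) = f (phi u).
Proof.
have sphi : semilinear f (fun u => f (phi u) : B^o).
  have [pD pZ] := (linear_semilinear phi).1 (dual_linear phi).
  by split=> *; rewrite ?pD ?pZ ?rmorphD ?rmorphM.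
by have [psi lpsi psiE] := bc_lift bc sphi; exists (Dual lpsi).
Qed.

Definition dual_pull (phi : dual M) : dual N := projT1 (cid (dual_pull_exists phi)).

Lemma dual_pullE (phi : dual M) u : dual_pull phi (g u) = f (phi u).
Proof. exact: (projT2 (cid (dual_pull_exists phi))). Qed.

Lemma dual_pull_uniq (phi : dual M) (psi : dual N) : (forall u, psi (g u) = f (phi u)) ->
  dual_pull phi = psi.
Proof.
move=> E; apply: dual_ext.
apply: (bc_uniq bc (dual_linear _) (dual_linear _)) => u.
by rewrite dual_pullE E.
Qed.

(** A dual basis pulls back to a dual basis, and the values of a linear map on the pulled back
    functionals determine it. *)
Lemma dual_pull_base_change : fg_projective M -> is_base_change f dual_pull.
Proof.
move=> /fg_projective_dual[n [e [phi phiE]]].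
have sd : semilinear f dual_pull.
  split=> [u v|a u]; apply: dual_pull_uniq => w.
    by rewrite dual_addE !dual_pullE rmorphD.
  by rewrite dual_scaleE dual_pullE rmorphM.
split=> // P h [hD hZ].
have h0 : h 0 = 0 by have := hZ 0 0; rewrite rmorph0 !scale0r.
have hsum m (F : 'I_m -> dual M) : h (\sum_i F i) = \sum_i h (F i).
  by elim/big_rec2: _ => // i x y _ <-.
exists (fun psi : dual N => \sum_i (psi (g (e i)) : B) *: h (phi i)); split.
  split=> [a u v|u].
    rewrite scaler_sumr -big_split; apply: eq_bigr => i _ /=.
    by rewrite scalerA -scalerDl.
  rewrite {2}(dual_basis phiE u) hsum; apply: eq_bigr => i _.
  by rewrite hZ dual_pullE.
move=> h' [lh' h'E]; apply/funext => psi.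
have phiE' v : v = \sum_i (dual_pull (phi i) v : B) *: g (e i).
  have lid : linear (fun v : N => v) by [].
  have lr : linear (fun v : N => \sum_i (dual_pull (phi i) v : B) *: g (e i)).
    move=> a x y; rewrite scaler_sumr -big_split; apply: eq_bigr => i _ /=.
    by rewrite dual_linear scalerDl scalerA.
  move: v; apply: (bc_uniq bc lid lr) => u.
  rewrite {1}(phiE u) (semilinear_sum (bc_semilinear bc)); apply: eq_bigr => i _.
  by rewrite (bc_semilinear bc).2 dual_pullE.
rewrite {2}(dual_basis phiE' psi) (linear_sumE lh'); apply: eq_bigr => i _.
by rewrite (linearZE lh') h'E.
Qed.

End DualBC.

Section TwoModules.
Variables (M M' : lmodType A) (N N' : lmodType B) (g : M -> N) (g' : M' -> N').
Hypothesis bc : is_base_change f g.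
Hypothesis bc' : is_base_change f g'.

Lemma prod_base_change : @is_base_change A B f (M * M')%type (N * N')%type
  (fun u => (g u.1, g' u.2)).
Proof.
have [gD gZ] := bc_semilinear bc; have [gD' gZ'] := bc_semilinear bc'.
split.
  split=> [[u u'] [v v']|a [u u']]; first by rewrite /= gD gD'.
  by rewrite /= gZ gZ'.
move=> P h [hD hZ].
have [|h1 lh1 h1E] := bc_lift bc (h := fun u => h (u, 0)).
  by split=> [u v|a u]; rewrite -?hD -?hZ; congr h; apply/pair_equal_spec;
    rewrite /= ?addr0 ?scaler0.
have [|h2 lh2 h2E] := bc_lift bc' (h := fun u => h (0, u)).
  by split=> [u v|a u]; rewrite -?hD -?hZ; congr h; apply/pair_equal_spec;
    rewrite /= ?addr0 ?scaler0.
exists (fun v => h1 v.1 + h2 v.2); split.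
  split=> [a u v|[u u']]; first by rewrite lh1 lh2 scalerDr addrACA.
  by rewrite h1E h2E -hD; congr h; apply/pair_equal_spec; rewrite /= addr0 add0r.
move=> h' [lh' h'E]; apply/funext => -[v v'].
have -> : (v, v') = (v, 0) + (0, v') by apply/pair_equal_spec; rewrite /= addr0 add0r.
rewrite (linearDE lh') /=; congr (_ + _).
  have l : linear (fun v => h' (v, 0)).
    by move=> a x y; rewrite -lh'; congr h'; apply/pair_equal_spec; rewrite /= scaler0 addr0.
  rewrite addr0; apply: (bc_uniq bc lh1 l) => u; rewrite h1E -h'E /=.
  by rewrite (semilinear0 bc'.1).
have l : linear (fun v => h' (0, v)).
  by move=> a x y; rewrite -lh'; congr h'; apply/pair_equal_spec; rewrite /= scaler0 addr0.
rewrite add0r; apply: (bc_uniq bc' lh2 l) => u; rewrite h2E -h'E /=.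
by rewrite (semilinear0 bc.1).
Qed.

Variables (h : M -> M') (hB : N -> N').
Hypotheses (lh : linear h) (lhB : linear hB).
Hypothesis hE : forall u, hB (g u) = g' (h u).

Lemma coker_base_change
    (c : qmod (fun v => exists u, v = h u) -> qmod (fun v => exists u, v = hB u)) :
  (forall v, c (qpi _ v) = qpi _ (g' v)) -> is_base_change f c.
Proof.
move=> cE; have [gD' gZ'] := bc_semilinear bc'.
pose S := fun v => exists u, v = h u; pose SB := fun v => exists u, v = hB u.
have lq := @qpi_linear _ _ S; have lqB := @qpi_linear _ _ SB.
have sc : semilinear f c.
  split=> [x y|a x]; have [u ->] := qpi_surj x.
    have [v ->] := qpi_surj y; rewrite -(linearDE lq) !cE gD'.
    exact: linearDE lqB _ _.
  by rewrite -(linearZE lq) !cE gZ'; exact: linearZE lqB _ _.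
split=> // P j [jD jZ].
have [|j1 lj1 j1E] := bc_lift bc' (h := fun v => j (qpi S v)).
  by split=> [u v|a u]; rewrite ?(linearDE lq) ?(linearZE lq) ?jD ?jZ.
have [|j2 lj2 j2E] := qmod_lift (S := SB) lj1.
  move=> _ [u ->]; have l0 : linear (fun _ : N => 0 : P).
    by move=> a x y; rewrite scaler0 addr0.
  move: u; apply: (bc_uniq bc (linear_funcomp lhB lj1) l0) => u; rewrite hE j1E.
  have -> : qpi S (h u) = 0 by apply/(qpi_range _ lh); exists u.
  by have := jZ 0 0; rewrite rmorph0 !scale0r.
exists j2; split.
  by split=> // x; have [v ->] := qpi_surj x; rewrite cE j2E j1E.
move=> j' [lj' j'E]; apply/funext => x; have [v ->] := qpi_surj x.
rewrite j2E; move: v; apply: (bc_uniq bc' lj1 (linear_funcomp lqB lj')) => v.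
by rewrite j1E -cE j'E.
Qed.

Variable r : M' -> M.
Hypotheses (lr : linear r) (hrh : forall u, h (r (h u)) = h u).

(** The map [u - r (h u)] projects [M] onto the kernel of [h]. The identity [h r h = h] survives
    base change, so the kernel is a retract of [M] compatibly with [g] and inherits the universal
    property. *)
Lemma ker_base_change (c : smod (linear_ker lh) -> smod (linear_ker lhB)) :
  (forall u, sinj (c u) = g (sinj u)) -> is_base_change f c.
Proof.
move=> cE; have [gD gZ] := bc_semilinear bc.
have [rB lrB rBE] : exists2 rB : N' -> N, linear rB & forall v, rB (g' v) = g (r v).
  apply: (bc_lift bc' (h := fun v => g (r v))); have [rD rZ] := (linear_semilinear r).1 lr.
  by split=> *; rewrite ?rD ?rZ ?gD ?gZ.
have hrhB u : hB (rB (hB u)) = hB u.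
  move: u; apply: (bc_uniq bc (linear_funcomp (linear_funcomp lhB lrB) lhB) lhB) => u.
  by rewrite hE rBE hE hrh.
have kP u : h (u - r (h u)) = 0 by rewrite (linearBE lh) hrh subrr.
have kBP u : hB (u - rB (hB u)) = 0 by rewrite (linearBE lhB) hrhB subrr.
pose pi u : smod (linear_ker lh) := smk _ (kP u).
pose piB u : smod (linear_ker lhB) := smk _ (kBP u).
have lpi : linear pi by apply: smk_linear => a u v; rewrite lh lr scalerBr opprD addrACA.
have lpiB : linear piB by apply: smk_linear => a u v; rewrite lhB lrB scalerBr opprD addrACA.
have piK u : pi (sinj u) = u.
  by apply: sinj_inj; rewrite /= (sinjP u) (linear0E lr) subr0.
have piBK u : piB (sinj u) = u.
  by apply: sinj_inj; rewrite /= (sinjP u) (linear0E lrB) subr0.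
have piE u : piB (g u) = c (pi u).
  by apply: sinj_inj; rewrite /= cE /= hE rBE gD (semilinearN (bc_semilinear bc)).
split.
  by split=> [u v|a u]; apply: sinj_inj; rewrite /= !cE /= ?gD ?gZ.
move=> P j [jD jZ].
have [|j1 lj1 j1E] := bc_lift bc (h := fun u => j (pi u)).
  by split=> [u v|a u]; rewrite ?(linearDE lpi) ?(linearZE lpi) ?jD ?jZ.
exists (fun u => j1 (sinj u)); split.
  by split=> [a u v|u]; [rewrite sinj_linear lj1|rewrite cE j1E piK].
move=> j' [lj' j'E]; apply/funext => u; rewrite -{2}[u]piBK.
apply: (bc_uniq bc lj1 (linear_funcomp lpiB lj')) => w.
by rewrite j1E piE j'E.
Qed.

End TwoModules.

End PointwiseBaseChange.

Section Regular.
Variables (A : comPzRingType) (M M' : lmodType A) (h : M -> M').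
Hypothesis lh : linear h.

(** Projectivity of the cokernel gives a linear section [s], so [v - s (qpi S v)] lies in the image
    of [h]; projectivity of [M'] lifts this projection through [h] to a linear [r]. *)
Lemma projective_coker_regular : fg_projective M' ->
  fg_projective (qmod (fun v => exists u, v = h u)) ->
  exists2 r : M' -> M, linear r & forall u, h (r (h u)) = h u.
Proof.
move=> /fg_projective_dual[n [e [phi phiE]]] /fg_projective_dual[m [c [psi psiE]]].
pose S := fun v => exists u, v = h u; have lq := @qpi_linear _ _ S.
have [d dE] := choice (fun i => qpi_surj (c i)).
pose s x := \sum_i (psi i x : A) *: d i.
have sE x : qpi S (s x) = x.
  rewrite (linear_sumE lq) [RHS]psiE; apply: eq_bigr => i _.
  by rewrite (linearZE lq) -dE.
have ls : linear s.
  move=> a x y; rewrite scaler_sumr -big_split; apply: eq_bigr => i _ /=.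
  by rewrite dual_linear scalerDl scalerA.
have rP j : exists u, e j - s (qpi S (e j)) = h u.
  by apply/(qpi_range _ lh); rewrite (linearBE lq) sE subrr.
have [w wE] := choice rP.
pose r v := \sum_j (phi j v : A) *: w j.
exists r => [a x y|u].
  rewrite scaler_sumr -big_split; apply: eq_bigr => i _ /=.
  by rewrite dual_linear scalerDl scalerA.
have hr v : h (r v) = v - s (qpi S v).
  rewrite (linear_sumE lh) {2 3}[v]phiE (linear_sumE lq) (linear_sumE ls) -sumrB.
  apply: eq_bigr => j _; rewrite (linearZE lh) -wE scalerBr.
  by rewrite (linearZE lq) (linearZE ls).
rewrite hr; have -> : qpi S (h u) = 0 by apply/(qpi_range _ lh); exists u.
by rewrite (linear0E ls) subr0.
Qed.

Lemma ker_fg r : linear r -> (forall u, h (r (h u)) = h u) -> finitely_generated M ->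
  finitely_generated (smod (linear_ker lh)).
Proof.
move=> lr hrh [n [e eE]].
have kP u : h (u - r (h u)) = 0 by rewrite (linearBE lh) hrh subrr.
exists n, (fun i => smk (linear_ker lh) (kP (e i))) => u; have [c cE] := eE (sinj u); exists c.
apply: sinj_inj; rewrite (linear_sumE (@sinj_linear _ _ _ (linear_ker lh))) /=.
have -> : sinj u = sinj u - r (h (sinj u)) by rewrite (sinjP u) (linear0E lr) subr0.
rewrite cE (linear_sumE lh) (linear_sumE lr) -sumrB; apply: eq_bigr => i _.
by rewrite (linearZE lh) (linearZE lr) scalerBr.
Qed.

Lemma coker_fg : finitely_generated M' ->
  finitely_generated (qmod (fun v => exists u, v = h u)).
Proof.
move=> [n [e eE]]; exists n, (fun i => qpi _ (e i)) => x.
have [u ->] := qpi_surj x; have [c ->] := eE u; exists c.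
rewrite (linear_sumE (qpi_linear _)); apply: eq_bigr => i _.
by rewrite (linearZE (qpi_linear _)).
Qed.

End Regular.

Lemma dual_fg (A : comPzRingType) (M : lmodType A) :
  fg_projective M -> finitely_generated (dual M).
Proof.
move=> /fg_projective_dual[n [e [phi phiE]]]; exists n, phi => psi.
by exists (fun i => psi (e i)); exact: dual_basis.
Qed.

Lemma prod_fg (A : comPzRingType) (M N : lmodType A) : finitely_generated M ->
  finitely_generated N -> finitely_generated (M * N)%type.
Proof.
move=> [n [e eE]] [m [e' eE']].
exists (n + m)%N, (fun i => match split i with inl i => (e i, 0) | inr i => (0, e' i) end).
move=> [u v]; have [c ->] := eE u; have [d ->] := eE' v.
exists (fun i => match split i with inl i => c i | inr i => d i end).
rewrite big_split_ord; apply/pair_equal_spec.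
have E1 (F : 'I_n -> (M * N)%type) : \sum_i F i = (\sum_i (F i).1, \sum_i (F i).2).
  by elim/big_rec3: _ => // i y1 y2 y3 _ ->.
have E2 (F : 'I_m -> (M * N)%type) : \sum_i F i = (\sum_i (F i).1, \sum_i (F i).2).
  by elim/big_rec3: _ => // i y1 y2 y3 _ ->.
rewrite E1 E2 /=; split.
  rewrite [X in _ + X]big1 ?addr0 => [|i _]; last by rewrite (unsplitK (inr i)) /= scaler0.
  by apply: eq_bigr => i _; rewrite (unsplitK (inl i)).
rewrite [X in X + _]big1 ?add0r => [|i _]; last by rewrite (unsplitK (inl i)) /= scaler0.
by apply: eq_bigr => i _; rewrite (unsplitK (inr i)).
Qed.

(** * Cokernels, kernels, duals and sums of quasi-coherent sheaves *)

Section Sheaves.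
Variables (k : fieldType) (Y : kfunctor k).

Section Cokernel.
Variables (E E' : qcoh Y) (f : shom E E').

Definition scoker_fib A (y : Y A) : lmodType A :=
  qmod (fun v : E' A y => exists u, v = f A y u).

Definition scoker_pi A (y : Y A) (v : E' A y) : scoker_fib y := qpi _ v.

Lemma scoker_pi_linear A (y : Y A) : linear (@scoker_pi A y).
Proof. exact: qpi_linear. Qed.

Lemma scoker_pi0 A (y : Y A) (v : E' A y) :
  scoker_pi v = 0 <-> exists u, v = f A y u.
Proof. exact: qpi_range (@sh_linear _ _ _ _ f A y). Qed.

Lemma scoker_pi_surj A (y : Y A) (c : scoker_fib y) :
  exists v, c = scoker_pi v.
Proof. exact: qpi_surj. Qed.

Lemma scoker_pi_eq A (y : Y A) (v w : E' A y) :
  scoker_pi v = scoker_pi w <-> exists u, v - w = f A y u.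
Proof.
rewrite -scoker_pi0 (linearBE (@scoker_pi_linear A y)); split=> [->|/eqP].
  by rewrite subrr.
by rewrite subr_eq0 => /eqP.
Qed.

(** Total in [g] because it uses chosen representatives; it is the induced map as soon as [g]
    respects differences and the image of [f]. *)
Definition scoker_map A B (x : Y A) (y : Y B) (g : E' A x -> E' B y)
  (c : scoker_fib x) : scoker_fib y := scoker_pi (g (repr c)).

Lemma scoker_mapE A B (x : Y A) (y : Y B) (g : E' A x -> E' B y) :
  (forall u v, g (u - v) = g u - g v) ->
  (forall u, exists w, g (f A x u) = f B y w) ->
  forall v, scoker_map g (scoker_pi v) = scoker_pi (g v).
Proof.
move=> gB gf v; apply/scoker_pi_eq; rewrite -gB.
have /scoker_pi_eq[u ->] : scoker_pi (repr (scoker_pi v)) = scoker_pi v.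
  by rewrite /scoker_pi /qpi reprK.
exact: gf.
Qed.

Lemma scoker_trE A B (h : kHom A B) (x : Y A) (y : Y B) (e : pmap h x = y) v :
  scoker_map (tr (q := E') e) (scoker_pi v) = scoker_pi (tr e v).
Proof.
apply: scoker_mapE => [u w|u]; first by rewrite trD trN.
by exists (tr e u); rewrite sh_nat.
Qed.

Definition scoker : qcoh Y.
Proof.
refine (@QCoh k Y scoker_fib
  (fun A B h x y e => scoker_map (tr (q := E') e)) _ _ _).
- abstract (move=> A B h x y e; apply: (coker_base_change (tr_bc E e) (tr_bc E' e)
    (@sh_linear _ _ _ _ f A x) (@sh_linear _ _ _ _ f B y)) => [u|v];
    [exact: sh_nat|exact: scoker_trE]).
- abstract (move=> A x e c; have [v ->] := scoker_pi_surj c; rewrite scoker_trE;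
    congr scoker_pi; exact: tr_id).
- abstract (move=> A B C h g x y z e e' e'' c; have [v ->] := scoker_pi_surj c;
    rewrite !scoker_trE; congr scoker_pi; exact: tr_comp).
Defined.

Definition scoker_proj : shom E' scoker.
Proof.
refine (@SHom k Y E' scoker (fun A y v => scoker_pi v) _ _).
- abstract (move=> A y; exact: scoker_pi_linear).
- abstract (move=> A B h x y e v; exact: esym (scoker_trE e v)).
Defined.

Lemma scoker_coherent : coherent E' -> coherent scoker.
Proof. move=> cE' A y; exact: coker_fg. Qed.

End Cokernel.

Section Kernel.
Variables (E E' : qcoh Y) (f : shom E E').
Hypothesis reg : forall A (y : Y A),
  exists2 r : E' A y -> E A y, linear r & forall u, f A y (r (f A y u)) = f A y u.

Definition sker_fib A (y : Y A) : lmodType A :=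
  smod (linear_ker (@sh_linear _ _ _ _ f A y)).

Lemma sker_tr_subproof A B (h : kHom A B) (x : Y A) (y : Y B)
  (e : pmap h x = y) (u : sker_fib x) : f B y (tr e (sinj u)) = 0.
Proof. by rewrite sh_nat (sinjP u) tr0. Qed.

Definition sker_tr A B (h : kHom A B) (x : Y A) (y : Y B)
  (e : pmap h x = y) (u : sker_fib x) : sker_fib y := smk _ (sker_tr_subproof e u).

Definition sker : qcoh Y.
Proof.
refine (@QCoh k Y sker_fib sker_tr _ _ _).
- abstract (move=> A B h x y e; have [r lr rE] := reg x;
    apply: (ker_base_change (tr_bc E e) (tr_bc E' e) _ lr rE) => // u; exact: sh_nat).
- abstract (move=> A x e u; apply: sinj_inj; exact: tr_id).
- abstract (move=> A B C h g x y z e e' e'' u; apply: sinj_inj; exact: tr_comp).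
Defined.

Definition sker_inj : shom sker E.
Proof. by refine (@SHom k Y sker E (fun A y (u : sker_fib y) => sinj u) _ _). Defined.

Lemma sker_coherent : coherent E -> coherent sker.
Proof. by move=> cE A y; have [r lr rE] := reg y; apply: ker_fg lr rE (cE A y). Qed.

End Kernel.

Section DualSheaf.
Variable E : qcoh Y.
Hypothesis proj : forall A (y : Y A), fg_projective (E A y).

Definition sdual : qcoh Y.
Proof.
refine (@QCoh k Y (fun A y => dual (E A y) : lmodType A)
  (fun A B h x y e => dual_pull (tr_bc E e)) _ _ _).
- abstract (move=> A B h x y e; exact: dual_pull_base_change).
- abstract (move=> A x e u; apply: dual_pull_uniq => v; by rewrite tr_id).
- abstract (move=> A B C h g x y z e e' e'' u; apply: dual_pull_uniq => v;
    by rewrite (tr_comp e e' e'') !dual_pullE).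
Defined.

Lemma sdual_coherent : coherent sdual.
Proof. by move=> A y; apply: dual_fg. Qed.

End DualSheaf.

Section Sum.
Variables E E' : qcoh Y.

Definition sprod : qcoh Y.
Proof.
refine (@QCoh k Y (fun A y => (E A y * E' A y)%type : lmodType A)
  (fun A B h x y e u => (tr e u.1, tr e u.2)) _ _ _).
- abstract (move=> A B h x y e; apply: prod_base_change; exact: tr_bc).
- abstract (by move=> A x e [u v]; rewrite /= !tr_id).
- abstract (by move=> A B C h g x y z e e' e'' [u v]; rewrite /= !(tr_comp e e' e'')).
Defined.

Lemma sprod_coherent : coherent E -> coherent E' -> coherent sprod.
Proof. by move=> cE cE' A y; apply: prod_fg; [apply: cE|apply: cE']. Qed.

Definition sprod_in1 : shom E sprod.
Proof.
refine (@SHom k Y E sprod (fun A y u => (u, 0)) _ _).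
- abstract (by move=> A y c u v; apply/pair_equal_spec; rewrite /= scaler0 addr0).
- abstract (by move=> A B h x y e u; rewrite /= tr0).
Defined.

Definition sprod_in2 : shom E' sprod.
Proof.
refine (@SHom k Y E' sprod (fun A y u => (0, u)) _ _).
- abstract (by move=> A y c u v; apply/pair_equal_spec; rewrite /= scaler0 addr0).
- abstract (by move=> A B h x y e u; rewrite /= tr0).
Defined.

Definition sprod_out1 : shom sprod E.
Proof. by refine (@SHom k Y sprod E (fun A y u => u.1) _ _). Defined.

Definition sprod_out2 : shom sprod E'.
Proof. by refine (@SHom k Y sprod E' (fun A y u => u.2) _ _). Defined.

End Sum.

Lemma zero_base_change (A B : comPzRingType) (f : {rmorphism A -> B}) :
  @is_base_change A B f 'rV[A]_0 'rV[B]_0 (fun=> 0).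
Proof.
split=> [|P h [hD hZ]]; first by split=> *; rewrite ?addr0 ?scaler0.
exists (fun=> 0); split=> [|h' [lh' _]].
  split=> [a u v|u]; first by rewrite scaler0 addr0.
  by rewrite [u]thinmx0; have := hZ 0 0; rewrite rmorph0 !scale0r => ->.
by apply/funext => u; rewrite [u]thinmx0 (linear0E lh').
Qed.

Definition szero_sheaf : qcoh Y.
Proof.
refine (@QCoh k Y (fun A y => 'rV[A]_0 : lmodType A) (fun A B h x y e u => 0) _ _ _).
- abstract (by move=> *; exact: zero_base_change).
- abstract (by move=> A x e u; rewrite [u]thinmx0).
- abstract (by []).
Defined.

Lemma szero_coherent : coherent szero_sheaf.
Proof.
by move=> A y; exists 0%N, (fun=> 0) => u; exists (fun=> 0); rewrite big_ord0 [u]thinmx0.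
Qed.

End Sheaves.

Lemma inj_surj_bij (T T' : Type) (f : T -> T') :
  injective f -> (forall y, exists x, f x = y) -> bijective f.
Proof.
move=> fI fs; exists (fun y => projT1 (cid (fs y))) => x.
  by apply: fI; exact: (projT2 (cid (fs (f x)))).
exact: (projT2 (cid (fs x))).
Qed.

(** * Gluing maps, and the same constructions for t-stratified bundles *)

Section Links.
Variables (k : fieldType) (p : nat) (chark : p \in [pchar k]).
Variable perf : forall a : k, exists b : k, b ^+ p = a.
Variables (X : kfunctor k) (t : nat).

Local Notation twist := (twist chark X).
Local Notation strat := (strat chark perf X t).
Local Notation coh E n := (@se_coh k p chark perf X t E n).

(* The gluing maps of a t-stratified bundle are indexed by [option nat]: [None]
   stands for [sig0] and [Some n] for [sigS n]. *)
Definition lsrc (l : option nat) : kfunctor k :=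
  if l is Some n then twist n.+1 else untwist chark perf X t.
Definition li (l : option nat) : nat := if l is Some n then n.+1 else 0.
Definition lj (l : option nat) : nat := if l is Some n then n.+2 else 1.
Definition la (l : option nat) : ktrans (lsrc l) (twist (li l)) :=
  match l with Some n => ktid (twist n.+1) | None => frob0 chark perf X t end.
Definition lb (l : option nat) : ktrans (lsrc l) (twist (lj l)) :=
  match l with Some n => frob chark X n.+1 | None => frob1 chark perf X t end.

Definition sg (E : strat) (l : option nat) :
    forall A (z : lsrc l A), se E (li l) A (la l A z) -> se E (lj l) A (lb l A z) :=
  match l with
  | Some n => fun A z => sigS E n A z
  | None => fun A z => sig0 E A z
  end.

Arguments sg E {l A} z _.

Section Glue.
Variables (E : strat) (l : option nat).

Lemma sg_linear A (z : lsrc l A) : linear (sg E z).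
Proof.
case: l z => [n|] z; first exact: (@sh_linear _ _ _ _ (sigS E n) A z).
exact: (@sh_linear _ _ _ _ (sig0 E) A z).
Qed.

Lemma sg_nat A B (h : kHom A B) (z : lsrc l A) (z' : lsrc l B)
    (e : pmap h z = z') (u : se E (li l) A (la l A z)) :
  sg E z' (tr (pull_eq (la l) e) u) = tr (pull_eq (lb l) e) (sg E z u).
Proof.
case: l z z' e u => [n|] z z' e u.
  transitivity (sigS E n B z' (tr (q := se E n.+1) e u));
    last exact: (sh_nat (sigS E n) e u).
  by congr (sigS E n B z' _); exact: tr_irr.
exact: (sh_nat (sig0 E) e u).
Qed.

Lemma sg_bij A (z : lsrc l A) : bijective (sg E z).
Proof.
case: l z => [n|] z.
  exact: (s_iso_bij (sigS E n)).1 (sig_iso E n) A z.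
exact: (s_iso_bij (sig0 E)).1 (sig0_iso E) A z.
Qed.

Lemma sg_inj A (z : lsrc l A) : injective (sg E z).
Proof. exact: bij_inj (sg_bij z). Qed.

Lemma sg_surj A (z : lsrc l A) v : exists u, sg E z u = v.
Proof. by have [s sK Ks] := sg_bij z; exists (s v). Qed.

Definition sgi A (z : lsrc l A) (v : se E (lj l) A (lb l A z)) :
  se E (li l) A (la l A z) := projT1 (cid (sg_surj v)).

Lemma sgiK A (z : lsrc l A) : cancel (@sgi A z) (sg E z).
Proof. by move=> v; exact: (projT2 (cid (sg_surj v))). Qed.

Lemma sgK A (z : lsrc l A) : cancel (sg E z) (@sgi A z).
Proof. by move=> u; apply: sg_inj; rewrite sgiK. Qed.

Lemma sgi_linear A (z : lsrc l A) : linear (@sgi A z).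
Proof. by move=> a u v; apply: sg_inj; rewrite sg_linear !sgiK. Qed.

Lemma sgi_nat A B (h : kHom A B) (z : lsrc l A) (z' : lsrc l B)
    (e : pmap h z = z') (v : se E (lj l) A (lb l A z)) :
  sgi (tr (pull_eq (lb l) e) v) = tr (pull_eq (la l) e) (sgi v).
Proof. by apply: sg_inj; rewrite sgiK sg_nat sgiK. Qed.

End Glue.

Arguments sg_linear E {l A} z _.
Arguments sgi_linear E {l A} z _.

Lemma sg_hom (D E : strat) (f : strat_hom D E) l A (z : lsrc l A) u :
  f (lj l) A (lb l A z) (sg D z u) = sg E z (f (li l) A (la l A z) u).
Proof. by case: l z u => [n|] z u; [exact: sm_sigE|exact: sm_sig0E]. Qed.

Lemma sgi_hom (D E : strat) (f : strat_hom D E) l A (z : lsrc l A) u :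
  f (li l) A (la l A z) (sgi u) = sgi (f (lj l) A (lb l A z) u).
Proof. by apply: sg_inj; rewrite sgiK -sg_hom sgiK. Qed.

Section Build.
Variable G : forall n, qcoh (twist n).
Hypothesis cG : forall n, coherent (G n).
Variable s : forall (l : option nat) A (z : lsrc l A),
  G (li l) A (la l A z) -> G (lj l) A (lb l A z).
Hypothesis sl : forall l A (z : lsrc l A), linear (@s l A z).
Hypothesis sn : forall l A B (h : kHom A B) (z : lsrc l A) (z' : lsrc l B)
    (e : pmap h z = z') (u : G (li l) A (la l A z)),
  s (tr (pull_eq (la l) e) u) = tr (pull_eq (lb l) e) (s u).
Hypothesis sb : forall l A (z : lsrc l A), bijective (@s l A z).

Lemma mk_sig0_nat A B (h : kHom A B) (z : untwist chark perf X t A)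
    (z' : untwist chark perf X t B) (e : pmap h z = z')
    (u : pull (frob0 chark perf X t) (G 0) A z) :
  @s None B z' (tr e u) =
  tr (q := pull (frob1 chark perf X t) (G 1)) e (@s None A z u).
Proof. exact: (@sn None). Qed.

Definition mk_sig0 :
    shom (pull (frob0 chark perf X t) (G 0)) (pull (frob1 chark perf X t) (G 1)) :=
  @SHom k _ (pull (frob0 chark perf X t) (G 0)) (pull (frob1 chark perf X t) (G 1))
    (@s None) (@sl None) mk_sig0_nat.

Lemma mk_sigS_nat n A B (h : kHom A B) (z : twist n.+1 A)
    (z' : twist n.+1 B) (e : pmap h z = z') (u : G n.+1 A z) :
  @s (Some n) B z' (tr e u) =
  tr (q := pull (frob chark X n.+1) (G n.+2)) e (@s (Some n) A z u).
Proof.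
by rewrite -[RHS](@sn (Some n)); congr s; exact: tr_irr.
Qed.

Definition mk_sigS n : shom (G n.+1) (pull (frob chark X n.+1) (G n.+2)) :=
  @SHom k _ (G n.+1) (pull (frob chark X n.+1) (G n.+2))
    (@s (Some n)) (@sl (Some n)) (@mk_sigS_nat n).

Definition mk_strat : strat :=
  @Strat k p chark perf X t G cG mk_sig0 ((s_iso_bij mk_sig0).2 (@sb None))
    mk_sigS (fun n => (s_iso_bij (mk_sigS n)).2 (@sb (Some n))).

Lemma mk_stratE l A (z : lsrc l A) : sg mk_strat z = @s l A z.
Proof. by case: l z. Qed.

End Build.

Section BuildHom.
Variables (D E : strat) (f : forall n, shom (se D n) (se E n)).
Hypothesis fs : forall l A (z : lsrc l A) u,
  f (lj l) A (lb l A z) (sg D z u) = sg E z (f (li l) A (la l A z) u).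

Definition mk_hom : strat_hom D E.
Proof.
refine (@StratHom k p chark perf X t D E f _ _).
- abstract (by apply: shom_ext => A z u; exact: (@fs None)).
- abstract (by move=> n; apply: shom_ext => A z u; exact: (@fs (Some n))).
Defined.

End BuildHom.

Lemma hom_ext (D E : strat) (f g : strat_hom D E) :
  (forall n A (y : twist n A) u, f n A y u = g n A y u) -> f = g.
Proof. by move=> fg; apply: strat_hom_ext => n; apply: shom_ext => A y u. Qed.

Section Cokernel.
Variables (D E : strat) (f : strat_hom D E).

Definition coker_sg l A (z : lsrc l A)
  (c : scoker (f (li l)) A (la l A z)) : scoker (f (lj l)) A (lb l A z) :=
  scoker_pi (f (lj l)) (sg E z (repr (c : scoker_fib (f (li l)) (la l A z)))).

Lemma coker_sgE l A (z : lsrc l A) v :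
  coker_sg (scoker_pi (f (li l)) v) = scoker_pi (f (lj l)) (sg E z v).
Proof.
have /scoker_pi_eq[u uE] : scoker_pi (f (li l)) (repr (scoker_pi (f (li l)) v)) =
    scoker_pi (f (li l)) v by rewrite /scoker_pi /qpi reprK.
apply/scoker_pi_eq; rewrite -(linearBE (sg_linear E z)) uE.
by exists (sg D z u); rewrite sg_hom.
Qed.

Lemma coker_sg_linear l A (z : lsrc l A) : linear (@coker_sg l A z).
Proof.
move=> a c d; have [u ->] := scoker_pi_surj c; have [v ->] := scoker_pi_surj d.
by rewrite -scoker_pi_linear !coker_sgE sg_linear scoker_pi_linear.
Qed.

Lemma coker_sg_nat l A B (h : kHom A B) (z : lsrc l A) (z' : lsrc l B)
    (e : pmap h z = z') (u : scoker (f (li l)) A (la l A z)) :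
  coker_sg (tr (pull_eq (la l) e) u) = tr (pull_eq (lb l) e) (coker_sg u).
Proof.
have [v ->] := scoker_pi_surj u; rewrite coker_sgE /= !scoker_trE coker_sgE.
by rewrite sg_nat.
Qed.

Lemma coker_sg_bij l A (z : lsrc l A) : bijective (@coker_sg l A z).
Proof.
apply: inj_surj_bij => [c d|c]; last first.
  have [v ->] := scoker_pi_surj c; have [u <-] := sg_surj v.
  by exists (scoker_pi _ u); rewrite coker_sgE.
have [u ->] := scoker_pi_surj c; have [v ->] := scoker_pi_surj d.
rewrite !coker_sgE => /scoker_pi_eq[w]; have [w' <-] := sg_surj w.
rewrite sg_hom -(linearBE (sg_linear E z)) => /sg_inj uv.
by apply/scoker_pi_eq; exists w'.
Qed.

Definition strat_coker : strat :=
  mk_strat (fun n => @scoker_coherent k (twist n) _ _ (f n) (coh E n))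
    coker_sg_linear coker_sg_nat coker_sg_bij.

Definition strat_coker_proj : strat_hom E strat_coker.
Proof.
refine (@mk_hom E strat_coker (fun n => scoker_proj (f n)) _).
abstract (by move=> l A z u; rewrite mk_stratE /= coker_sgE).
Defined.

End Cokernel.

Section Charted.
Hypothesis chX : locally_charted X.

(** [strat_coker f] is itself a t-stratified bundle, so [strat_projective] applies to its fibres as
    well as to those of [E]. *)
Lemma strat_hom_regular (D E : strat) (f : strat_hom D E) n A (y : twist n A) :
  exists2 r : se E n A y -> se D n A y, linear r &
    forall u, f n A y (r (f n A y u)) = f n A y u.
Proof.
apply: projective_coker_regular; first exact: sh_linear.
  exact: strat_projective.
exact: (strat_projective (strat_coker f)).
Qed.

Section Kernel.
Variables (D E : strat) (f : strat_hom D E).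

Let K n : qcoh (twist n) := sker (@strat_hom_regular D E f n).

Lemma ker_sg_subproof l A (z : lsrc l A) (u : K (li l) A (la l A z)) :
  f (lj l) A (lb l A z) (sg D z (sinj u)) = 0.
Proof. by rewrite sg_hom (sinjP u) (linear0E (sg_linear E z)). Qed.

Definition ker_sg l A (z : lsrc l A) (u : K (li l) A (la l A z)) :
  K (lj l) A (lb l A z) := smk _ (ker_sg_subproof u).

Lemma ker_sg_linear l A (z : lsrc l A) : linear (@ker_sg l A z).
Proof. by move=> a u v; apply: sinj_inj; rewrite /= sg_linear. Qed.

Lemma ker_sg_nat l A B (h : kHom A B) (z : lsrc l A) (z' : lsrc l B)
    (e : pmap h z = z') (u : K (li l) A (la l A z)) :
  ker_sg (tr (pull_eq (la l) e) u) = tr (pull_eq (lb l) e) (ker_sg u).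
Proof. by apply: sinj_inj; rewrite /= sg_nat. Qed.

Lemma ker_sg_bij l A (z : lsrc l A) : bijective (@ker_sg l A z).
Proof.
apply: inj_surj_bij => [u v /(congr1 (@sinj _ _ _ _))/sg_inj/sinj_inj //|v].
have v0 : f (li l) A (la l A z) (sgi (sinj v)) = 0.
  by rewrite sgi_hom (sinjP v) (linear0E (sgi_linear E z)).
by exists (smk _ v0 : K (li l) A (la l A z)); apply: sinj_inj; rewrite /= sgiK.
Qed.

Definition strat_ker : strat :=
  mk_strat (fun n =>
      @sker_coherent k (twist n) _ _ (f n) (@strat_hom_regular D E f n) (coh D n))
    ker_sg_linear ker_sg_nat ker_sg_bij.

Definition strat_ker_inj : strat_hom strat_ker D.
Proof.
refine (@mk_hom strat_ker D (fun n => sker_inj (@strat_hom_regular D E f n)) _).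
abstract (by move=> l A z u; rewrite mk_stratE).
Defined.

End Kernel.

Section Dual.
Variable E : strat.

Let proj n : forall A (y : twist n A), fg_projective (se E n A y).
Proof. exact: strat_projective. Qed.

Let G n : qcoh (twist n) := sdual (@proj n).

(** Duality reverses arrows, so the gluing map of the dual is the transpose of the inverse gluing
    map. *)
Definition dual_sg l A (z : lsrc l A) :
  G (li l) A (la l A z) -> G (lj l) A (lb l A z) :=
  dual_map (sgi_linear E z).

Lemma dual_sg_linear l A (z : lsrc l A) : linear (@dual_sg l A z).
Proof. exact: dual_map_linear. Qed.

Lemma dual_sg_nat l A B (h : kHom A B) (z : lsrc l A) (z' : lsrc l B)
    (e : pmap h z = z') (u : G (li l) A (la l A z)) :
  dual_sg (tr (pull_eq (la l) e) u) = tr (pull_eq (lb l) e) (dual_sg u).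
Proof.
apply/esym/dual_pull_uniq => v.
by rewrite /= sgi_nat dual_pullE.
Qed.

Lemma dual_sg_bij l A (z : lsrc l A) : bijective (@dual_sg l A z).
Proof.
exists (dual_map (sg_linear E z)) => psi; apply: dual_ext => u /=.
  by rewrite sgK.
by rewrite sgiK.
Qed.

Definition strat_dual : strat :=
  mk_strat (fun n => @sdual_coherent k (twist n) _ (@proj n))
    dual_sg_linear dual_sg_nat dual_sg_bij.

End Dual.

End Charted.

Section Sum.
Variables D E : strat.

Let G n : qcoh (twist n) := sprod (se D n) (se E n).

Definition prod_sg l A (z : lsrc l A) (u : G (li l) A (la l A z)) :
  G (lj l) A (lb l A z) := (sg D z u.1, sg E z u.2).

Lemma prod_sg_linear l A (z : lsrc l A) : linear (@prod_sg l A z).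
Proof. by move=> a [u u'] [v v']; rewrite /prod_sg /= !sg_linear. Qed.

Lemma prod_sg_nat l A B (h : kHom A B) (z : lsrc l A) (z' : lsrc l B)
    (e : pmap h z = z') (u : G (li l) A (la l A z)) :
  prod_sg (tr (pull_eq (la l) e) u) = tr (pull_eq (lb l) e) (prod_sg u).
Proof. by rewrite /prod_sg /= !sg_nat. Qed.

Lemma prod_sg_bij l A (z : lsrc l A) : bijective (@prod_sg l A z).
Proof.
by exists (fun v => (sgi v.1, sgi v.2)) => -[u v]; rewrite /prod_sg /= ?sgK ?sgiK.
Qed.

Definition strat_sum : strat :=
  mk_strat (fun n => @sprod_coherent k (twist n) _ _ (coh D n) (coh E n))
    prod_sg_linear prod_sg_nat prod_sg_bij.

End Sum.

Definition strat_null : strat.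
Proof.
refine (@mk_strat (fun n => szero_sheaf (twist n)) (fun n => @szero_coherent k (twist n))
  (fun l A z u => 0) _ _ _).
- abstract (by move=> l A z a u v; rewrite scaler0 addr0).
- abstract (by []).
- abstract (by move=> l A z; exists (fun=> 0) => u; rewrite [u]thinmx0).
Defined.

End Links.

Arguments sg {k p chark perf X t} E {l A} z _.
Arguments sg_linear {k p chark perf X t} E {l A} z _.

(** * The tensor category of t-stratified bundles *)

Section StratAbelian.
Variables (k : fieldType) (p : nat) (chark : p \in [pchar k]).
Variable perf : forall a : k, exists b : k, b ^+ p = a.
Variables (X : kfunctor k) (t : nat).

Local Notation twist := (twist chark X).
Local Notation strat := (strat chark perf X t).
Local Notation C := (StratCat chark perf X t).

Lemma chom_ext (a b : C) (f g : hom a b) :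
  (forall n A (y : twist n A) u,
     sm f n A y u = sm g n A y u) -> f = g.
Proof. exact: hom_ext. Qed.

Lemma strat_klinear : is_klinear_category C.
Proof.
split.
- by split=> *; apply: chom_ext.
- move=> a b; split; [split=> [f g h|f g|f|f]|split=> [x y f|f|x f g|x y f]];
    apply: chom_ext => n A z u /=.
  + by rewrite addrA.
  + by rewrite addrC.
  + by rewrite add0r.
  + by rewrite addNr.
  + by rewrite scalerA rmorphM.
  + by rewrite rmorph1 scale1r.
  + by rewrite scalerDr.
  + by rewrite rmorphD scalerDl.
- move=> a b c; split=> *; apply: chom_ext => n A y u //=; [exact: shD|exact: shZ].
Qed.

(** Exactness of a functor that keeps all fibres, or that selects one of them, is reduced to this
    condition and its dual. *)
Definition pointwise_kernel (a b c : strat) (f : strat_hom a b) (i : strat_hom c a) : Prop :=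
  forall n A (y : twist n A), injective (i n A y) /\
    forall u, f n A y u = 0 <-> exists w, u = i n A y w.

Definition pointwise_cokernel (a b c : strat) (f : strat_hom a b) (q : strat_hom b c) : Prop :=
  forall n A (y : twist n A), (forall w, exists v, q n A y v = w) /\
    forall v, q n A y v = 0 <-> exists u, v = f n A y u.

Lemma hom_linear (a b : strat) (f : strat_hom a b) n A (y : twist n A) : linear (f n A y).
Proof. exact: (@sh_linear _ _ _ _ (f n) A y). Qed.

Arguments hom_linear {a b} f {n A} y _.

(** Fibrewise the factorization through [i] is unique, so its linearity, naturality and
    compatibility with gluing all follow from injectivity of [i]. *)
Lemma pointwise_is_kernel (a b c : C) (f : hom a b) (i : hom c a) :
  pointwise_kernel f i -> is_kernel f i.
Proof.
move=> ker; split.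
  by apply: hom_ext => n A y w; apply/((ker n A y).2); exists w.
move=> d g fg; have fg0 n A (y : twist n A) u : f n A y (g n A y u) = 0.
  exact: (congr1 (fun h : strat_hom d b => h n A y u) fg).
have ex n A (y : twist n A) u := ((ker n A y).2 _).1 (fg0 n A y u).
pose h n A (y : twist n A) u := projT1 (cid (ex n A y u)).
have hE n A (y : twist n A) u : g n A y u = i n A y (h n A y u).
  exact: (projT2 (cid (ex n A y u))).
have iI n A (y : twist n A) : injective (i n A y) := (ker n A y).1.
have hl n A (y : twist n A) : linear (h n A y).
  by move=> x u v; apply: iI; rewrite hom_linear -!hE hom_linear.
have hn n A B (m : kHom A B) (x : twist n A) (y : twist n B) (e : pmap m x = y) u :
    h n B y (tr e u) = tr e (h n A x u).
  by apply: iI; rewrite -hE !sh_nat -hE.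
have hs l A (z : lsrc chark perf X t l A) u :
    h _ _ (lb chark perf X t l A z) (sg d z u) = sg c z (h _ _ (la chark perf X t l A z) u).
  by apply: iI; rewrite -hE !sg_hom -hE.
exists (mk_hom (f := fun n => SHom (hl n) (hn n)) hs); split.
  by apply: hom_ext => n A y u; rewrite /= -hE.
move=> h' h'E; apply: hom_ext => n A y u; apply: iI; rewrite /= -hE.
by rewrite -(congr1 (fun h : strat_hom d a => h n A y u) h'E).
Qed.

(** The factorization is computed on preimages under [q]; it does not depend on them, and
    surjectivity of [q] transfers all compatibilities from [g]. *)
Lemma pointwise_is_cokernel (a b c : C) (f : hom a b) (q : hom b c) :
  pointwise_cokernel f q -> is_cokernel f q.
Proof.
move=> cok; split.
  by apply: hom_ext => n A y w; apply/((cok n A y).2); exists w.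
move=> d g gf; have gf0 n A (y : twist n A) u : g n A y (f n A y u) = 0.
  exact: (congr1 (fun h : strat_hom a d => h n A y u) gf).
pose s n A (y : twist n A) w := projT1 (cid ((cok n A y).1 w)).
have sE n A (y : twist n A) w : q n A y (s n A y w) = w.
  exact: (projT2 (cid ((cok n A y).1 w))).
pose h n A (y : twist n A) w := g n A y (s n A y w).
have hE n A (y : twist n A) v : h n A y (q n A y v) = g n A y v.
  have [u uE] : exists u, s n A y (q n A y v) - v = f n A y u.
    by apply/((cok n A y).2); rewrite (linearBE (hom_linear q y)) sE subrr.
  by apply/eqP; rewrite -subr_eq0 -(linearBE (hom_linear g y)) uE gf0.
have hl n A (y : twist n A) : linear (h n A y).
  move=> x u v; rewrite -{1}[u]sE -{1}[v]sE -hom_linear hE hom_linear //.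
have hn n A B (m : kHom A B) (x : twist n A) (y : twist n B) (e : pmap m x = y) u :
    h n B y (tr e u) = tr e (h n A x u).
  by rewrite -{1}[u]sE -sh_nat hE sh_nat.
have hs l A (z : lsrc chark perf X t l A) u :
    h _ _ (lb chark perf X t l A z) (sg c z u) = sg d z (h _ _ (la chark perf X t l A z) u).
  by rewrite -{1}[u]sE -sg_hom hE sg_hom.
exists (mk_hom (f := fun n => SHom (hl n) (hn n)) hs); split.
  by apply: hom_ext => n A y u; rewrite /= hE.
move=> h' h'E; apply: hom_ext => n A y u; rewrite -[u]sE /= hE.
by rewrite -(congr1 (fun h : strat_hom b d => h n A y (s n A y u)) h'E).
Qed.

Lemma strat_coker_pointwise (a b : strat) (f : strat_hom a b) :
  pointwise_cokernel f (strat_coker_proj f).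
Proof.
move=> n A y; split=> [w|v]; last exact: scoker_pi0.
by have [v ->] := scoker_pi_surj w; exists v.
Qed.

(** The two universal properties compare [c] with [strat_coker f], for which the fibrewise statement
    holds by construction. *)
Lemma is_cokernel_pointwise (a b c : C) (f : hom a b) (q : hom b c) :
  is_cokernel f q -> pointwise_cokernel f q.
Proof.
move=> [qf qU]; set r := strat_coker_proj f.
have [rf rU] := pointwise_is_cokernel (strat_coker_pointwise f).
have [g [gq _]] := qU _ _ rf; have [h [hr _]] := rU _ _ qf.
have gqE n A (y : twist n A) v : g n A y (q n A y v) = r n A y v.
  exact: (congr1 (fun h : strat_hom b (strat_coker f) => h n A y v) gq).
have hrE n A (y : twist n A) v : h n A y (r n A y v) = q n A y v.
  exact: (congr1 (fun h : strat_hom b c => h n A y v) hr).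
have hg : cmp h g = idm c.
  have [m [_ mU]] := qU _ _ qf.
  have <- : m = idm c by apply: mU; apply: chom_ext.
  by apply/esym/mU; apply: chom_ext => n A y v; rewrite /= gqE hrE.
move=> n A y; have hgE w : h n A y (g n A y w) = w.
  exact: (congr1 (fun h : strat_hom c c => h n A y w) hg).
have [rs r0] := strat_coker_pointwise f y.
split=> [w|v].
  by have [v vE] := rs (g n A y w); exists v; rewrite -hrE vE hgE.
rewrite -r0; split=> [q0|r0'].
  by rewrite -[LHS]gqE q0 (linear0E (hom_linear g y)).
by rewrite -hrE [r n A y v]r0' (linear0E (hom_linear h y)).
Qed.

Definition strat_sum_in1 (a b : strat) : strat_hom a (strat_sum a b).
Proof.
refine (@mk_hom k p chark perf X t a (strat_sum a b)
  (fun n => sprod_in1 (se a n) (se b n)) _).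
abstract (by move=> l A z u;
  rewrite mk_stratE /prod_sg /= (linear0E (sg_linear b z))).
Defined.

Definition strat_sum_in2 (a b : strat) : strat_hom b (strat_sum a b).
Proof.
refine (@mk_hom k p chark perf X t b (strat_sum a b)
  (fun n => sprod_in2 (se a n) (se b n)) _).
abstract (by move=> l A z u;
  rewrite mk_stratE /prod_sg /= (linear0E (sg_linear a z))).
Defined.

Definition strat_sum_out1 (a b : strat) : strat_hom (strat_sum a b) a.
Proof.
refine (@mk_hom k p chark perf X t (strat_sum a b) a
  (fun n => sprod_out1 (se a n) (se b n)) _).
abstract (by move=> l A z u; rewrite mk_stratE).
Defined.

Definition strat_sum_out2 (a b : strat) : strat_hom (strat_sum a b) b.
Proof.
refine (@mk_hom k p chark perf X t (strat_sum a b) b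
  (fun n => sprod_out2 (se a n) (se b n)) _).
abstract (by move=> l A z u; rewrite mk_stratE).
Defined.

Hypothesis chX : locally_charted X.

Lemma strat_ker_pointwise (a b : strat) (f : strat_hom a b) :
  pointwise_kernel f (strat_ker_inj chX f).
Proof.
move=> n A y; split=> [u v /sinj_inj //|u]; split=> [u0|[w ->]].
  by exists (smk _ u0 : sker_fib (f n) y).
exact: (sinjP w).
Qed.

Lemma is_kernel_pointwise (a b c : C) (f : hom a b) (i : hom c a) :
  is_kernel f i -> pointwise_kernel f i.
Proof.
move=> [fi iU]; set j := strat_ker_inj chX f.
have [fj jU] := pointwise_is_kernel (strat_ker_pointwise f).
have [g [ig _]] := iU _ _ fj; have [h [jh _]] := jU _ _ fi.
have igE n A (y : twist n A) v : i n A y (g n A y v) = j n A y v.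
  exact: (congr1 (fun h : strat_hom (strat_ker chX f) a => h n A y v) ig).
have jhE n A (y : twist n A) v : j n A y (h n A y v) = i n A y v.
  exact: (congr1 (fun h : strat_hom c a => h n A y v) jh).
have gh : cmp g h = idm c.
  have [m [_ mU]] := iU _ _ fi.
  have <- : m = idm c by apply: mU; apply: chom_ext.
  by apply/esym/mU; apply: chom_ext => n A y v; rewrite /= igE jhE.
move=> n A y; have ghE w : g n A y (h n A y w) = w.
  exact: (congr1 (fun h : strat_hom c c => h n A y w) gh).
have [jI j0] := strat_ker_pointwise f y.
split=> [u v uv|u].
  by rewrite -[u]ghE -[v]ghE; congr (g n A y _); apply: jI; rewrite -/j !jhE.
rewrite j0; split=> -[w ->]; first by exists (g n A y w); rewrite igE.
by exists (h n A y w); rewrite -jhE.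
Qed.

Lemma mono_pointwise (a b : C) (f : hom a b) : is_mono f ->
  forall n A (y : twist n A), injective (f n A y).
Proof.
move=> mf n A y u v uv; apply/eqP; rewrite -subr_eq0; apply/eqP.
have [fi _] := pointwise_is_kernel (strat_ker_pointwise f).
have i0 : strat_ker_inj chX f = strat_zero (strat_ker chX f) a.
  apply: (mf (strat_ker chX f)); rewrite fi; apply: hom_ext => n' A' y' w /=.
  by rewrite (linear0E (hom_linear f y')).
have [_ /(_ (u - v))[+ _]] := strat_ker_pointwise f y.
rewrite (linearBE (hom_linear f y)) uv subrr => /(_ erefl)[w ->].
exact: (congr1 (fun h : strat_hom (strat_ker chX f) a => h n A y w) i0).
Qed.

Lemma epi_pointwise (a b : C) (f : hom a b) : is_epi f ->
  forall n A (y : twist n A) v, exists u, v = f n A y u.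
Proof.
move=> ef n A y v.
have [qf _] := pointwise_is_cokernel (strat_coker_pointwise f).
have q0 : strat_coker_proj f = strat_zero b (strat_coker f).
  by apply: (ef (strat_coker f)); rewrite qf; apply: hom_ext.
apply/((strat_coker_pointwise f y).2).
exact: (congr1 (fun h : strat_hom b (strat_coker f) => h n A y v) q0).
Qed.

Lemma strat_abelian : is_abelian C.
Proof.
split.
  exists (strat_null chark perf X t : C); split=> b.
    exists (h0 (strat_null chark perf X t : C) b); split=> // f _; apply: hom_ext => n A y u.
    by rewrite [u]thinmx0 (linear0E (hom_linear f y)).
  exists (h0 b (strat_null chark perf X t : C)); split=> // f _; apply: hom_ext => n A y u.
  by rewrite [RHS]thinmx0 [LHS]thinmx0.
split.
  move=> a b; exists (strat_sum a b : C), (strat_sum_in1 a b), (strat_sum_in2 a b),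
    (strat_sum_out1 a b), (strat_sum_out2 a b).
  split; apply: hom_ext => n A y // -[u v] /=.
  by apply/pair_equal_spec; rewrite /= addr0 add0r.
split.
  move=> a b f; exists (strat_ker chX f), (strat_ker_inj chX f).
  exact/pointwise_is_kernel/strat_ker_pointwise.
split.
  move=> a b f; exists (strat_coker f), (strat_coker_proj f).
  exact/pointwise_is_cokernel/strat_coker_pointwise.
split=> a b f.
  move=> /mono_pointwise fI; exists (strat_coker f), (strat_coker_proj f).
  apply: pointwise_is_kernel => n A y; split; first exact: fI.
  exact: (strat_coker_pointwise f y).2.
move=> /epi_pointwise fs; exists (strat_ker chX f), (strat_ker_inj chX f).
apply: pointwise_is_cokernel => n A y; split=> [v|].
  by have [u ->] := fs n A y v; exists u.
exact: (strat_ker_pointwise f y).2.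
Qed.

End StratAbelian.

Arguments hom_linear {k p chark perf X t a b} f {n A} y _.

(** * Tensor constraints tested on pure tensors *)

Section PureTensors.
Variable A : comPzRingType.

Lemma tens_map_pure_linear (M N M' N' : lmodType A) (f : M -> M') (g : N -> N') u v :
  linear f -> linear g -> tens_map f g (pure u v) = pure (f u) (g v).
Proof.
by move=> /linear_semilinear sf /linear_semilinear sg; exact: tens_map_pure sf sg.
Qed.

Lemma tens_lunit_pure (M : lmodType A) (a : A) (u : M) :
  tens_lunit (pure (a : A^o) u) = a *: u.
Proof. by rewrite /tens_lunit teval_pure //; exact: lunit_balanced. Qed.

Lemma tens_runit_pure (M : lmodType A) (a : A) (u : M) :
  tens_runit (pure u (a : A^o)) = a *: u.
Proof. by rewrite /tens_runit teval_pure //; exact: runit_balanced. Qed.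

Lemma pure_scaler (M N : lmodType A) a (u : M) (v : N) : pure u (a *: v) = a *: pure u v.
Proof. by rewrite scale_pure; case: (balanced_pure M N). Qed.

Lemma pure_suml (M N : lmodType A) n (F : 'I_n -> M) (v : N) :
  pure (\sum_i F i) v = \sum_i pure (F i) v.
Proof.
have [l _ _] := balanced_pure M N; elim/big_rec2: _ => [|i x y _ <-]; last exact: l.
by rewrite -[X in pure X v](scale0r 0) -scale_pure scale0r.
Qed.

Lemma pure_sumr (M N : lmodType A) n (F : 'I_n -> N) (u : M) :
  pure u (\sum_i F i) = \sum_i pure u (F i).
Proof.
have [_ r _] := balanced_pure M N; elim/big_rec2: _ => [|i x y _ <-]; last exact: r.
by rewrite -[X in pure u X](scale0r 0) pure_scaler scale0r.
Qed.

Lemma tens_linear_ext (M N P : lmodType A) (f g : tens M N -> P) :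
  linear f -> linear g -> (forall u v, f (pure u v) = g (pure u v)) -> forall x, f x = g x.
Proof. by move=> lf lg; apply: tens_eq_fun; exact: linearDE. Qed.

Lemma tens_lunit_bij (M : lmodType A) : bijective (@tens_lunit A M).
Proof.
exists (fun u => pure (1 : A^o) u) => [|u]; last by rewrite tens_lunit_pure scale1r.
apply: tens_linear_ext => [a x y|//|a u].
  have [_ r _] := balanced_pure A^o M.
  by rewrite (@tens_lunit_linear A M) r pure_scaler.
by rewrite tens_lunit_pure pure_scaler scale_pure [_ *: _]mulr1.
Qed.

Lemma tens_runit_bij (M : lmodType A) : bijective (@tens_runit A M).
Proof.
exists (fun u => pure u (1 : A^o)) => [|u]; last by rewrite tens_runit_pure scale1r.
apply: tens_linear_ext => [a x y|//|u a].
  have [l _ _] := balanced_pure M A^o.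
  by rewrite (@tens_runit_linear A M) l scale_pure.
by rewrite tens_runit_pure -scale_pure -pure_scaler [_ *: _]mulr1.
Qed.

(* The inverse of the associativity constraint is itself conjugated by braidings. *)
Lemma tens_assoc_bij (M N P : lmodType A) : bijective (@tens_assoc A M N P).
Proof.
have lid (Q : lmodType A) : linear (fun x : Q => x) by [].
have lb (Q Q' : lmodType A) := @tens_braid_linear A Q Q'.
have la (Q Q' Q'' : lmodType A) := @tens_assoc_linear A Q Q' Q''.
pose g (x : tens M (tens N P)) : tens (tens M N) P :=
  tens_map (@tens_braid A N M) (fun w : P => w)
   (tens_braid (tens_assoc (tens_map (@tens_braid A N P) (fun u : M => u) (tens_braid x)))).
have lg : linear g.
  apply: linear_funcomp (tens_map_linear (lb N M) (lid P)).
  apply: linear_funcomp (lb P (tens N M)).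
  apply: linear_funcomp (la P N M).
  by apply: linear_funcomp (tens_map_linear (lb N P) (lid M)); exact: lb.
have gE u v w : g (pure u (pure v w)) = pure (pure u v) w.
  rewrite /g tens_braid_pure (tens_map_pure_linear _ _ (lb N P) (lid M)) tens_braid_pure.
  rewrite tens_assoc_pure tens_braid_pure (tens_map_pure_linear _ _ (lb N M) (lid P)).
  by rewrite tens_braid_pure.
have [gD _] := (linear_semilinear g).1 lg.
exists g.
  apply: tens3_eq_fun => [x y|x y|u v w] //; last by rewrite tens_assoc_pure gE.
  by rewrite (linearDE (la M N P)) gD.
apply: tens_linear_ext => [||u]; [exact: linear_funcomp lg (la M N P)|exact: lid|].
apply: tens_linear_ext.
- move=> a x y; have [_ r _] := balanced_pure M (tens N P).
  by rewrite r pure_scaler lg la.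
- move=> a x y; have [_ r _] := balanced_pure M (tens N P).
  by rewrite r pure_scaler.
- by move=> v w; rewrite gE tens_assoc_pure.
Qed.

End PureTensors.

Section StratTensor.
Variables (k : fieldType) (p : nat) (chark : p \in [pchar k]).
Variable perf : forall a : k, exists b : k, b ^+ p = a.
Variables (X : kfunctor k) (t : nat).

Local Notation twist := (twist chark X).
Local Notation strat := (strat chark perf X t).
Local Notation C := (StratCat chark perf X t).

Lemma tens_hom_ext (a b c : C) (f g : hom (ten a b) c) :
  (forall n A (y : twist n A) (u : se a n A y) (v : se b n A y),
     sm f n A y (pure u v) = sm g n A y (pure u v)) -> f = g.
Proof.
move=> fg; apply: chom_ext => n A y u.
exact: (tens_linear_ext (hom_linear f y)
  (hom_linear g y) (@fg n A y)).
Qed.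

Lemma pure_linearl (A : comPzRingType) (M N : lmodType A) (v : N) :
  linear (fun u : M => pure u v).
Proof. by move=> a x y; have [l _ _] := balanced_pure M N; rewrite l scale_pure. Qed.

Lemma tens3_hom_ext (a b c d : C) (f g : hom (ten (ten a b) c) d) :
  (forall n A (y : twist n A) (u : se a n A y) (v : se b n A y)
     (w : se c n A y),
     sm f n A y (pure (pure u v) w) =
     sm g n A y (pure (pure u v) w)) -> f = g.
Proof.
move=> fg; apply: tens_hom_ext => n A y u w.
apply: (tens_linear_ext (linear_funcomp (pure_linearl w) (hom_linear f y))
  (linear_funcomp (pure_linearl w) (hom_linear g y))) => u' v.
exact: fg.
Qed.

Lemma tens4_hom_ext (a b c d e : C) (f g : hom (ten (ten (ten a b) c) d) e) :
  (forall n A (y : twist n A) (u : se a n A y) (v : se b n A y)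
     (w : se c n A y) (x : se d n A y),
     sm f n A y (pure (pure (pure u v) w) x) =
     sm g n A y (pure (pure (pure u v) w) x)) -> f = g.
Proof.
move=> fg; apply: tens3_hom_ext => n A y u w x.
apply: (tens_linear_ext
  (linear_funcomp (linear_funcomp (pure_linearl w) (pure_linearl x)) (hom_linear f y))
  (linear_funcomp (linear_funcomp (pure_linearl w) (pure_linearl x)) (hom_linear g y)))
  => u' v.
exact: fg.
Qed.

Lemma bij_is_iso (a b : C) (f : hom a b) :
  (forall n A (y : twist n A), bijective (sm f n A y)) -> is_iso f.
Proof.
move=> bf; have [g gP] : exists g : forall n, shom (se b n) (se a n),
    forall n, scomp (g n) (f n) = sid _ /\ scomp (f n) (g n) = sid _.
  have H n := (s_iso_bij (f n)).2 (bf n).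
  by exists (fun n => projT1 (cid (H n))) => n; exact: (projT2 (cid (H n))).
have gf n A (y : twist n A) u : g n A y (f n A y u) = u.
  exact: (congr1 (fun h : shom _ _ => h A y u) (gP n).1).
have fg n A (y : twist n A) u : f n A y (g n A y u) = u.
  exact: (congr1 (fun h : shom _ _ => h A y u) (gP n).2).
have gs l A (z : lsrc chark perf X t l A) u :
    g _ _ (lb chark perf X t l A z) (sg b z u) = sg a z (g _ _ (la chark perf X t l A z) u).
  by rewrite -{1}[u]fg -sg_hom gf.
exists (mk_hom gs : hom b a); split; apply: chom_ext => n A y u /=; [exact: gf|exact: fg].
Qed.

Lemma ten_pure (a b a' b' : C) (f : hom a a') (g : hom b b') n A (y : twist n A)
    (u : se a n A y) (v : se b n A y) :
  sm (tenm f g) n A y (pure u v) =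
  pure (sm f n A y u) (sm g n A y v).
Proof.
exact: tens_map_pure_linear (hom_linear f y)
  (hom_linear g y).
Qed.

Lemma strat_ten_functorial : ten_functorial C.
Proof.
split=> [a b|a b c a' b' c' f g f' g']; apply: tens_hom_ext => n A y u v.
  by rewrite ten_pure.
rewrite ten_pure /= -[RHS]/(sm (tenm g g') n A y (sm (tenm f f') n A y (pure u v))).
by rewrite !ten_pure.
Qed.

Lemma strat_ten_bilinear : ten_bilinear C.
Proof.
move=> a b a' b'; split=> [f f' g|f g g'|x f g|x f g]; apply: tens_hom_ext => n A y u v.
- rewrite ten_pure /=.
  rewrite -[RHS]/(sm (tenm f g) n A y (pure u v) + sm (tenm f' g) n A y (pure u v)).
  by rewrite !ten_pure; case: (balanced_pure (se (a' : strat) n A y) (se (b' : strat) n A y)).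
- rewrite ten_pure /=.
  rewrite -[RHS]/(sm (tenm f g) n A y (pure u v) + sm (tenm f g') n A y (pure u v)).
  by rewrite !ten_pure; case: (balanced_pure (se (a' : strat) n A y) (se (b' : strat) n A y)).
- rewrite ten_pure /= -[RHS]/(kstr A x *: sm (tenm f g) n A y (pure u v)) ten_pure.
  by rewrite scale_pure.
- rewrite ten_pure /= -[RHS]/(kstr A x *: sm (tenm f g) n A y (pure u v)) ten_pure.
  by rewrite -pure_scaler.
Qed.

Lemma strat_constraints_natural : constraints_natural C.
Proof.
split=> [a b c a' b' c' f g h|a a' f|a a' f|a b a' b' f g].
- apply: tens3_hom_ext => n A y u v w.
  rewrite -[LHS]/(tens_assoc (sm (tenm (tenm f g) h) n A y (pure (pure u v) w))).
  rewrite -[RHS]/(sm (tenm f (tenm g h)) n A y (tens_assoc (pure (pure u v) w))).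
  by rewrite !ten_pure !tens_assoc_pure !ten_pure.
- apply: tens_hom_ext => n A y u v.
  rewrite -[LHS]/(tens_lunit (sm (tenm (idm (tone C)) f) n A y (pure u v))).
  by rewrite ten_pure tens_lunit_pure /= tens_lunit_pure (linearZE (hom_linear f y)).
- apply: tens_hom_ext => n A y u v.
  rewrite -[LHS]/(tens_runit (sm (tenm f (idm (tone C))) n A y (pure u v))).
  by rewrite ten_pure tens_runit_pure /= tens_runit_pure (linearZE (hom_linear f y)).
- apply: tens_hom_ext => n A y u v.
  rewrite -[LHS]/(tens_braid (sm (tenm f g) n A y (pure u v))).
  rewrite -[RHS]/(sm (tenm g f) n A y (tens_braid (pure u v))).
  by rewrite ten_pure !tens_braid_pure ten_pure.
Qed.

Lemma strat_constraints_iso : constraints_iso C.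
Proof.
split=> [a b c|a|a]; apply: bij_is_iso => n A y.
- exact: tens_assoc_bij.
- exact: tens_lunit_bij.
- exact: tens_runit_bij.
Qed.

Lemma strat_pentagon : pentagon C.
Proof.
move=> a b c d; apply: tens4_hom_ext => n A y u v w x.
rewrite -[LHS]/(tens_assoc (tens_assoc (pure (pure (pure u v) w) x))).
rewrite -[RHS]/(sm (tenm (idm a) (assoc b c d)) n A y (tens_assoc
  (sm (tenm (assoc a b c) (idm d)) n A y (pure (pure (pure u v) w) x)))).
rewrite ten_pure -[sm (assoc a b c) _ _ _]/(@tens_assoc A _ _ _).
by rewrite !tens_assoc_pure ten_pure /= tens_assoc_pure.
Qed.

Lemma strat_triangle : triangle C.
Proof.
move=> a b; apply: tens3_hom_ext => n A y u v w.
rewrite -[LHS]/(sm (tenm (idm a) (lunit b)) n A y (tens_assoc (pure (pure u v) w))).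
rewrite tens_assoc_pure !ten_pure /= tens_lunit_pure tens_runit_pure.
by rewrite pure_scaler scale_pure.
Qed.

Lemma strat_hexagon : hexagon C.
Proof.
move=> a b c; apply: tens3_hom_ext => n A y u v w.
rewrite -[LHS]/(tens_assoc (tens_braid (tens_assoc (pure (pure u v) w)))).
rewrite -[RHS]/(sm (tenm (idm b) (braid a c)) n A y (tens_assoc
  (sm (tenm (braid a b) (idm c)) n A y (pure (pure u v) w)))).
rewrite !(tens_assoc_pure, tens_braid_pure, ten_pure).
rewrite -[sm (braid a b) _ _ _]/(@tens_braid A _ _) tens_braid_pure tens_assoc_pure.
by rewrite ten_pure /= tens_braid_pure.
Qed.

Lemma strat_symmetric : braid_symmetric C.
Proof.
move=> a b; apply: tens_hom_ext => n A y u v.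
by rewrite -[LHS]/(tens_braid (tens_braid (pure u v))) !tens_braid_pure.
Qed.

Lemma strat_tensor : is_tensor_category C.
Proof.
split; split.
- exact: strat_ten_functorial.
- exact: strat_ten_bilinear.
- exact: strat_constraints_natural.
- exact: strat_constraints_iso.
- exact: strat_pentagon.
- exact: strat_triangle.
- exact: strat_hexagon.
- exact: strat_symmetric.
Qed.

End StratTensor.

(** * Evaluation, coevaluation and rigidity *)

Section Evaluation.
Variables (A : comPzRingType) (M : lmodType A).

Definition is_dual_basis n (e : 'I_n -> M) (phi : 'I_n -> dual M) : Prop :=
  forall u, u = \sum_i (phi i u : A) *: e i.

Lemma eval_balanced : balanced (fun (psi : dual M) (u : M) => psi u).
Proof.
split=> [//|psi u v|a psi u]; first exact: (linearDE (dual_linear psi)).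
by rewrite (linearZE (dual_linear psi)).
Qed.

Definition tens_eval : tens (dual M) M -> A^o :=
  teval (fun (psi : dual M) (u : M) => psi u).

Lemma tens_eval_linear : linear tens_eval.
Proof.
by apply/linear_semilinear/teval_semilinear => //; exact: eval_balanced.
Qed.

Lemma tens_eval_pure (psi : dual M) u : tens_eval (pure psi u) = psi u.
Proof. by rewrite /tens_eval teval_pure //; exact: eval_balanced. Qed.

(** Expand each [e i] in the second basis and move the coefficients across the tensor sign. This
    independence is what makes the coevaluation natural and compatible with gluing. *)
Lemma coev_uniq n (e : 'I_n -> M) phi m (e' : 'I_m -> M) phi' :
  is_dual_basis e phi -> is_dual_basis e' phi' ->
  \sum_i pure (e i) (phi i) = \sum_j pure (e' j) (phi' j).
Proof.
move=> eP eP'; transitivity (\sum_i \sum_j pure (e' j) ((phi' j (e i) : A) *: phi i)).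
  apply: eq_bigr => i _; rewrite {1}(eP' (e i)) pure_suml; apply: eq_bigr => j _.
  by rewrite -scale_pure pure_scaler.
rewrite exchange_big; apply: eq_bigr => j _ /=.
by rewrite -pure_sumr -(dual_basis eP).
Qed.

Lemma coev_exists : fg_projective M -> exists c : tens M (dual M),
  forall n (e : 'I_n -> M) phi, is_dual_basis e phi -> c = \sum_i pure (e i) (phi i).
Proof.
move=> /fg_projective_dual[n [e [phi eP]]]; exists (\sum_i pure (e i) (phi i)) => m e' phi'.
exact: coev_uniq.
Qed.

End Evaluation.

Lemma dual_basis_pull (A B : comPzRingType) (f : {rmorphism A -> B})
  (M : lmodType A) (N : lmodType B) (g : M -> N) (bc : is_base_change f g)
  n (e : 'I_n -> M) phi :
  is_dual_basis e phi -> is_dual_basis (fun i => g (e i)) (fun i => dual_pull bc (phi i)).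
Proof.
move=> eP; have lid : linear (fun v : N => v) by [].
have lr : linear (fun v : N => \sum_i (dual_pull bc (phi i) v : B) *: g (e i)).
  move=> a x y; rewrite scaler_sumr -big_split; apply: eq_bigr => i _ /=.
  by rewrite dual_linear scalerDl scalerA.
apply: (bc_uniq bc lid lr) => u.
rewrite {1}(eP u) (semilinear_sum (bc_semilinear bc)); apply: eq_bigr => i _.
by rewrite (bc_semilinear bc).2 dual_pullE.
Qed.

Section Rigid.
Variables (k : fieldType) (p : nat) (chark : p \in [pchar k]).
Variable perf : forall a : k, exists b : k, b ^+ p = a.
Variables (X : kfunctor k) (t : nat).
Hypothesis chX : locally_charted X.

Local Notation twist := (twist chark X).
Local Notation strat := (strat chark perf X t).
Local Notation C := (StratCat chark perf X t).

Variable E : strat.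

Let proj n A (y : twist n A) : fg_projective (se E n A y) := strat_projective E chX y.

Definition ev_map n A (y : twist n A) :
  tens (dual (se E n A y)) (se E n A y) -> A^o := @tens_eval A _.

Lemma ev_nat n A B (h : kHom A B) (x : twist n A) (y : twist n B) (e : pmap h x = y)
  (u : stens (se (strat_dual chX E) n) (se E n) A x) :
  ev_map (y := y) (tr e u) = h (ev_map u).
Proof.
have ss := tr_semilinear (stens (se (strat_dual chX E) n) (se E n)) e.
move: u; apply: tens_eq_fun => [u v|u v|psi u].
- rewrite ss.1; exact: (linearDE (@tens_eval_linear B _)).
- by rewrite /ev_map (linearDE (@tens_eval_linear A _)) rmorphD.
- have -> : tr (q := stens (se (strat_dual chX E) n) (se E n)) e (pure psi u) =
      pure (tr (q := se (strat_dual chX E) n) e psi) (tr (q := se E n) e u).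
    exact: tens_map_pure (tr_semilinear _ e) (tr_semilinear _ e).
  by rewrite /ev_map !tens_eval_pure; exact: dual_pullE.
Qed.

Lemma ev_sg l A (z : lsrc chark perf X t l A)
  (u : tens (dual (se E (li l) A (la chark perf X t l A z)))
         (se E (li l) A (la chark perf X t l A z))) :
  ev_map (tens_map (sg (strat_dual chX E) z) (sg E z) u) = ev_map u.
Proof.
move: u; have l1 := sg_linear (strat_dual chX E) z.
have l2 := sg_linear E z.
apply: tens_linear_ext => [||psi u].
- exact: linear_funcomp (tens_map_linear l1 l2) (@tens_eval_linear A _).
- exact: tens_eval_linear.
- rewrite /ev_map (tens_map_pure_linear _ _ l1 l2) !tens_eval_pure mk_stratE /=.
  by rewrite sgK.
Qed.

Definition strat_ev : strat_hom (strat_tens (strat_dual chX E) E) (strat_one chark perf X t).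
Proof.
refine (@StratHom k p chark perf X t
  (strat_tens (strat_dual chX E) E) (strat_one chark perf X t)
  (fun n => @SHom k (twist n) (stens (se (strat_dual chX E) n) (se E n)) (sunit (twist n))
    (fun A y => @ev_map n A y) (fun A y => @tens_eval_linear A _) (@ev_nat n)) _ _).
- abstract (apply: shom_ext => A z u; exact: (@ev_sg None A z u)).
- abstract (move=> n; apply: shom_ext => A z u; exact: (@ev_sg (Some n) A z u)).
Defined.

Definition coev n A (y : twist n A) : tens (se E n A y) (dual (se E n A y)) :=
  projT1 (cid (coev_exists (proj y))).

Lemma coevE n A (y : twist n A) m (e : 'I_m -> se E n A y) phi :
  is_dual_basis e phi -> coev y = \sum_i pure (e i) (phi i).
Proof. exact: (projT2 (cid (coev_exists (proj y)))). Qed.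

Definition coev_map n A (y : twist n A) (a : A^o) : tens (se E n A y) (dual (se E n A y)) :=
  (a : A) *: coev y.

Lemma coev_map_linear n A (y : twist n A) : linear (@coev_map n A y).
Proof. by move=> a u v; rewrite /coev_map scalerDl scalerA. Qed.

Lemma coev_nat n A B (h : kHom A B) (x : twist n A) (y : twist n B) (e : pmap h x = y)
  (a : sunit (twist n) A x) :
  coev_map y (h a) =
  tr (q := stens (se E n) (se (strat_dual chX E) n)) e (coev_map x a).
Proof.
have ss := tr_semilinear (stens (se E n) (se (strat_dual chX E) n)) e.
rewrite /coev_map ss.2; congr (_ *: _).
have /fg_projective_dual[m [b [phi bP]]] := proj x.
rewrite (coevE bP) (coevE (dual_basis_pull (tr_bc (se E n) e) bP)) (semilinear_sum ss).
apply: eq_bigr => i _; apply/esym.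
exact: (tens_map_pure (b i) (phi i : se (strat_dual chX E) n A x)
  (tr_semilinear (se E n) e) (tr_semilinear (se (strat_dual chX E) n) e)).
Qed.

Lemma coev_sg l A (z : lsrc chark perf X t l A) (a : A^o) :
  coev_map (lb chark perf X t l A z) a =
  tens_map (sg E z) (sg (strat_dual chX E) z) (coev_map (la chark perf X t l A z) a).
Proof.
have l1 := sg_linear (strat_dual chX E) z.
have l2 := sg_linear E z.
have lt := tens_map_linear l2 l1; rewrite /coev_map (linearZE lt); congr (_ *: _).
have /fg_projective_dual[m [b [phi bP]]] := proj (la chark perf X t l A z).
have bP' : is_dual_basis (fun i => sg E z (b i)) (fun i => sg (strat_dual chX E) z (phi i)).
  move=> u; rewrite -[LHS]sgiK {1}(bP (sgi u)) (linear_sumE l2); apply: eq_bigr => i _.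
  by rewrite (linearZE l2) mk_stratE.
rewrite (coevE bP) (coevE bP') (linear_sumE lt); apply: eq_bigr => i _.
by rewrite (tens_map_pure_linear _ _ l2 l1).
Qed.

Definition strat_coev : strat_hom (strat_one chark perf X t) (strat_tens E (strat_dual chX E)).
Proof.
refine (@StratHom k p chark perf X t
  (strat_one chark perf X t) (strat_tens E (strat_dual chX E))
  (fun n => @SHom k (twist n) (sunit (twist n)) (stens (se E n) (se (strat_dual chX E) n))
    (fun A y => @coev_map n A y) (fun A y => @coev_map_linear n A y) (@coev_nat n)) _ _).
- abstract (apply: shom_ext => A z u; exact: (@coev_sg None A z u)).
- abstract (move=> n; apply: shom_ext => A z u; exact: (@coev_sg (Some n) A z u)).
Defined.

Let ev_ : hom (ten (strat_dual chX E : C) E) (tone C) := strat_ev.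
Let coev_ : hom (tone C) (ten (E : C) (strat_dual chX E)) := strat_coev.

(** On pure tensors the two triangle identities become the expansions of [u] and of [psi] in a dual
    basis. *)
Lemma strat_is_dual : @is_dual k C E (strat_dual chX E) strat_ev strat_coev.
Proof.
split=> [|ai [_ aiP]]; apply: tens_hom_ext => n A y.
  move=> a u.
  rewrite -[LHS]/(tens_runit (sm (tenm (idm (E : C)) ev_) n A y
    (tens_assoc (sm (tenm coev_ (idm (E : C))) n A y (pure a u))))).
  rewrite ten_pure -[RHS]/(tens_lunit (pure a u)) tens_lunit_pure.
  rewrite -[sm coev_ n A y a]/(coev_map y a) /coev_map.
  have /fg_projective_dual[m [b [phi bP]]] := proj y.
  rewrite (coevE bP) -scale_pure pure_suml.
  rewrite (linearZE (@tens_assoc_linear A _ _ _)) (linear_sumE (@tens_assoc_linear A _ _ _)).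
  have lf := hom_linear (tenm (idm (E : C)) ev_) y.
  rewrite (linearZE lf) (linear_sumE lf) (linearZE (@tens_runit_linear A _)).
  rewrite (linear_sumE (@tens_runit_linear A _)) [in RHS](bP u); congr (_ *: _).
  apply: eq_bigr => i _; rewrite tens_assoc_pure ten_pure tens_runit_pure.
  by rewrite -[sm ev_ n A y _]/(tens_eval _) tens_eval_pure.
move=> psi a.
rewrite -[LHS]/(tens_lunit (sm (tenm ev_ (idm (strat_dual chX E : C))) n A y (sm ai n A y
    (sm (tenm (idm (strat_dual chX E : C)) coev_) n A y (pure psi a))))).
rewrite ten_pure -[RHS]/(tens_runit (pure psi a)) tens_runit_pure.
rewrite -[sm coev_ n A y a]/(coev_map y a) /coev_map.
have /fg_projective_dual[m [b [phi bP]]] := proj y.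
(* [ai] is known only as an inverse of the associativity constraint, so its values are read off from
   injectivity of that constraint. *)
have aiE u v w : sm ai n A y (pure u (pure v w)) = pure (pure u v) w.
  have aI := bij_inj (tens_assoc_bij (dual (se E n A y)) (se E n A y) (dual (se E n A y))).
  apply: aI; rewrite tens_assoc_pure.
  exact: (congr1 (fun h : strat_hom _ _ => h n A y _) aiP).
rewrite (coevE bP) pure_scaler pure_sumr.
have li := hom_linear ai y.
have lf := hom_linear (tenm ev_ (idm (strat_dual chX E : C))) y.
rewrite (linearZE li) (linear_sumE li) (linearZE lf) (linear_sumE lf).
rewrite (linearZE (@tens_lunit_linear A _)) (linear_sumE (@tens_lunit_linear A _)).
rewrite [in RHS](dual_basis bP psi); congr (_ *: _).
apply: eq_bigr => i _; rewrite aiE ten_pure tens_lunit_pure.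
by rewrite -[sm ev_ n A y _]/(tens_eval _) tens_eval_pure.
Qed.

End Rigid.

Section StratMain.
Variables (k : fieldType) (p : nat) (chark : p \in [pchar k]).
Variable perf : forall a : k, exists b : k, b ^+ p = a.
Variable (X : kfunctor k).
Hypothesis chX : locally_charted X.

Lemma strat_rigid_abelian_tensor t : rigid_abelian_tensor_category (StratCat chark perf X t).
Proof.
split; [exact: strat_klinear|exact: strat_abelian|exact: strat_tensor|].
move=> E; exists (strat_dual chX E), (strat_ev chX E), (strat_coev chX E).
exact: strat_is_dual.
Qed.

End StratMain.

(** * The functors (+) and omega *)

Lemma reduced_inj (A B : comPzRingType) (h : {rmorphism A -> B}) : reduced A ->
  (forall a, h a = 0 -> exists n, a ^+ n = 0) -> injective h.
Proof.
move=> redA hn x y hxy; apply/eqP; rewrite -subr_eq0; apply/eqP.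
by have [n /redA] := hn (x - y) ltac:(by rewrite rmorphB hxy subrr).
Qed.

(** * Exactness and full faithfulness of the functor [plus] *)

Section Plus.
Variables (k : fieldType) (p : nat) (chark : p \in [pchar k]).
Variable perf : forall a : k, exists b : k, b ^+ p = a.
Variables (X : kfunctor k) (t : nat).
Hypothesis chX : locally_charted X.

Local Notation P := (plus chark perf X t).
Local Notation C := (StratCat chark perf X t).

(** The functor leaves all fibres unchanged, and exactness is a fibrewise condition. *)
Lemma plus_exact : is_exact_functor P.
Proof.
move=> a b c f g [/(is_kernel_pointwise chX) kf /is_cokernel_pointwise cg]; split.
  by apply: pointwise_is_kernel => n A y; exact: kf.
by apply: pointwise_is_cokernel => n A y; exact: cg.
Qed.

Lemma plus_tensor : is_tensor_functor P.
Proof.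
split; split.
- by move=> a b; apply: bij_is_iso => n A y; exists id.
- by apply: bij_is_iso => n A y; exists id.
- by move=> a b a' b' f g; apply: chom_ext.
- by move=> a b c; apply: chom_ext => n A y u /=; rewrite !tens_map_id.
- by move=> a; apply: chom_ext => n A y u /=; rewrite tens_map_id.
- by move=> a; apply: chom_ext => n A y u /=; rewrite tens_map_id.
- by move=> a b; apply: chom_ext.
Qed.

Lemma plus_exact_linear_tensor : exact_linear_tensor_functor P.
Proof.
split; [|split|exact: plus_exact|exact: plus_tensor].
- by split=> *; apply: chom_ext.
- by move=> a b f g; apply: chom_ext.
- by move=> a b x f; apply: chom_ext.
Qed.

Lemma plus_faithful : is_faithful P.
Proof.
move=> a b f g fg; apply: chom_ext => n A y u.
exact: (congr1 (fun h : strat_hom (plus_ob a) (plus_ob b) => h n A y u) fg).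
Qed.

Lemma frobN_inj_point (R : kAlg k) (v : untwist chark perf X t R) : reduced R ->
  exists (R' : kAlg k) (h : kHom R R') (w : untwist chark perf X t.+1 R'),
    injective h /\ frobN chark perf X t R' w = pmap h v.
Proof.
move=> redR.
pose i : kHom R (restr idfun R) := @KHom k R (restr idfun R) idfun (fun _ => erefl).
have [w [h [hE wE]]] := @untwist_frob k p chark perf X t idfun R (pmap i v).
exists (restr (idfun \o frobk chark : {rmorphism k -> k}) R), (kcomp h i), w; split.
  by apply: reduced_inj => // a /= ha; exists p; rewrite -hE.
by rewrite wE pmap_comp.
Qed.

(** A morphism between the images commutes with [sig0] only after pullback along [frobN], so the
    defect [d] vanishes at points in the image of [frobN]. By [frobN_inj_point] every point over a
    reduced chart becomes such a point after an injective extension, and [charted_zero] applies. *)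
Lemma plus_full : is_full P.
Proof.
move=> a b h; set h' : strat_hom (plus_ob a) (plus_ob b) := h.
pose d := sadd (scomp (pull_map (frob1 chark perf X t) (h' 1%N)) (sig0 a))
  (sopp (scomp (sig0 b) (pull_map (frob0 chark perf X t) (h' 0%N)))).
have d0 : forall A (v : untwist chark perf X t A) u, d A v u = 0.
  apply: (charted_zero (f := d) (untwist_charted chX)).
  - by move=> A v; exact: strat_projective.
  - move=> R v [_ redR]; have [R' [m [w [mI wE]]]] := frobN_inj_point v redR.
    exists R', m; split=> // v'; rewrite -wE in v' *.
    apply/eqP; rewrite subr_eq0; apply/eqP; exact: (@sm_sig0E _ _ _ _ _ _ _ _ h' R' w v').
have h0 : scomp (pull_map (frob1 chark perf X t) (h' 1%N)) (sig0 a) =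
    scomp (sig0 b) (pull_map (frob0 chark perf X t) (h' 0%N)).
  by apply: shom_ext => A v u; apply/eqP; rewrite -subr_eq0; apply/eqP; exact: d0.
by exists (@StratHom k p chark perf X t a b (sm h') h0 (sm_sig h')); apply: chom_ext.
Qed.

Lemma plus_fully_faithful : fully_faithful_embedding P.
Proof.
by split; [exact: plus_exact_linear_tensor|exact: plus_faithful|exact: plus_full].
Qed.

End Plus.

(** * Supports of morphisms *)

Section Support.
Variables (A : comPzRingType) (M M' : lmodType A) (h : M -> M') (r : M' -> M).
Hypotheses (lh : linear h) (lr : linear r) (hrh : forall u, h (r (h u)) = h u).
Hypotheses (pM' : fg_projective M') (fgM : finitely_generated M).

(* The ideal of coefficients of a von Neumann regular map is generated by an
   idempotent, whose locus is the support of the map. *)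
Lemma regular_support : exists2 e : A,
  igen (fun x => exists (phi : dual M') u, x = phi (h u)) e & 
  e * e = e /\ forall u, h u = e *: h u.
Proof.
have /fg_projective_dual[n [b [phi bP]]] := pM'; have [m [d dE]] := fgM.
pose S x := exists (psi : dual M') u, x = psi (h u) :> A.
pose s := [seq (phi j (h (d i)) : A) | i <- enum 'I_m, j <- enum 'I_n].
have phiS j u : igen S (phi j (h u)) by apply: mem_igen; exists (phi j), u.
have psiE (psi : dual M') u : psi (h u) = \sum_j (phi j (h u) : A) * psi (b j) :> A.
  rewrite [in LHS](bP (h u)) (linear_sumE (dual_linear psi)).
  by apply: eq_bigr => j _; rewrite (linearZE (dual_linear psi)).
have iS := igen_ideal S.
have [|x Sx|e Se eE] := @idem_ideal_fg A (igen S) s iS.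
- move=> x; split=> [Sx|sx]; last first.
    apply: igen_mono sx => _ /allpairsP[[i j] [_ _ ->]].
    by exists (phi j), (d i).
  have iss := igen_ideal (fun y => y \in s).
  apply: igen_sub Sx => // _ [psi [u ->]]; rewrite psiE.
  apply: (ideal_sum _ _ iss) => j; apply: (ideal_mulr _ iss).
  have [c ->] := dE u; rewrite (linear_sumE lh) (linear_sumE (dual_linear (phi j))).
  apply: (ideal_sum _ _ iss) => i; rewrite (linearZE lh) (linearZE (dual_linear (phi j))).
  case: iss => _ _; apply; apply: mem_igen; apply/allpairsP; exists (i, j).
  by rewrite !mem_enum.
- apply: igen_sub Sx => [|z]; first exact: igen_ideal.
  (* Writing [h u] as [h (r (h u))] turns each coefficient into a sum of products of two
     coefficients, so the ideal equals its square. *)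
  move=> [psi [u ->]]; rewrite -hrh {1}(bP (h u)) (linear_sumE lr) (linear_sumE lh).
  rewrite (linear_sumE (dual_linear psi)); apply: (ideal_sum _ _ (igen_ideal _)) => j.
  rewrite (linearZE lr) (linearZE lh) (linearZE (dual_linear psi)).
  apply: mem_igen; exists (phi j (h u)), (psi (h (r (b j)))); split=> //.
  by apply: mem_igen; exists psi, (r (b j)).
exists e => //; split=> [|u]; first by rewrite -eE.
rewrite {2}(bP (h u)) scaler_sumr {1}(bP (h u)); apply: eq_bigr => j _.
by rewrite scalerA -eE.
Qed.

End Support.

(** * The fibre functor at a rational point *)

Section Omega.
Variables (k : fieldType) (p : nat) (chark : p \in [pchar k]).
Variable perf : forall a : k, exists b : k, b ^+ p = a.
Variables (X : kfunctor k).
Hypothesis chX : locally_charted X.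
Variables (t : nat).

Local Notation twist := (twist chark X).
Local Notation strat := (strat chark perf X t).
Local Notation C := (StratCat chark perf X t).

Section Support0.
Variables (D E : strat) (f : strat_hom D E).

(** One idempotent of [A] controls the support over every [A]-algebra: its image fixes [f], and
    being a combination of coefficients of [f] it is killed by whatever kills [f]. *)
Lemma support_point A (y : X A) : exists2 e : A, e * e = e &
  forall (B : kAlg k) (h : kHom A B),
    (forall u, f 0%N B (pmap h y) u = h e *: f 0%N B (pmap h y) u) /\
    forall b, (forall u, b *: f 0%N B (pmap h y) u = 0) -> b * h e = 0.
Proof.
have [r lr rE] := strat_hom_regular chX f (y : twist 0 A).
have [e eS [ee eE]] := regular_support (@sh_linear _ _ _ _ (f 0%N) A y) lr rE
  (strat_projective E chX (n := 0) y) (@se_coh _ _ _ _ _ _ D 0%N A y).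
exists e => // B h; have bD := tr_bc (se D 0) (erefl (pmap h y)).
have bE := tr_bc (se E 0) (erefl (pmap h y)).
have lf := @sh_linear _ _ _ _ (f 0%N) B (pmap h y); split.
  apply: (bc_uniq bD lf) => [a u v|u].
    by rewrite lf scalerDr !scalerA mulrC.
  by rewrite sh_nat {1}eE trZ.
move=> b b0; move: e eS {ee eE}; apply: igen_ind => [|x x' hx hx'|a x hx|_ [phi [u ->]]].
- by rewrite rmorph0 mulr0.
- by rewrite rmorphD mulrDr hx hx' addr0.
- by rewrite rmorphM mulrCA hx mulr0.
- rewrite -(dual_pullE bE) -sh_nat.
  rewrite -[LHS]/(b *: (dual_pull bE phi _ : B^o)).
  rewrite -(linearZE (dual_linear (dual_pull bE phi))).
  by rewrite b0 (linear0E (dual_linear (dual_pull bE phi))).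
Qed.

(** In terms of [support_point], [U] is the locus [e = 0] and [V] the locus [e = 1]. Both are
    phrased without [e], which depends on the point chosen. *)
Let U : subfun X := fun A y => forall u, f 0%N A y u = 0.
Let V : subfun X := fun A y => forall a, (forall u, a *: f 0%N A y u = 0) -> a = 0.

Lemma support_zero_open : open_subfun U.
Proof.
move=> A y; have [e ee eP] := support_point y; exists (fun a => a = 1 - e) => B h.
have [fe ef] := eP B h; split=> [U0|[n [a [c [aE cE]]]] u].
  have := ef 1 (fun u => ltac:(by rewrite U0 scaler0)); rewrite mul1r => he.
  exists 1%N, (fun=> 1 - e), (fun=> 1); split=> //.
  by rewrite big_ord1 rmorphB rmorph1 he subr0 mulr1.
suff he : h e = 0 by rewrite fe he scale0r.
rewrite -[h e]mulr1 -cE mulr_sumr big1 // => i _.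
by rewrite aE mulrCA -rmorphM mulrBr mulr1 ee subrr rmorph0 mulr0.
Qed.

Lemma support_one_open : open_subfun V.
Proof.
move=> A y; have [e ee eP] := support_point y; exists (fun a => a = e) => B h.
have [fe ef] := eP B h; split=> [V0|[n [a [c [aE cE]]]] b /ef].
  exists 1%N, (fun=> e), (fun=> 1); split=> //.
  rewrite big_ord1 mul1r; apply/eqP; rewrite eq_sym -subr_eq0; apply/eqP.
  by apply: V0 => u; rewrite scalerBl scale1r -fe subrr.
have -> : h e = 1.
  rewrite -[h e]mulr1 -cE mulr_sumr; apply: eq_bigr => i _.
  by rewrite aE mulrCA -rmorphM ee.
by rewrite mulr1.
Qed.

Hypothesis girr : geometrically_irreducible X.

(** [U] contains [x] and shares no field-valued point with [V], so irreducibility leaves [V] without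
    field-valued points. If the idempotent [e] were nonzero, [1 - e] would not be a unit, and a
    residue field killing [1 - e] would give a point of [V]. *)
Lemma hom0_connected (x : X (kbase k)) : (forall u, f 0%N (kbase k) x u = 0) ->
  forall A (y : X A) u, f 0%N A y u = 0.
Proof.
move=> fx; have fk : is_field (kbase k).
  split=> [/eqP|a /eqP a0]; first by rewrite oner_eq0.
  by exists a^-1; rewrite divff.
have [_ irr] := girr fk.
(* Geometric irreducibility is applied with [k] itself as the extension, so opens of [X] are pulled
   back to the product with the spectrum of [k]. *)
have open1 (W : subfun X) : open_subfun W ->
    @open_subfun k (kprod X (kspec (kbase k))) (fun A z => W A z.1).
  by move=> oW A [y g]; have [I IE] := oW A y; exists I.
have V0 (K : kAlg k) (y : X K) : is_field K -> ~ V y.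
  move=> fK Vy.
  have [||K' [z [fK' [Uz Vz]]]] :=
    irr _ _ (open1 _ support_zero_open) (open1 _ support_one_open).
  - by exists (kbase k), (x, kid (kbase k)).
  - pose g : kHom (kbase k) K := @KHom k (kbase k) K (kstr K) (fun _ => erefl).
    by exists K, (y, g).
  by case: fK' => + _; apply; apply: Vz => u; rewrite Uz scaler0.
move=> A y u; have [e ee eP] := support_point y.
have [fe _] := eP A (kid A); rewrite pmap_id in fe; rewrite fe.
suff -> : kid A e = 0 by rewrite scale0r.
have iI : ideal (fun a => exists b, a = b * (1 - e)).
  split=> [|_ _ [b ->] [b' ->]|a _ [b ->]].
  - by exists 0; rewrite mul0r.
  - by exists (b + b'); rewrite mulrDl.
  - by exists (a * b); rewrite mulrA.
case: (pselect (exists b, 1 = b * (1 - e))) => [[b b1]|n1].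
  by rewrite -[kid A e]mulr1 b1 mulrCA mulrBr mulr1 ee subrr mulr0.
have [K [h [fK hI]]] := residue_field iI n1; have [_ he] := eP K h.
case: (V0 K (pmap h y) fK) => b /he.
have := hI (1 - e); rewrite rmorphB rmorph1 => /(_ (ex_intro _ 1 _))/eqP.
by rewrite mul1r subr_eq0 => /(_ erefl)/eqP <-; rewrite mulr1.
Qed.

End Support0.

(** Vanishing climbs the tower: after a Frobenius pullback the gluing maps identify the fibre at one
    level with a fibre at the previous one, and such pullbacks are injective on reduced charts. *)
Lemma hom_zero_from0 (D E : strat) (f : strat_hom D E) :
  (forall A (y : X A) u, f 0%N A y u = 0) -> f = strat_zero D E.
Proof.
move=> f0; apply: hom_ext => n; elim: n => [|n IH] A y u; first exact: f0.
apply: (charted_zero (f := f n.+1) (twist_charted perf chX (n := n.+1))).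
  by move=> B z; exact: strat_projective.
move=> R v [_ redR]; have vE := frob_frobenius v.
case: n IH y u v vE => [|n] IH _ _ v vE.
  have [th [w [h [hE wE]]]] := untwist_point chark perf t (v : X (restr (frobk chark) R)).
  exists (restr th (restr (frobk chark) R)), (kcomp h (frobenius_hom chark R)); split.
    (* One Frobenius carries [v] back to a point of [X], and [untwist_point] costs a further
       [p ^ t]-th power. *)
    apply: reduced_inj => // a /= ha; exists (p * p ^ t)%N.
    by rewrite exprM -hE.
  have -> : pmap (kcomp h (frobenius_hom chark R)) v = frob1 chark perf X t _ w.
    rewrite pmap_comp vE frob1E wE; exact: kt_nat.
  move=> u'; have [u <-] := @sg_surj k p chark perf X t D None _ w u'.
  rewrite [LHS](@sg_hom _ _ _ _ _ _ D E f None _ w u) [X in sg _ _ X]IH.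
  exact: (linear0E (@sg_linear _ _ _ _ _ _ E None _ w)).
exists (restr (frobk chark) R), (frobenius_hom chark R); split.
  by apply: reduced_inj => // a /= ha; exists p.
pose R' := restr (frobk chark) R.
rewrite vE => u'; have [u <-] := @sg_surj k p chark perf X t D (Some n) R' v u'.
rewrite [LHS](@sg_hom _ _ _ _ _ _ D E f (Some n) R' v u) [X in sg _ _ X]IH.
exact: (linear0E (@sg_linear _ _ _ _ _ _ E (Some n) R' v)).
Qed.

Hypothesis girr : geometrically_irreducible X.
Variable x : X (kbase k).

Local Notation W := (omega chark perf t x).

Lemma omega_faithful : is_faithful W.
Proof.
move=> a b f g fg.
have /hom_zero_from0 fg0 : forall A (y : X A) u, strat_add f (strat_opp g) 0%N A y u = 0.
  apply: (hom0_connected (f := strat_add f (strat_opp g)) girr (x := x)) => u.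
  apply/eqP; rewrite subr_eq0; apply/eqP.
  exact: (congr1 (fun h : vhom (omega_ob x a) (omega_ob x b) => h u) fg).
apply: chom_ext => n A y u; apply/eqP; rewrite -subr_eq0; apply/eqP.
exact: (congr1 (fun h : strat_hom a b => h n A y u) fg0).
Qed.

Lemma vec_ext (U V : Vec k) (f g : hom U V) :
  (forall u, (f : vhom U V) u = (g : vhom U V) u) -> f = g.
Proof. exact: vhom_ext. Qed.

Lemma vec_is_kernel (U V V' : Vec k) (f : hom V V') (i : hom U V) :
  injective (i : vhom U V) ->
  (forall v, (f : vhom V V') v = 0 <-> exists u, v = (i : vhom U V) u) -> is_kernel f i.
Proof.
move=> iI fi; split=> [|V'' g fg].
  by apply: vec_ext => u; apply/fi; exists u.
have ex u := (fi _).1 (congr1 (fun h : vhom V'' V' => h u) fg).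
pose h u := projT1 (cid (ex u)).
have hE u : (g : vhom V'' V) u = (i : vhom U V) (h u) := projT2 (cid (ex u)).
have hl : linear h.
  by move=> a u v; apply: iI; rewrite vh_linear -!hE vh_linear.
exists (VHom hl : @hom k (Vec k) V'' U); split=> [|h' h'E].
  by apply: vec_ext => u; rewrite /= -hE.
apply: vec_ext => u; apply: iI; rewrite /= -hE.
by rewrite -(congr1 (fun h : vhom V'' V => h u) h'E).
Qed.

Lemma vec_is_cokernel (U V V' : Vec k) (f : hom U V) (q : hom V V') :
  (forall w, exists v, (q : vhom V V') v = w) ->
  (forall v, (q : vhom V V') v = 0 <-> exists u, v = (f : vhom U V) u) -> is_cokernel f q.
Proof.
move=> qs qf; split=> [|V'' g gf].
  by apply: vec_ext => u; apply/qf; exists u.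
pose s w := projT1 (cid (qs w)).
have sE w : (q : vhom V V') (s w) = w := projT2 (cid (qs w)).
pose h w := (g : vhom V V'') (s w).
have hE v : h ((q : vhom V V') v) = (g : vhom V V'') v.
  have [u uE] : exists u, s ((q : vhom V V') v) - v = (f : vhom U V) u.
    by apply/qf; rewrite (linearBE (@vh_linear _ _ _ q)) sE subrr.
  apply/eqP; rewrite -subr_eq0 -(linearBE (@vh_linear _ _ _ g)) uE; apply/eqP.
  exact: (congr1 (fun h : vhom U V'' => h u) gf).
have hl : linear h.
  by move=> a u v; rewrite -{1}[u]sE -{1}[v]sE -vh_linear hE vh_linear.
exists (VHom hl : @hom k (Vec k) V' V''); split=> [|h' h'E].
  by apply: vec_ext => u; rewrite /= hE.
apply: vec_ext => u; rewrite -[u]sE /= hE.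
by rewrite -(congr1 (fun h : vhom V V'' => h (s u)) h'E).
Qed.

Lemma vec_is_iso (U V : Vec k) (f : hom U V) (g : hom V U) :
  (forall u, (g : vhom V U) ((f : vhom U V) u) = u) ->
  (forall u, (f : vhom U V) ((g : vhom V U) u) = u) -> is_iso f.
Proof. by move=> gf fg; exists g; split; apply: vec_ext. Qed.

Lemma omega_fiber : is_fiber_functor W.
Proof.
split.
- by split=> *; apply: vec_ext.
- by split=> *; apply: vec_ext.
- move=> a b c f g [/(is_kernel_pointwise chX)/(_ 0%N _ x)[fI fP]].
  move=> /is_cokernel_pointwise/(_ 0%N _ x)[gs gP].
  by split; [apply: vec_is_kernel|apply: vec_is_cokernel].
- split; split.
  + move=> a b; apply: (@vec_is_iso _ _ _
      (@VHom k (omega_ob x (ten a b)) (vtens (omega_ob x a) (omega_ob x b)) id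
         (fun _ _ _ => erefl))) => //.
  + by apply: (@vec_is_iso _ _ _
      (@VHom k (omega_ob x (tone C)) (vunit k) id (fun _ _ _ => erefl))).
  + by move=> a b a' b' f g; apply: vec_ext.
  + by move=> a b c; apply: vec_ext => u /=; rewrite !tens_map_id.
  + by move=> a; apply: vec_ext => u /=; rewrite tens_map_id.
  + by move=> a; apply: vec_ext => u /=; rewrite tens_map_id.
  + by move=> a b; apply: vec_ext.
Qed.

(** By [omega_faithful] an endomorphism of the unit is determined by its fibre at [x], hence by the
    scalar to which it sends [1]. *)
Lemma omega_end_unit : bijective (fun c : k => hscale c (idm (tone C))).
Proof.
apply: inj_surj_bij => [c d|f].
  move=> /(congr1 (fun h : strat_hom (tone C) (tone C) => h 0%N (kbase k) x 1)) /=.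
  by rewrite ![_ *: _]mulr1.
exists ((f : strat_hom (tone C) (tone C)) 0%N (kbase k) x 1).
apply: omega_faithful; apply: vec_ext => u.
have fl := @hom_linear _ _ _ _ _ _ _ _ f 0%N (kbase k) x.
rewrite -[RHS]/((f : strat_hom (tone C) (tone C)) 0%N (kbase k) x u).
have -> : u = (u : k) *: (1 : k^o) by rewrite [_ *: _]mulr1.
by rewrite (linearZE fl) [LHS]mulrC [_ *: 1]mulr1.
Qed.

Lemma omega_neutral_Tannaka : neutral_Tannaka_category W.
Proof.
split; [exact: strat_rigid_abelian_tensor|exact: omega_end_unit|exact: omega_fiber|].
exact: omega_faithful.
Qed.

End Omega.

Theorem theorem3p4 (k : fieldType) (p : nat) (chark : p \in [pchar k])
    (perf : forall a : k, exists b : k, b ^+ p = a)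
    (X : kfunctor k) (schX : is_scheme X) (smX : smooth X)
    (girrX : geometrically_irreducible X) :
  (forall t : nat, rigid_abelian_tensor_category (StratCat chark perf X t)) /\
  (forall t : nat, fully_faithful_embedding (plus chark perf X t)) /\
  (forall (x : X (kbase k)) (t : nat),
     is_fiber_functor (omega chark perf t x) /\
     neutral_Tannaka_category (omega chark perf t x)).
Proof.
have chX := smooth_charted chark perf smX; split; [|split=> [t|x t]].
- by move=> t; exact: strat_rigid_abelian_tensor.
- exact: plus_fully_faithful.
- by split; [exact: omega_fiber|exact: omega_neutral_Tannaka].
Qed.
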